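(* Let $a$ and $b$ be two free random variables in a non-commutative probability space, with free cumulants $(\kappa_n(a))_{n\ge1}$, $(\kappa_n(b))_{n\ge1}$, and let $(\kappa_n(ab+ba))_{n\ge1}$ be the free cumulants of $ab+ba$. Then, for every $n\ge1$, $$\kappa_n(ab+ba)=\sum_{\substack{(\mathcal{G},C)\in OCG_n\\ \mathcal{G}\text{ is bipartite}}}2^{f_C}\Bigg(\prod_{v\in V'_{\mathcal{G}}}\kappa_{d(v)}(a)\prod_{w\in V''_{\mathcal{G}}}\kappa_{d(w)}(b)+\prod_{v\in V'_{\mathcal{G}}}\kappa_{d(v)}(b)\prod_{w\in V''_{\mathcal{G}}}\kappa_{d(w)}(a)\Bigg),$$ where $f_C$ is the number of flexible edges of $\mathcal{G}$ without counting the first edge of $C$, $(V'_{\mathcal{G}},V''_{\mathcal{G}})$ is the unique bipartition of the vertex set $V_{\mathcal{G}}$ such that $V'_{\mathcal{G}}$ contains the first vertex of $C$, and $d(v)$ is the degree of the vertex $v$ in $\mathcal{G}$.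
   Context: A non-commutative probability space $(\mathcal{A},\varphi)$ is a unital algebra over $\mathbb{C}$ with a linear functional $\varphi$, $\varphi(1)=1$. The free cumulants are the multilinear functionals $\kappa_n:\mathcal{A}^n\to\mathbb{C}$ determined recursively by $\varphi(a_1\cdots a_n)=\sum_{\pi\in\mathcal{NC}(n)}\prod_{V\in\pi}\kappa_{|V|}(a_V)$, where $\mathcal{NC}(n)$ is the set of non-crossing partitions of $\{1,\dots,n\}$ and for $V=\{v_1<\dots<v_k\}$, $\kappa_{|V|}(a_V)=\kappa_k(a_{v_1},\dots,a_{v_k})$; $\kappa_n(a):=\kappa_n(a,\dots,a)$. Freeness is free independence, equivalently vanishing of mixed free cumulants in $a,b$. Cacti. In a graph with loops and multiple edges allowed, a cycle is a finite sequence $(v_1,e_1,\dots,v_j,e_j)$ of vertices and edges such that $e_i$ connects $v_i$ with $v_{i+1}$ for $i=1,\dots,j$ (with $v_{j+1}=v_1$); repetitions are allowed. A simple cycle is a cycle with pairwise distinct vertices and pairwise distinct edges, considered up to cyclic rotation and reversal (a loop gives one with $j=1$, a pair of parallel edges one with $j=2$). A cactus is a connected graph in which every edge belongs to at most one simple cycle; an edge is rigid if it belongs to a simple cycle and flexible otherwise. An outercycle (orientation) of a cactus $\mathcal{G}$ is a cycle $C$ passing exactly once through every rigid edge and exactly twice through every flexible edge. Outercycles $C=(v_1,e_1,\dots,v_j,e_j)$ and $C'=(v_1',e_1',\dots,v_j',e_j')$ of $\mathcal{G}$ are considered the same if some automorphism $g$ of $\mathcal{G}$ (acting on vertices and edges)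 satisfies $g(v_i)=v_i'$, $g(e_i)=e_i'$ for all $i$ (cyclic rotations are not otherwise identified). $OCG_n$ is the set of oriented cacti $(\mathcal{G},C)$ ($\mathcal{G}$ a cactus, $C$ an outercycle) with exactly $n$ edges, taken up to isomorphism (a graph isomorphism carrying one outercycle entrywise to the other). Loops count twice in the degree. *)

(* Defs.v *)
From HB Require Import structures.
From mathcomp Require Import all_boot all_order all_fingroup all_algebra.
From mathcomp Require Import complex boolp reals.

Set Implicit Arguments.
Unset Strict Implicit.
Unset Printing Implicit Defensive.

Import Order.TTheory GRing.Theory Num.Theory.
Local Open Scope ring_scope.

(** * Free cumulants and freeness

   The complex field is [R[i]] for an arbitrary [R : realType].  A
   non-commutative probability space is an [A : algType R[i]] with a linear
   form [phi : {scalar A}] such that [phi 1 = 1]. *)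

Definition noncrossing (n : nat) (P : {set {set 'I_n}}) : Prop :=
  forall B C, B \in P -> C \in P ->
  forall i j k l : 'I_n, (i < j)%N -> (j < k)%N -> (k < l)%N ->
  i \in B -> k \in B -> j \in C -> l \in C -> B = C.

Definition NC (n : nat) : {set {set {set 'I_n}}} :=
  [set P | partition P [set: 'I_n] && `[< noncrossing P >]].

(* [enum B] lists B increasingly, so this is (a_(v_1), ..., a_(v_k)). *)
Definition restr (T : nmodType) (s : seq T) (B : {set 'I_(size s)}) : seq T :=
  [seq s`_(i : 'I_(size s)) | i <- enum B].

(* The moment-cumulant formula solved for the term of the one-block partition;
   the fuel m is only there to make the recursion structural. *)
Fixpoint fcum_rec (R : realType) (A : algType R[i]) (phi : A -> R[i])
    (m : nat) (s : seq A) : R[i] :=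
  if m is m'.+1 then
    phi (\prod_(x <- s) x)
    - \sum_(P in NC (size s) | P != [set [set: 'I_(size s)]])
        \prod_(B in P) fcum_rec phi m' (restr B)
  else 0.

(* fcum phi [:: a_1; ...; a_n] is kappa_n(a_1, ..., a_n), for n >= 1. *)
Definition fcum (R : realType) (A : algType R[i]) (phi : A -> R[i])
    (s : seq A) : R[i] := fcum_rec phi (size s) s.

Definition kappa (R : realType) (A : algType R[i]) (phi : A -> R[i])
    (n : nat) (a : A) : R[i] := fcum phi (nseq n a).

(* Free independence of the unital subalgebras {p(a)} and {p(b)}; the boolean c
   tells whether the alternating product starts in the first or the second. *)
Definition free_indep (R : realType) (A : algType R[i]) (phi : A -> R[i])
    (a b : A) : Prop :=
  forall (c : bool) (n : nat) (p : 'I_n -> {poly R[i]}),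
  let x (i : 'I_n) := horner_alg (if c (+) odd i then b else a) (p i) in
  (0 < n)%N -> (forall i, phi (x i) = 0) -> phi (\prod_(i < n) x i) = 0.

(** * Cacti *)

(* A multigraph with vertices V and edges E is its map from edges to sets of
   endpoints; a loop at v is an edge e with [G e = [set v; v] = [set v]]. *)
Definition multigraph (V E : finType) (G : {ffun E -> {set V}}) : Prop :=
  forall e, exists u v, G e = [set u; v].

Definition connected (V E : finType) (G : {ffun E -> {set V}}) : Prop :=
  (0 < #|V|)%N /\
  forall u v, connect [rel x y | [exists e, G e == [set x; y]]] u v.

(* Loops count twice. *)
Definition degree (V E : finType) (G : {ffun E -> {set V}}) (v : V) : nat :=
  #|[set e | v \in G e]| + #|[set e | G e == [set v]]|.

(* The cycle (v_1, e_1, ..., v_j, e_j) is the sequence of the pairs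
   (v_i, e_i). *)
Definition gcycle (V E : finType) (G : {ffun E -> {set V}})
    (C : seq (V * E)) : bool :=
  path.cycle (fun p q : V * E => G p.2 == [set p.1; q.1]) C.

Definition simple_cycle (V E : finType) (G : {ffun E -> {set V}})
    (C : seq (V * E)) : bool :=
  [&& gcycle G C, uniq (unzip1 C) & uniq (unzip2 C)].

(* (v_1, e_1, ..., v_j, e_j) is reversed to
   (v_1, e_j, v_j, e_(j-1), ..., v_2, e_1). *)
Definition rev_cycle (V E : finType) (C : seq (V * E)) : seq (V * E) :=
  zip (rotr 1 (rev (unzip1 C))) (rev (unzip2 C)).

Definition same_cycle (V E : finType) (C D : seq (V * E)) : Prop :=
  exists k, D = rot k C \/ D = rot k (rev_cycle C).

Definition cactus (V E : finType) (G : {ffun E -> {set V}}) : Prop :=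
  [/\ multigraph G, connected G
    & forall (e : E) (C D : seq (V * E)),
        simple_cycle G C -> simple_cycle G D ->
        e \in unzip2 C -> e \in unzip2 D -> same_cycle C D].

Definition rigid (V E : finType) (G : {ffun E -> {set V}}) (e : E) : Prop :=
  exists C : seq (V * E), simple_cycle G C /\ e \in unzip2 C.

Definition flexible (V E : finType) (G : {ffun E -> {set V}}) (e : E) : Prop :=
  ~ rigid G e.

Definition outercycle (V E : finType) (G : {ffun E -> {set V}})
    (C : seq (V * E)) : Prop :=
  [/\ gcycle G C,
      forall e, rigid G e -> count_mem e (unzip2 C) = 1%N
    & forall e, flexible G e -> count_mem e (unzip2 C) = 2].

(* The number f_C; the first edge of C is the head of [unzip2 C]. *)
Definition nflex (V E : finType) (G : {ffun E -> {set V}})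
    (C : seq (V * E)) : nat :=
  #|[set e | `[< flexible G e >] && (ohead (unzip2 C) != Some e)]|.

(* The bipartition with classes S and its complement. *)
Definition bipartition (V E : finType) (G : {ffun E -> {set V}})
    (S : {set V}) : bool :=
  [forall e, [exists u in S, [exists v in ~: S, G e == [set u; v]]]].

Definition bipartite (V E : finType) (G : {ffun E -> {set V}}) : bool :=
  [exists S, bipartition G S].

(* V'_G, the class containing the first vertex of C; V''_G is its
   complement. *)
Definition first_part (V E : finType) (G : {ffun E -> {set V}})
    (C : seq (V * E)) : {set V} :=
  odflt set0
    [pick S | bipartition G S & if C is p :: _ then p.1 \in S else false].

(** * Oriented cacti up to isomorphism *)

(* Every outercycle of a cactus with n edges has length at most 2n. *)
Definition orgraph (n m : nat) : predArgType :=
  ({ffun 'I_n -> {set 'I_m}} * n.*2.-bseq ('I_m * 'I_n))%type.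

Definition oriented_cactus (n m : nat) (x : orgraph n m) : Prop :=
  cactus x.1 /\ outercycle x.1 x.2.

Definition oc_iso (n m : nat) (x y : orgraph n m) : bool :=
  [exists s : 'S_m, exists t : 'S_n,
     [forall e, y.1 (t e) == s @: x.1 e]
     && ([seq (s p.1, t p.2) | p <- x.2] == y.2 :> seq _)].

Definition labelled_OC (n m : nat) : {set orgraph n m} :=
  [set x | `[< oriented_cactus x >]].

(* One representative of every isomorphism class of oriented cacti with n edges
   and m vertices. *)
Definition OCG (n m : nat) : {set orgraph n m} :=
  transversal (equivalence_partition (@oc_iso n m) (labelled_OC n m))
              (labelled_OC n m).

(** * Basic facts *)

Lemma oc_iso_equiv (n m : nat) : equivalence_rel (@oc_iso n m).
Proof.
have isoP (x y : orgraph n m) : reflect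
    (exists (s : 'S_m) (t : 'S_n), (forall e, y.1 (t e) = s @: x.1 e) /\
       [seq (s p.1, t p.2) | p <- x.2] = y.2 :> seq _) (oc_iso x y).
  apply: (iffP existsP) => [[s /existsP[t /andP[/forallP h /eqP h']]]|].
    by exists s, t; split => // e; exact/eqP.
  move=> [s [t [h h']]]; exists s; apply/existsP; exists t.
  by rewrite h' eqxx andbT; apply/forallP => e; rewrite h.
have refl (x : orgraph n m) : oc_iso x x.
  apply/isoP; exists 1%g, 1%g; split => [e|].
    rewrite perm1; apply/setP => v; apply/idP/imsetP => [vx|[w wx ->]].
      by exists v; rewrite ?perm1.
    by rewrite perm1.
  by rewrite -[RHS]map_id; apply: eq_map => -[u e] /=; rewrite !perm1.
have sym (x y : orgraph n m) : oc_iso x y -> oc_iso y x.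
  move=> /isoP[s [t [h h']]]; apply/isoP; exists s^-1%g, t^-1%g; split => [e|].
    rewrite -{2}(permKV t e) h -imset_comp -[LHS]imset_id.
    by apply: eq_imset => v /=; rewrite permK.
  rewrite -h' -map_comp -[RHS]map_id; apply: eq_map => -[u e] /=.
  by rewrite !permK.
have trans (x y z : orgraph n m) : oc_iso x y -> oc_iso y z -> oc_iso x z.
  move=> /isoP[s [t [h h']]] /isoP[s' [t' [k k']]].
  apply/isoP; exists (s * s')%g, (t * t')%g; split => [e|].
    rewrite permM k h -imset_comp; by apply: eq_imset => v; rewrite /= permM.
  rewrite -k' -h' -map_comp; by apply: eq_map => -[u e]; rewrite /= !permM.
move=> x y z; split=> [|xy]; first exact: refl.
apply/idP/idP; first exact/trans/sym.
exact: trans.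
Qed.

Lemma OCG_transversal (n m : nat) :
  is_transversal (OCG n m)
    (equivalence_partition (@oc_iso n m) (labelled_OC n m)) (labelled_OC n m).
Proof.
by apply/transversalP/equivalence_partitionP => x y z _ _ _; exact: oc_iso_equiv.
Qed.

(* The bipartition in [first_part] is unique. *)
Lemma bipartition_uniq (V E : finType) (G : {ffun E -> {set V}})
    (S T : {set V}) (v : V) : connected G -> bipartition G S ->
  bipartition G T -> v \in S -> v \in T -> S = T.
Proof.
move=> [_ conn] /forallP bS /forallP bT vS vT; apply/setP => w.
have bip (U : {set V}) x y e :
    [exists u in U, [exists w in ~: U, G e == [set u; w]]] ->
    G e = [set x; y] -> (y \in U) = (x \notin U).
  move=> /existsP[u /andP[uU /existsP[z /andP[]]]].
  rewrite inE => zU /eqP -> eq_xy.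
  have ux : u \in [set x; y] by rewrite -eq_xy !inE eqxx.
  have zx : z \in [set x; y] by rewrite -eq_xy !inE eqxx orbT.
  move: ux zx; rewrite !inE => /orP[/eqP ex|/eqP ex] /orP[/eqP ey|/eqP ey];
    subst; rewrite ?uU ?(negbTE zU) //; by rewrite uU in zU.
have /connectP[p] := conn v w; elim: p v vS vT => [|y p IH] v vS vT /=.
  by move=> _ ->; rewrite vS vT.
suff st x : (x \in S) = (x \in T) -> forall p, path
  [rel x y | [exists e, G e == [set x; y]]] x p ->
  (last x p \in S) = (last x p \in T).
  by move=> h ->; apply: (st v _ (y :: p)) => //; rewrite vS vT.
move=> e q; elim: q x e => //= z q IHq x e /andP[/existsP[d /eqP Gd] zq].
by apply: IHq => //; rewrite (bip _ _ _ _ (bS d) Gd) (bip _ _ _ _ (bT d) Gd) e.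
Qed.

(* The recursion defining the free cumulants. *)
Lemma moment_cumulant (R : realType) (A : algType R[i]) (phi : A -> R[i])
    (s : seq A) : phi 1 = 1 ->
  phi (\prod_(x <- s) x)
  = \sum_(P in NC (size s)) \prod_(B in P) fcum phi (restr B).
Proof.
move=> phi1.
have size_restr (t : seq A) (B : {set 'I_(size t)}) : size (restr B) = #|B|.
  by rewrite size_map -cardE.
have lt_block (n : nat) (P : {set {set 'I_n}}) B : P \in NC n ->
    P != [set setT] -> B \in P -> (#|B| < n)%N.
  rewrite inE => /andP[/and3P[/eqP cov /trivIsetP triv n0] _] PT BP.
  rewrite -[X in (_ < X)%N]card_ord -cardsT proper_card // properT.
  apply: contra PT => /eqP BT; subst B.
  apply/eqP/setP => B; rewrite inE; apply/idP/eqP => [BP'|-> //].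
  apply/eqP; apply: contraNT n0 => /(triv _ _ BP' BP).
  by rewrite -setI_eq0 setIT => /eqP <-.
have fuel k m m' (t : seq A) : (size t < k)%N -> (0 < size t)%N ->
    (size t <= m)%N -> (size t <= m')%N -> fcum_rec phi m t = fcum_rec phi m' t.
  elim: k t m m' => // k IH t [|m] [|m'] tk t0.
  - by [].
  - by rewrite leqNgt t0.
  - by move=> _; rewrite leqNgt t0.
  move=> tm tm' /=; congr (_ - _).
  apply: eq_bigr => P /andP[PN PT]; apply: eq_bigr => B BP.
  have ltB := lt_block _ _ _ PN PT BP.
  apply: IH; rewrite size_restr.
  - by rewrite -ltnS (leq_trans _ tk).
  - move: PN; rewrite inE => /andP[/and3P[_ _ n0] _].
    by rewrite card_gt0; apply: contraNneq n0 => <-.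
  - by rewrite -ltnS (leq_trans ltB).
  - by rewrite -ltnS (leq_trans ltB).
have [/size0nil -> | s0] := posnP (size s).
  rewrite big_nil phi1 (big_pred1 set0) ?big_set0 // => P /=; apply/idP/eqP.
    rewrite inE => /andP[/and3P[_ _ n0] _]; apply/setP => B; rewrite inE.
    apply: contraNF n0; suff -> : B = set0 by [].
    by apply/setP => -[].
  move=> ->; rewrite inE; apply/andP; split; last first.
    by apply/asboolP => B C; rewrite inE.
  have -> : [set: 'I_0] = set0 by apply/setP => -[].
  by rewrite partition_set0.
have T_NC : [set setT] \in NC (size s).
  rewrite inE; apply/andP; split; last first.
    by apply/asboolP => B C; rewrite !inE => /eqP -> /eqP ->.
  apply/and3P; split.
  - by rewrite /cover big_set1.
  - by apply/trivIsetP => B C; rewrite !inE => /eqP -> /eqP ->; rewrite eqxx.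
  - by rewrite inE eq_sym -card_gt0 cardsT card_ord.
rewrite (bigD1 _ T_NC) /= big_set1.
have -> : restr [set: 'I_(size s)] = s.
  rewrite /restr enum_setT -enumT -[RHS](mkseq_nth 0) /mkseq -val_enum_ord.
  by rewrite -map_comp.
have -> : fcum phi s = fcum_rec phi (size s).+1 s by apply: (fuel (size s).+1).
rewrite /= -addrA -[LHS]addr0; congr (_ + _).
apply/esym/eqP; rewrite addrC subr_eq0; apply/eqP.
apply: eq_bigr => P /andP[PN PT]; apply: eq_bigr => B BP.
have ltB := lt_block _ _ _ PN PT BP.
apply: (fuel (size s)); rewrite size_restr ?(ltnW ltB) //.
move: (PN : P \in NC _); rewrite inE => /andP[/and3P[_ _ n0] _].
by rewrite card_gt0; apply: contraNneq n0 => <-.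
Qed.

(* Main.v *)
Require Import Defs.
From HB Require Import structures.
From mathcomp Require Import all_boot all_order all_fingroup all_algebra.
From mathcomp Require Import qpoly complex boolp reals.
From mathcomp Require Import ring zify.

Set Implicit Arguments.
Unset Strict Implicit.
Unset Printing Implicit Defensive.

Import Order.TTheory GRing.Theory Num.Theory.
Local Open Scope ring_scope.

(* An outercycle of a cactus, read from its first vertex, splits into excursions
   along a flexible edge or around a simple cycle.  This encodes an oriented
   cactus up to isomorphism by a plane tree whose inner nodes are the flexible
   edges and the simple cycles, and the weight in the theorem factors along that
   tree; trees with an odd cycle get weight 0.  It remains to show that the
   cumulant series C of x = ab + ba is the generating series K of the weighted
   trees.  Modulo s^N, the moment series of x is characterized by
   M(z) = 1 + C(s) whenever z (1 + C(s)) = s, so it suffices to have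
   \sum_j z^j phi(x^j) = 1 + K for the z with z (1 + K) = s.  By freeness phi
   kills the nontrivial alternating products E(w) of free Appell polynomials of a
   and b, and multiplication by a or b acts on the E(w) by explicit triangular
   formulas.
   The tree series provide a function g of words such that
   t_j = \sum_w g(w) phi(x^j E(w)) has t_0 = 1 and
   phi(x^j) = (1 + K) t_j - s t_(j+1); summing against z^j telescopes. *)

(** * Non-crossing partitions and the functional equation of the moment series *)

(** What ties trees to words is one recurrence. The excursions at a vertex of colour c are flexible
    edges, adding 1 to its degree, and cycles, adding 2, so the series of trees of root degree k
    satisfies h_(k+2) = xx c * h_(k+1) + yy c * h_k. On a run of the letter c, g obeys the same
    recurrence in the length of the run; there the 2 in xx c = 2 s f(~~c), the source of 2^(f_C), is
    the trace of a 2x2 matrix. Multiplication by a letter pairs the cumulants with the values of g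
    on runs, and these sums give the tree series f and r. A factor ab or ba needs two
    multiplications, hence a second function [G1] for the words met between its two letters. Power
    series are replaced by elements of a ring with s^N = 0: sums over words become finite because
    every two letters of w put a factor s into g(w), and uniqueness of solutions becomes an
    iteration argument. On the graph side the obstacle is that rigidity quantifies over all simple
    cycles. It is controlled by vertex sets U: a closed walk crosses the boundary of U an even
    number of times. *)

Section NoncrossingSums.
Variable N : nat.
Implicit Types (A B D : {set 'I_N}) (P Q : {set {set 'I_N}}).

(** Partitions of arbitrary subsets of ['I_N] let the induction remove points and split the ground
    set without relabelling. *)
Definition NCD D : {set {set {set 'I_N}}} :=
  [set P | partition P D && `[< noncrossing P >]].

Lemma partitionU A B P Q : [disjoint A & B] ->
  partition P A -> partition Q B -> partition (P :|: Q) (A :|: B).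
Proof.
move=> dAB pP pQ; apply/and3P; split.
- by rewrite /cover bigcup_setU -/(cover P) -/(cover Q) !(cover_partition pP, cover_partition pQ).
- apply/trivIsetP => X Y; rewrite !inE.
  have tP := trivIsetP (partition_trivIset pP).
  have tQ := trivIsetP (partition_trivIset pQ).
  have PQ X' Y' : X' \in P -> Y' \in Q -> [disjoint X' & Y'].
    move=> /(partitionS pP) XA /(partitionS pQ) YB.
    exact: disjointWl XA (disjointWr YB dAB).
  move=> /orP[XP|XQ] /orP[YP|YQ] XY; [exact: tP| exact: PQ| |exact: tQ].
  by rewrite disjoint_sym; apply: PQ.
- by rewrite inE (partition0 pP) (partition0 pQ).
Qed.

Lemma noncrossingS P Q : P \subset Q -> noncrossing Q -> noncrossing P.
Proof. by move=> /subsetP s h B C /s ? /s ?; apply: h. Qed.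

(** When A lies entirely before B, a block inside A and a block inside B cannot cross, so the two
    sides can be partitioned independently. *)
Lemma sum_split (K : comNzRingType) A B (F : {set {set 'I_N}} -> K) :
  (forall i j, i \in A -> j \in B -> (i < j)%N) ->
  \sum_(P in NCD (A :|: B) | [forall X in P, (X \subset A) || (X \subset B)]) F P
  = \sum_(P in NCD A) \sum_(Q in NCD B) F (P :|: Q).
Proof.
move=> AB; have dAB : [disjoint A & B].
  apply/pred0P => i /=; apply/negP => /andP[iA iB].
  by have := AB _ _ iA iB; rewrite ltnn.
rewrite pair_big /=.
rewrite (reindex_onto (fun u : {set {set 'I_N}} * {set {set 'I_N}} => u.1 :|: u.2)
  (fun P => ([set X in P | X \subset A], [set X in P | X \subset B]))) /=; last first.
  move=> P /andP[_ /forall_inP h]; apply/setP => X; rewrite !inE -andb_orr.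
  by case XP: (X \in P) => //=; exact: h.
apply: eq_bigl => -[P Q] /=; rewrite !inE xpair_eqE.
apply/idP/idP.
  case/andP=> [/andP[/andP[pPQ /asboolP nPQ] /forall_inP sPQ] /andP[/eqP eP /eqP eQ]].
  have n0 X : X \in P :|: Q -> X != set0 by exact: partition_neq0 pPQ.
  have sub (C : {set 'I_N}) : (C == A) || (C == B) -> partition [set X in P :|: Q | X \subset C] C.
    move=> CAB; apply/and3P; split.
    - rewrite eqEsubset; apply/andP; split.
        by apply/bigcupsP => X; rewrite inE => /andP[].
      apply/subsetP => x xC.
      have : x \in cover (P :|: Q).
        rewrite (cover_partition pPQ) inE.
        by case/orP: CAB => /eqP <-; rewrite xC ?orbT.
      case/bigcupP => X XPQ xX; apply/bigcupP; exists X => //.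
      rewrite inE XPQ /=.
      case/orP: (sPQ _ XPQ) => s; case/orP: CAB => /eqP E; subst C => //.
        by have := AB x x (subsetP s _ xX) xC; rewrite ltnn.
      by have := AB x x xC (subsetP s _ xX); rewrite ltnn.
    - by apply: trivIsetS (partition_trivIset pPQ); apply/subsetP => X; rewrite inE => /andP[].
    - by rewrite inE (partition0 pPQ).
  have pP := sub A; have pQ := sub B; rewrite eqxx eP in pP; rewrite eqxx orbT eQ in pQ.
  rewrite pP // pQ //=; apply/andP; split; apply/asboolP; apply: noncrossingS nPQ.
    exact: subsetUl.
  exact: subsetUr.
case/andP=> /andP[pP /asboolP nP] /andP[pQ /asboolP nQ].
rewrite partitionU //=; apply/andP; split; first apply/andP; first split.
- apply/asboolP => X Y; rewrite !inE => XPQ YPQ i j k l ij jk kl iX kX jY lY.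
  case/orP: XPQ => XP; case/orP: YPQ => YP.
  + exact: nP ij jk kl iX kX jY lY.
  + have kA := subsetP (partitionS pP XP) _ kX.
    have jB := subsetP (partitionS pQ YP) _ jY.
    by have := AB _ _ kA jB; rewrite ltnNge (ltnW jk).
  + have iB := subsetP (partitionS pQ XP) _ iX.
    have jA := subsetP (partitionS pP YP) _ jY.
    by have := AB _ _ jA iB; rewrite ltnNge (ltnW ij).
  + exact: nQ ij jk kl iX kX jY lY.
- apply/forall_inP => X; rewrite inE => /orP[/(partitionS pP)|/(partitionS pQ)] -> //.
  by rewrite orbT.
- have nsub (X C C' : {set 'I_N}) : X != set0 -> [disjoint C & C'] -> X \subset C ->
      X \subset C' = false.
    move=> X0 dC XC; apply: contraNF X0 => XC'.
    by rewrite -subset0; rewrite -setI_eq0 in dC; rewrite -(eqP dC) subsetI XC.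
  apply/andP; split; apply/eqP/setP => X; rewrite !inE.
    case XP : (X \in P) => /=; first by rewrite (partitionS pP XP).
    case XQ : (X \in Q) => //=.
    by rewrite (nsub _ B A) ?(partition_neq0 pQ XQ) ?(partitionS pQ XQ) 1?disjoint_sym.
  case XQ : (X \in Q) => /=; first by rewrite (partitionS pQ XQ) orbT.
  case XP : (X \in P) => //=.
  by rewrite (nsub _ A B) ?(partition_neq0 pP XP) ?(partitionS pP XP).
Qed.

(* No block of [P] meets both [0, j) and [j, N). *)
Definition cutb (j : 'I_N) P :=
  [forall X in P, (X \subset [set i : 'I_N | (i < j)%N]) || (X \subset [set i : 'I_N | (j <= i)%N])].

Definition ins (d j : 'I_N) P := (d |: pblock P j) |: (P :\ pblock P j).

Section Insert.
Variables (d : 'I_N) (D : {set 'I_N}).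
Hypothesis ltD : forall i, i \in D -> (d < i)%N.

Let dD : d \notin D.
Proof. by apply/negP => /ltD; rewrite ltnn. Qed.

Lemma NCD_single P : ([set d] |: P \in NCD (d |: D)) && ([set d] \notin P) = (P \in NCD D).
Proof.
apply/idP/idP.
  rewrite inE => /andP[/andP[pP /asboolP nP] dP].
  rewrite inE; have := partitionD1 pP (setU11 _ _).
  rewrite setU1K // setU1K // => -> /=; apply/asboolP; apply: noncrossingS nP.
  exact: subsetUr.
rewrite inE => /andP[pP /asboolP nP].
have dP : [set d] \notin P.
  by apply: contra dD => /(partitionS pP); rewrite sub1set.
rewrite dP andbT inE; apply/andP; split.
  apply: partitionU1 => //; first by rewrite -card_gt0 cards1.
  by rewrite disjoints1.
apply/asboolP => X Y; rewrite !inE => /orP[/eqP->|XP] /orP[/eqP->|YP] // i j k l ij jk kl.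
- rewrite !inE => /eqP iE /eqP kE; move: (ltn_trans ij jk).
  by rewrite iE kE ltnn.
- rewrite !inE => _ _ /eqP jE /eqP lE; move: (ltn_trans jk kl).
  by rewrite jE lE ltnn.
- exact: nP ij jk kl.
Qed.

Lemma ins_partition j P : j \in D -> P \in NCD D -> partition (ins d j P) (d |: D).
Proof.
rewrite inE => jD /andP[pP _].
have jc : j \in cover P by rewrite (cover_partition pP).
have BP : pblock P j \in P by rewrite pblock_mem.
have -> : d |: D = (d |: pblock P j) :|: (D :\: pblock P j).
  apply/setP => x; rewrite !inE.
  case: (boolP (x \in pblock P j)) => xB; last by rewrite orbF.
  by rewrite (subsetP (partitionS pP BP) _ xB) !orbT.
apply: partitionU1; first exact: partitionD1.
  by apply/set0Pn; exists d; rewrite setU11.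
apply/pred0P => x /=; rewrite !inE.
by case: (x \in _); rewrite ?andbF //= orbF; case: eqP => // ->; rewrite (negbTE dD).
Qed.

(** Unless d is alone in its block, let j be the next element of that block. Deleting d leaves a
    partition in which no block passes over the cut at j: a block with elements on both sides would
    cross d and j. *)
Lemma sum_insert (K : comNzRingType) (F : {set {set 'I_N}} -> K) :
  \sum_(P in NCD (d |: D)) F P =
  \sum_(P in NCD D) F ([set d] |: P)
  + \sum_(j in D) \sum_(P in NCD D | cutb j P) F (ins d j P).
Proof.
rewrite (bigID (fun P => [set d] \in P)) /=; congr (_ + _).
  rewrite (reindex_onto (fun P => [set d] |: P) (fun P => P :\ [set d])) /=; last first.
    by move=> P /andP[_ dP]; rewrite setD1K.
  apply: eq_bigl => P; rewrite setU11 andbT -NCD_single; congr (_ && _).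
  apply/eqP/idP => [<-|dP]; first by rewrite !inE eqxx.
  by rewrite setU1K.
rewrite pair_big_dep /=.
pose B0 P := pblock P d.
pose jm P := odflt d [pick j in B0 P :\ d | [forall i in B0 P :\ d, (j <= i)%N]].
pose rem P := (B0 P :\ d) |: (P :\ B0 P).
have fwd P : P \in NCD (d |: D) -> [set d] \notin P ->
    [/\ jm P \in D, rem P \in NCD D, cutb (jm P) (rem P) & ins d (jm P) (rem P) = P].
  rewrite inE => /andP[pP /asboolP nP] dP.
  have [B0P dB0] : B0 P \in P /\ d \in B0 P.
    by rewrite pblock_mem ?mem_pblock (cover_partition pP) setU11.
  have disj X Y x : X \in P -> Y \in P -> x \in X -> x \in Y -> X = Y.
    move=> XP YP xX xY; rewrite -(def_pblock (partition_trivIset pP) XP xX).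
    exact: (def_pblock (partition_trivIset pP) YP xY).
  have /setD1P[jd jB] : jm P \in B0 P :\ d.
    rewrite /jm; case: pickP => [j /andP[]//|] h.
    have /set0Pn[i iB] : B0 P :\ d != set0.
      apply: contra dP; rewrite setD_eq0 subset1 => /orP[/eqP <- //|/eqP E].
      by rewrite E inE in dB0.
    case: (arg_minnP (fun i => val i) iB) => j jB jmin.
    have /negP := h j; case; apply/andP; split; first exact: jB.
    by apply/forall_inP => k; exact: jmin.
  have jmin i : i \in B0 P -> i != d -> (jm P <= i)%N.
    move=> iB id; move: (jB) (jd); rewrite /jm; case: pickP => [j|] /=; last by rewrite eqxx.
    by move=> /andP[_ /forall_inP] h _ _; apply: h; rewrite !inE id.
  have inD x : x \in cover P -> x != d -> x \in D.
    by rewrite (cover_partition pP) !inE => /orP[/eqP->|//]; rewrite eqxx.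
  have inD' X x : X \in P -> x \in X -> x != d -> x \in D.
    by move=> XP xX; apply: inD; apply/bigcupP; exists X.
  have jD : jm P \in D by apply: inD' B0P jB jd.
  have remP : B0 P :\ d \notin P.
    apply/negP => rP; have jr : jm P \in B0 P :\ d by rewrite !inE jd.
    by have := disj _ _ _ rP B0P jr jB; move/setP/(_ d); rewrite !inE eqxx dB0.
  have pR : partition (rem P) D.
    have -> : D = (B0 P :\ d) :|: ((d |: D) :\: B0 P).
      apply/setP => x; rewrite !inE.
      have [->|xd] /= := eqVneq x d; first by rewrite dB0 (negbTE dD).
      case: (boolP (x \in B0 P)) => //= xB; exact: inD' B0P xB xd.
    apply: partitionU1; first exact: partitionD1.
      by apply/set0Pn; exists (jm P); rewrite !inE jd.
    by apply/pred0P => x /=; rewrite !inE; case: (x \in B0 P); rewrite ?andbF.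
  (* [e] sends a block of [rem P] to the block of P containing it. It is injective, so a crossing in
     [rem P] would be one in P. *)
  pose e X := if X == B0 P :\ d then B0 P else X.
  have eP X : X \in rem P -> (e X \in P) * {subset X <= e X}.
    rewrite /e !inE; case: eqP => [-> _|_ /andP[_ XP]]; last by split.
    by split => // x; rewrite inE => /andP[].
  have einj : {in rem P &, injective e}.
    move=> X Y; rewrite /e !inE.
    have [->|_] := eqVneq X (B0 P :\ d); have [->|_] := eqVneq Y (B0 P :\ d) => //=.
      by move=> _ /andP[/negP h _] E; case: h; rewrite E.
    by move=> /andP[/negP h _] _ E; case: h; rewrite E.
  split => //.
  - rewrite inE pR; apply/asboolP => X Y XR YR i j k l ij jk kl iX kX jY lY.
    have [eX sX] := eP _ XR; have [eY sY] := eP _ YR.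
    apply: einj => //.
    exact: nP _ _ eX eY _ _ _ _ ij jk kl (sX _ iX) (sX _ kX) (sY _ jY) (sY _ lY).
  - apply/forall_inP => X; rewrite !inE => /orP[/eqP ->|/andP[XB XP]].
      apply/orP; right; apply/subsetP => i; rewrite !inE => /andP[id iB].
      exact: jmin.
    have nX x : x \in X -> x != d /\ x != jm P.
      move=> xX; split; apply: contraNneq XB => E; rewrite E in xX.
        by apply/eqP; apply: disj XP B0P xX dB0.
      by apply/eqP; apply: disj XP B0P xX jB.
    case: (boolP (X \subset _)) => //= /subsetPn[k kX]; rewrite inE -leqNgt => jk.
    have [kd kj] := nX _ kX.
    apply/subsetP => i iX; rewrite inE leqNgt; apply: contra XB => ij.
    have [id _] := nX _ iX; apply/eqP/esym.
    apply: (nP _ _ B0P XP d i (jm P) k) => //.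
      by apply: ltD; apply: inD' XP iX id.
    by rewrite ltn_neqAle jk andbT eq_sym.
  - have pE : pblock (rem P) (jm P) = B0 P :\ d.
      by apply: (def_pblock (partition_trivIset pR)); rewrite !inE ?eqxx // jd.
    rewrite /ins /= pE setD1K // /rem setU1K ?setD1K //.
    by rewrite !inE negb_and remP orbT.
rewrite (reindex_onto (fun u => ins d u.1 u.2) (fun P => (jm P, rem P))) /=; last first.
  by move=> P /andP[PN dP]; have [] := fwd _ PN dP.
apply: eq_bigl => -[j P] /=; rewrite xpair_eqE.
apply/idP/idP.
  case/andP=> /andP[iN id] /andP[/eqP E1 /eqP E2]; have [] := fwd _ iN id.
  by rewrite E1 E2 => -> -> ->.
case/and3P => jD; rewrite inE => /andP[pP /asboolP nP] cP.
have jc : j \in cover P by rewrite (cover_partition pP).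
pose B := pblock P j.
have BP : B \in P by rewrite pblock_mem.
have jB : j \in B by rewrite mem_pblock.
have dj : d != j by apply: contraTneq jD => <-.
have dX X : X \in P -> d \notin X.
  by move=> /(partitionS pP)/subsetP h; apply/negP => /h; apply/negP.
have dP X : X \in P -> (d |: X) \notin P.
  by move=> XP; apply/negP => /dX; rewrite setU11.
have insE : ins d j P = (d |: B) |: (P :\ B) by [].
have pI : partition (ins d j P) (d |: D).
  by apply: ins_partition; rewrite // inE pP; apply/asboolP.
have dI : [set d] \notin ins d j P.
  rewrite insE !inE negb_or; apply/andP; split.
    by apply/eqP => /setP/(_ j); rewrite !inE jB orbT eq_sym (negbTE dj).
  by rewrite negb_and; apply/orP; right; apply/negP => /dX; rewrite inE eqxx.
have Bmin i : i \in B -> (j <= i)%N.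
  move=> iB; have := forall_inP cP _ BP => /orP[] /subsetP h.
    by have := h _ jB; rewrite inE ltnn.
  by have := h _ iB; rewrite inE.
have B0E : B0 (ins d j P) = d |: B.
  by apply: (def_pblock (partition_trivIset pI)); rewrite ?insE setU11.
have remE : rem (ins d j P) = P.
  rewrite /rem B0E setU1K ?dX // insE setU1K ?setD1K //.
  by rewrite !inE negb_and; apply/orP; right; apply: dP.
have jmE : jm (ins d j P) = j.
  rewrite /jm B0E setU1K ?dX //; case: pickP => [k /andP[kB /forall_inP kmin]|h] /=.
    by apply/val_inj/anti_leq; rewrite kmin // Bmin.
  have /negP := h j; case; apply/andP; split; first exact: jB.
  by apply/forall_inP => k; exact: Bmin.
rewrite remE jmE !eqxx dI inE pI /= !andbT; apply/asboolP.
move=> X Y XI YI a b c l ab bc cl aX cX bY lY.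
pose e X := if X == d |: B then B else X.
have eI X' : X' \in ins d j P -> (e X' \in P) * (forall x, x \in X' -> x != d -> x \in e X').
  rewrite /e insE !inE; case: eqP => [-> _|_ /andP[_ XP]]; last by split.
  by split => // x; rewrite !inE => /orP[->|].
have einj : {in ins d j P &, injective e}.
  move=> X' Y'; rewrite /e insE !inE.
  have [->|_] := eqVneq X' (d |: B); have [->|_] := eqVneq Y' (d |: B) => //=.
    by move=> _ /andP[/negP h _] E; case: h; rewrite E.
  by move=> /andP[/negP h _] _ E; case: h; rewrite E.
apply: einj => //.
have [eX sX] := eI _ XI; have [eY sY] := eI _ YI.
have gtd x y : x \in d |: D -> (x < y)%N -> y != d.
  rewrite !inE => /orP[/eqP->|/ltD dx] xy; apply: contraTneq xy => ->; first by rewrite ltnn.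
  by rewrite -leqNgt ltnW.
have aD : a \in d |: D by apply: (subsetP (partitionS pI XI)).
have bd := gtd _ _ aD ab; have cd := gtd _ _ aD (ltn_trans ab bc).
have ld := gtd _ _ aD (ltn_trans (ltn_trans ab bc) cl).
have [ad|ad] := eqVneq a d; last first.
  exact: (nP _ _ eX eY a b c l ab bc cl (sX _ aX ad) (sX _ cX cd) (sY _ bY bd) (sY _ lY ld)).
have XE : e X = B.
  rewrite /e; case: eqP => // XB; move: XI; rewrite insE !inE; case: eqP => //= _ /andP[_ /dX].
  by rewrite -ad aX.
have cB : c \in B by rewrite -XE; apply: sX.
(* Only the case a = d is new, and j takes over the role of d: [cutb] excludes b < j, b = j
   identifies the two blocks, and otherwise j, b, c, l would cross in P. *)
have [bj|bj] := ltnP b j.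
  have := forall_inP cP _ eY => /orP[] /subsetP h.
    have := h l (sY _ lY ld); rewrite inE => lj.
    by have := leq_trans (ltn_trans cl lj) (Bmin _ cB); rewrite ltnn.
  by have := h b (sY _ bY bd); rewrite inE leqNgt bj.
rewrite XE; move: bj; rewrite leq_eqVlt => /orP[/eqP/val_inj E|jb].
  have bB : b \in B by rewrite -E.
  rewrite /B E; apply: (def_pblock (partition_trivIset pP)) => //; exact: sY.
exact: (nP _ _ BP eY j b c l jb bc cl jB cB (sY _ bY bd) (sY _ lY ld)).
Qed.

End Insert.

End NoncrossingSums.

Lemma set_min (N : nat) (D : {set 'I_N}) : (0 < #|D|)%N ->
  exists2 d, d \in D & forall i, i \in D -> (d <= i)%N.
Proof.
case/card_gt0P => i0 i0D; pose m := [arg min_(i < i0 | i \in D) val i].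
by exists m; rewrite /m; case: arg_minnP.
Qed.

Lemma set_max (N : nat) (D : {set 'I_N}) : (0 < #|D|)%N ->
  exists2 d, d \in D & forall i, i \in D -> (i <= d)%N.
Proof.
case/card_gt0P => i0 i0D; pose m := [arg max_(i > i0 | i \in D) val i].
by exists m; rewrite /m; case: arg_maxnP.
Qed.

Lemma noncrossing_set0 (N : nat) : NCD (set0 : {set 'I_N}) = [set set0].
Proof.
apply/setP => P; rewrite !inE partition_set0; apply: andb_idr => /eqP ->.
by apply/asboolP => B C; rewrite inE.
Qed.

(** Removing the maximum of D keeps the other ranks. The rank of j will be the number of points
    enclosed between d and j. *)
Lemma big_rank (K : comNzRingType) (N : nat) (D : {set 'I_N}) (h : nat -> K) :
  \sum_(j in D) h #|[set i in D | (i < j)%N]| = \sum_(r < #|D|) h r.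
Proof.
move En : #|D| => n; elim: n D En => [|n IH] D Dn.
  by move/eqP: Dn; rewrite cards_eq0 => /eqP ->; rewrite big_set0 big_ord0.
have [m mD mmax] : exists2 d, d \in D & forall i, i \in D -> (i <= d)%N.
  by apply: set_max; rewrite Dn.
rewrite (big_setD1 m) //= big_ord_recr /= addrC; congr (_ + _); last first.
  congr h; have : (#|D :\ m| = n)%N by move: Dn; rewrite (cardsD1 m) mD => -[].
  move=> <-; apply: eq_card => i; rewrite !inE andbC; apply: andb_id2r => iD.
  by rewrite ltn_neqAle mmax // andbT.
rewrite -(IH (D :\ m)); last by move: Dn; rewrite (cardsD1 m) mD => -[].
apply: eq_bigr => j; rewrite !inE => /andP[jm jD]; congr h; apply: eq_card => i.
rewrite !inE; case: eqVneq => //= ->; rewrite mD /=.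
by apply/negbTE; rewrite -leqNgt mmax.
Qed.

Section MomentSeries.
Variables (K : comNzRingType) (f : nat -> K).

Definition ncwt (N : nat) (P : {set {set 'I_N}}) : K := \prod_(B in P) f #|B|.

Definition ncsum (n : nat) : K := \sum_(P in NC n) ncwt P.

(* The block of [d] is weighted by [g] rather than by [f], so that removing
   elements from that block only shifts [g]. *)
Definition ncwt_at (N : nat) (g : nat -> K) (d : 'I_N) (P : {set {set 'I_N}}) : K :=
  g #|pblock P d| * \prod_(B in P :\ pblock P d) f #|B|.

Variable L : nat.

Definition momser : {poly K} := \poly_(m < L) ncsum m.

Local Notation M := momser.

(** The sum over n points whose minimum lies in a block of k + 1 elements: each factor ['X * M] is
    one element of the block with the points up to the next one, and g weights the block. *)
Let U (g : nat -> K) (n : nat) := \sum_(k < L) g k.+1 * (('X * M) ^+ k.+1)`_n.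

Lemma coef_XMexp k n : (n < k)%N -> (('X * M) ^+ k)`_n = 0.
Proof. by move=> nk; rewrite exprMn coefXnM nk. Qed.

(** One factor ['X * M] is peeled off the power; r is the number of points between the minimum and
    the next element of its block. *)
Lemma U_rec g n : (n < L)%N ->
  U g n.+1 = g 1%N * ncsum n
    + \sum_(r < n) ncsum r * U (fun k => g k.+1) (n - r)%N.
Proof.
move=> nL; have [L' LE] : exists L', L = L'.+1 by exists L.-1; rewrite prednK // (leq_trans _ nL).
have coefS k : (('X * M) ^+ k.+1)`_n.+1 = (M * ('X * M) ^+ k)`_n.
  by rewrite exprS -mulrA coefXM.
have firstE (F : nat -> K) : \sum_(k < L) F k = F 0%N + \sum_(k < L') F k.+1.
  by rewrite LE big_ord_recl.
have lastE (F : nat -> K) : \sum_(k < L) F k = \sum_(k < L') F k + F L'.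
  by rewrite LE big_ord_recr.
rewrite /U (firstE (fun k => g k.+1 * (('X * M) ^+ k.+1)`_n.+1)) coefS expr0 mulr1 coef_poly nL; congr (_ + _).
have -> : \sum_(r < n) ncsum r * \sum_(k < L) g k.+2 * (('X * M) ^+ k.+1)`_(n - r)
   = \sum_(k < L) g k.+2 * \sum_(r < n) ncsum r * (('X * M) ^+ k.+1)`_(n - r).
  under eq_bigr do rewrite mulr_sumr.
  rewrite exchange_big /=; apply: eq_bigr => k _; rewrite mulr_sumr.
  by apply: eq_bigr => r _; rewrite mulrCA.
rewrite (lastE (fun k => g k.+2 * \sum_(r < n) ncsum r * (('X * M) ^+ k.+1)`_(n - r))).
rewrite [X in _ = _ + g _ * X]big1 ?mulr0 ?addr0; last first.
  move=> r _; rewrite coef_XMexp ?mulr0 // -LE.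
  exact: leq_ltn_trans (leq_subr _ _) nL.
apply: eq_bigr => k _; rewrite coefS coefM big_ord_recr /= subnn coef_XMexp // mulr0 addr0.
congr (_ * _); apply: eq_bigr => r _; rewrite coef_poly (ltn_trans (ltn_ord r) nL) //.
Qed.

Lemma ncwt_atE (N : nat) (d : 'I_N) (D : {set 'I_N}) P : P \in NCD D -> d \in D ->
  ncwt P = ncwt_at f d P.
Proof.
rewrite inE => /andP[pP _] dD; rewrite /ncwt (big_setD1 (pblock P d)) //.
by rewrite pblock_mem ?(cover_partition pP).
Qed.

(* By induction on [D]: either [d] is a singleton, or [d] is inserted into the
   block of the next element [j] of its block, and the elements between [d] and
   [j] are partitioned separately. *)
Lemma sum_NCD (n N : nat) (D : {set 'I_N}) (d : 'I_N) g :
  #|D| = n -> (n < L)%N -> (forall i, i \in D -> (d < i)%N) ->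
  \sum_(P in NCD (d |: D)) ncwt_at g d P = U g n.+1.
Proof.
elim/ltn_ind: n N D d g => n IH N D d g Dn nL ltD.
have dD : d \notin D by apply/negP => /ltD; rewrite ltnn.
have Zrec N' (D' : {set 'I_N'}) m : #|D'| = m -> (m <= n)%N -> (0 < m)%N ->
    \sum_(P in NCD D') ncwt P = U f m.
  case: m => // m Dm mn _.
  have [e eD emin] : exists2 d, d \in D' & forall i, i \in D' -> (d <= i)%N.
    by apply: set_min; rewrite Dm.
  rewrite (eq_bigr _ (fun P PN => ncwt_atE PN eD)) -(setD1K eD).
  apply: IH => //; first by move: Dm; rewrite (cardsD1 e) eD => -[].
    exact: ltn_trans nL.
  by move=> i; rewrite !inE => /andP[ie iD]; rewrite ltn_neqAle eq_sym ie emin.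
(* The sum depends on #|D'| only, because [Zrec] gives the same value for D' and for all of
   ['I_m]. *)
have Z N' (D' : {set 'I_N'}) m : #|D'| = m -> (m <= n)%N ->
    \sum_(P in NCD D') ncwt P = ncsum m.
  case: m => [|m] Dm mn; last first.
    by rewrite (Zrec _ _ _ Dm) // /ncsum (Zrec _ setT m.+1) // cardsT card_ord.
  have Z0 N'' (D'' : {set 'I_N''}) : #|D''| = 0%N -> \sum_(P in NCD D'') ncwt P = 1.
    by move/eqP; rewrite cards_eq0 => /eqP ->; rewrite noncrossing_set0 big_set1 /ncwt big_set0.
  by rewrite Z0 // /ncsum (Z0 _ setT) // cardsT card_ord.
rewrite sum_insert // U_rec //; congr (_ + _).
  rewrite -(Z _ D n) // mulr_sumr; apply: eq_bigr => P.
  rewrite -(NCD_single ltD) => /andP[PN dP]; move: PN; rewrite inE => /andP[pP _].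
  have -> : ncwt_at g d ([set d] |: P) = g #|[set d]| * ncwt P.
    rewrite /ncwt_at (def_pblock (B := [set d]) (partition_trivIset pP)) ?setU11 ?inE //.
    by rewrite setU1K.
  by rewrite cards1.
transitivity (\sum_(j in D) ncsum #|[set i in D | (i < j)%N]| *
    U (fun k => g k.+1) (n - #|[set i in D | (i < j)%N]|)).
  apply: eq_bigr => j jD; set A := [set i in D | _]; pose B := [set i in D | (j <= i)%N].
  have DE : D = A :|: B.
    by apply/setP => i; rewrite !inE -andb_orr ltnNge orNb andbT.
  have AB i k : i \in A -> k \in B -> (i < k)%N.
    by rewrite !inE => /andP[_ ij] /andP[_]; apply: leq_trans.
  have jB : j \in B by rewrite inE jD /=.
  have cAB : (#|A| + #|B| = n)%N.
    rewrite -Dn DE cardsU.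
    suff -> : A :&: B = set0 by rewrite cards0 subn0.
    by apply/setP => i; rewrite !inE; case: ltnP; rewrite ?andbF.
  have B0 : (0 < #|B|)%N by apply/card_gt0P; exists j.
  transitivity (\sum_(P in NCD A) \sum_(Q in NCD B) ncwt P * ncwt_at (fun k => g k.+1) j Q).
    rewrite {1}DE.
    transitivity (\sum_(P in NCD (A :|: B) | [forall X in P, (X \subset A) || (X \subset B)])
        ncwt_at (fun k => g k.+1) j P).
      apply: eq_big => P.
        apply: andb_id2l; rewrite -DE inE => /andP[pP _]; apply: eq_forallb_in => X XP.
        have XD := partitionS pP XP.
        congr (_ || _); apply/subsetP/subsetP => h x xX; have := h x xX;
          by rewrite !inE ?(subsetP XD _ xX) // => /andP[].
      rewrite -DE => /andP[PN _]; move: (PN); rewrite inE => /andP[pP _].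
      have BP : pblock P j \in P by rewrite pblock_mem ?(cover_partition pP).
      have dB : d \notin pblock P j by apply: contra dD; apply/subsetP/(partitionS pP).
      have dP : (d |: pblock P j) \notin P.
        by apply: contra dD => /(partitionS pP); rewrite subUset sub1set => /andP[].
      have tI : trivIset (ins d j P).
        by have := ins_partition ltD jD PN => /partition_trivIset.
      have pE : pblock (ins d j P) d = d |: pblock P j.
        by apply: def_pblock; rewrite /ins ?setU11.
      rewrite /ncwt_at pE cardsU1 dB add1n /ins setU1K //.
      by rewrite !inE negb_and dP orbT.
    rewrite sum_split //; apply: eq_bigr => P PN; apply: eq_bigr => Q QN.
    move: PN QN; rewrite !inE => /andP[pP _] /andP[pQ _].
    have BQ : pblock Q j \in Q by rewrite pblock_mem ?(cover_partition pQ).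
    have dAB : [disjoint A & B].
      by apply/pred0P => i /=; apply/negP => /andP[iA /(AB _ _ iA)]; rewrite ltnn.
    have QP X : X \in Q -> X \notin P.
      move=> XQ; apply/negP => XP; have /set0Pn[x xX] := partition_neq0 pQ XQ.
      have := pred0P dAB x; rewrite /= (subsetP (partitionS pP XP) _ xX).
      by rewrite (subsetP (partitionS pQ XQ) _ xX).
    have pE : pblock (P :|: Q) j = pblock Q j.
      apply: def_pblock; rewrite ?inE ?BQ ?orbT //.
        by have := partitionU dAB pP pQ => /partition_trivIset.
      by rewrite mem_pblock (cover_partition pQ).
    rewrite /ncwt_at pE mulrCA; congr (_ * _).
    have -> : (P :|: Q) :\ pblock Q j = P :|: (Q :\ pblock Q j).
      apply/setP => X; rewrite !inE; case: eqVneq => //= -> /=.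
      by rewrite (negbTE (QP _ BQ)).
    rewrite /ncwt -bigU /=; first by apply: eq_bigl => X; rewrite !inE.
    apply/pred0P => X /=; rewrite !inE.
    by apply/negP => /and3P[XP _ /QP]; rewrite XP.
  rewrite -big_distrlr /= (Z _ A _ erefl); last by rewrite -cAB leq_addr.
  congr (_ * _); rewrite -{1}(setD1K jB).
  have -> : (n - #|A| = #|B :\ j|.+1)%N by rewrite -cAB addKn (cardsD1 j B) jB.
  have BnB : (#|B :\ j| < n)%N by rewrite -cAB (cardsD1 j B) jB add1n; lia.
  apply: IH => //; first exact: ltn_trans nL.
  by move=> i; rewrite !inE => /and3P[ij _]; rewrite ltn_neqAle eq_sym ij.
by rewrite (big_rank D (fun r => ncsum r * U (fun k => g k.+1) (n - r))) Dn.
Qed.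

Lemma ncsum0 : ncsum 0 = 1.
Proof.
rewrite /ncsum (_ : NC 0 = [set set0]) ?big_set1 ?/ncwt ?big_set0 //.
rewrite -(noncrossing_set0 0); congr NCD; apply/setP => -[] //.
Qed.

(** Coefficient by coefficient, this is the functional equation M = 1 + C('X * M) of the moment
    series, where C has the coefficients f. *)
Lemma ncsum_rec n : (0 < n)%N -> (n < L)%N ->
  ncsum n = \sum_(k < L) f k.+1 * (('X * M) ^+ k.+1)`_n.
Proof.
case: n => // n _ nL.
rewrite /ncsum (eq_bigr _ (fun P PN => ncwt_atE PN (in_setT (ord0 : 'I_n.+1)))).
rewrite -(setD1K (in_setT ord0)); apply: sum_NCD.
- by have := cardsD1 ord0 [set: 'I_n.+1]; rewrite cardsT card_ord inE add1n => -[].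
- exact: ltnW.
- by move=> i; rewrite !inE andbT lt0n.
Qed.

End MomentSeries.

(** * Power series truncated by a nilpotent variable *)

Section Nilpotent.
Variables (S : comNzRingType) (s : S) (N : nat).
Hypothesis sN : s ^+ N = 0.

(** Stands in for the uniqueness of power series solutions: d will be a difference of two solutions,
    and iterating the equation N times kills it. *)
Lemma nilp_fix (x d : S) : d = s * x * d -> d = 0.
Proof.
move=> E; suff h k : d = (s * x) ^+ k * d by rewrite (h N) exprMn sN !mul0r.
by elim: k => [|k IH]; rewrite ?mul1r // exprSr -mulrA -E.
Qed.

Lemma nilp_unit (c : S) : exists y, y * (1 + s * c) = 1.
Proof.
exists (\sum_(i < N) (- (s * c)) ^+ i).
have := subrX1 (- (s * c)) N; rewrite exprNn exprMn sN mul0r mulr0 sub0r.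
by move=> E; rewrite -[RHS]opprK E; ring.
Qed.

(** Since s = z (1 + C), the summand of index j is (1 + C) (z^j t_j - z^(j+1) t_(j+1)). *)
Lemma telescope_moments (C z : S) (t m : nat -> S) n : z * (1 + C) = s ->
  (forall j, m j = (1 + C) * t j - s * t j.+1) ->
  \sum_(j < n) z ^+ j * m j = (1 + C) * (t 0%N - z ^+ n * t n).
Proof.
move=> zs mE; elim: n => [|n IH]; first by rewrite big_ord0 mul1r subrr mulr0.
by rewrite big_ord_recr /= IH mE -zs exprSr; ring.
Qed.

Variables (K : comNzRingType) (e : {rmorphism K -> S}).

Definition evp (p : {poly K}) (z : S) : S := (map_poly e p).[z].

Lemma evpD p q z : evp (p + q) z = evp p z + evp q z.
Proof. by rewrite /evp rmorphD hornerD. Qed.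
Lemma evpB p q z : evp (p - q) z = evp p z - evp q z.
Proof. by rewrite /evp rmorphB hornerD hornerN. Qed.
Lemma evpM p q z : evp (p * q) z = evp p z * evp q z.
Proof. by rewrite /evp rmorphM hornerM. Qed.
Lemma evpXn p n z : evp (p ^+ n) z = evp p z ^+ n.
Proof. by rewrite /evp rmorphXn horner_exp. Qed.
Lemma evpC c z : evp c%:P z = e c.
Proof. by rewrite /evp map_polyC hornerC. Qed.
Lemma evpX z : evp 'X z = z.
Proof. by rewrite /evp map_polyX hornerX. Qed.
Lemma evp_sum I (r : seq I) (P : pred I) F z :
  evp (\sum_(i <- r | P i) F i) z = \sum_(i <- r | P i) evp (F i) z.
Proof. by rewrite /evp rmorph_sum horner_sum. Qed.

Lemma evp_poly n (f : nat -> K) z :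
  evp (\poly_(i < n) f i) z = \sum_(i < n) z ^+ i * e (f i).
Proof.
rewrite poly_def evp_sum; apply: eq_bigr => i _.
by rewrite -mul_polyC evpM evpC evpXn evpX mulrC.
Qed.

Lemma evp_diff p z z' : exists q, evp p z - evp p z' = (z - z') * q.
Proof.
elim/poly_ind: p => [|p c [q E]]; first by exists 0; rewrite /evp rmorph0 !horner0 subrr mulr0.
exists (z * q + evp p z'); rewrite !evpD !evpM !evpX !evpC.
by rewrite mulrDr [(z - z') * (z * q)]mulrCA -E; ring.
Qed.

Lemma evp_nil (p : {poly K}) L z : (forall n, (n < L)%N -> p`_n = 0) -> z ^+ L = 0 -> evp p z = 0.
Proof.
move=> pL zL; rewrite /evp horner_coef big1 // => i _; rewrite coef_map /=.
case: (ltnP i L) => [/pL -> | Li]; first by rewrite rmorph0 mul0r.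
by rewrite -(subnKC Li) exprD zL mul0r mulr0.
Qed.

Lemma evp_drop1 (p : {poly K}) z : evp p z = e p`_0 + z * evp (drop_poly 1 p) z.
Proof.
rewrite -{1}(poly_take_drop 1 p) evpD evpM evpXn evpX expr1 mulrC; congr (_ + _).
by rewrite (_ : take_poly 1 p = (p`_0)%:P) ?evpC //; apply/polyP => -[|i]; rewrite coef_take_poly coefC.
Qed.

(** With M = 1 + X M1, subtracting the equations z + z^2 M1(z) = s and z' + z'^2 M1(z') = s exhibits
    z - z' as a multiple of s (z - z'). *)
Lemma subst_uniq (M : {poly K}) (y y' : S) : M`_0 = 1 ->
  s * y * evp M (s * y) = s -> s * y' * evp M (s * y') = s -> s * y = s * y'.
Proof.
move=> M0; set z := s * y; set z' := s * y' => zM zM'.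
pose M1 := drop_poly 1 M.
have [q E] := evp_diff M1 z z'.
have ME w : evp M w = 1 + w * evp M1 w by rewrite evp_drop1 M0 rmorph1.
rewrite !ME in zM zM'.
apply/eqP; rewrite -subr_eq0; apply/eqP.
apply: (@nilp_fix (- (y * z * q + (y + y') * evp M1 z'))).
have : z * (1 + z * evp M1 z) - z' * (1 + z' * evp M1 z') = 0.
  by rewrite zM zM' subrr.
have -> : evp M1 z = evp M1 z' + (z - z') * q by rewrite -E; ring.
move=> h; apply/eqP; rewrite -subr_eq0 -h; apply/eqP; rewrite /z /z'; ring.
Qed.

Section MomentInverse.
Variables (f : nat -> K) (L : nat) (M : {poly K}).
Hypothesis NL : (N <= L)%N.
Hypothesis M0 : M`_0 = 1.
Hypothesis Mrec : forall n, (0 < n)%N -> (n < L)%N ->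
  M`_n = \sum_(k < L) f k.+1 * (('X * M) ^+ k.+1)`_n.

Definition cumser (w : S) : S := \sum_(k < L) e (f k.+1) * w ^+ k.+1.

Lemma cumser_div w : exists c, cumser w = w * c.
Proof.
exists (\sum_(k < L) e (f k.+1) * w ^+ k); rewrite mulr_sumr.
by apply: eq_bigr => k _; rewrite exprS mulrCA.
Qed.

(** M and 1 + C('X * M) agree below degree L and z^L = 0, so u = z M(z) satisfies M(z) = 1 + C(u),
    hence u = z (1 + C(u)). As s solves the same equation, u = s. *)
Lemma moment_inverse z : z * (1 + cumser s) = s -> evp M z = 1 + cumser s.
Proof.
move=> zs; have [c cE] := cumser_div s.
(* With [cumser s] written as s c, the hypothesis reads z + z s c = s. *)
have [y yE] : exists y, z = s * y.
  by exists (1 - z * c); rewrite mulrBr mulr1 -[X in X - _]zs cE; ring.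
have zL : z ^+ L = 0 by rewrite yE exprMn -(subnKC NL) exprD sN !mul0r.
pose P := M - 1%:P - \sum_(k < L) (f k.+1)%:P * ('X * M) ^+ k.+1.
have P0 : evp P z = 0.
  apply: (@evp_nil P L) => // n nL; rewrite !coefB coefC coef_sum.
  under eq_bigr do rewrite coefCM.
  case: n nL => [|n] nL; last by rewrite Mrec // subr0 subrr.
  rewrite M0 subrr sub0r big1 ?oppr0 // => k _.
  by rewrite exprMn coefXnM mulr0.
pose u := z * evp M z.
have ME : evp M z = 1 + cumser u.
  move/eqP: P0; rewrite /P !evpB evpC rmorph1 subr_eq0 => /eqP E.
  rewrite -[LHS](subrK 1) E addrC evp_sum; congr (_ + _).
  by apply: eq_bigr => k _; rewrite evpM evpC evpXn evpM evpX.
pose Q := \sum_(k < L) (f k.+1)%:P * 'X ^+ k.+1.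
have QE w : evp Q w = cumser w.
  by rewrite evp_sum; apply: eq_bigr => k _; rewrite evpM evpC evpXn evpX.
have [q qE] := evp_diff Q u s; rewrite !QE in qE.
have us : u = s.
  apply/eqP; rewrite -subr_eq0; apply/eqP; apply: (@nilp_fix (y * q)).
  have -> : s * (y * q) * (u - s) = z * (cumser u - cumser s) by rewrite qE yE; ring.
  have uE : u = z * (1 + cumser u) by rewrite -ME.
  by rewrite {1}uE -[X in _ - X = _]zs; ring.
by rewrite ME us.
Qed.

End MomentInverse.

End Nilpotent.

(** * Words in two free variables *)

Section WordSums.
Variable S : comNzRingType.
Implicit Types (F G H : seq bool -> S) (w : seq bool).

(* The sum of [F] over the words of length less than [n]. *)
Fixpoint sumw (n : nat) F : S :=
  if n is n'.+1 then F [::] + (sumw n' (fun w => F (true :: w)) + sumw n' (fun w => F (false :: w)))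
  else 0.

Lemma eq_sumw_size n F G : (forall w, (size w < n)%N -> F w = G w) -> sumw n F = sumw n G.
Proof.
elim: n F G => //= n IH F G E; rewrite E //.
by congr (_ + (_ + _)); apply: IH => w wn; apply: E.
Qed.

Lemma eq_sumw n F G : (forall w, F w = G w) -> sumw n F = sumw n G.
Proof. by move=> E; apply: eq_sumw_size => w _. Qed.

Lemma sumw0 n F : (forall w, F w = 0) -> sumw n F = 0.
Proof. by elim: n F => //= n IH F E; rewrite E !IH ?addr0. Qed.

Lemma sumwD n F G : sumw n (fun w => F w + G w) = sumw n F + sumw n G.
Proof. by elim: n F G => [|n IH] F G /=; rewrite ?addr0 // !IH; ring. Qed.

Lemma sumwZ n c F : sumw n (fun w => c * F w) = c * sumw n F.
Proof. by elim: n F => [|n IH] F /=; rewrite ?mulr0 // !IH; ring. Qed.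

Lemma sumw_sum n m (F : 'I_m -> seq bool -> S) :
  sumw n (fun w => \sum_(k < m) F k w) = \sum_(k < m) sumw n (F k).
Proof.
elim: m F => [|m IH] F; first by rewrite big_ord0 sumw0 // => w; rewrite big_ord0.
rewrite big_ord_recl -IH -sumwD; apply: eq_sumw => w; exact: big_ord_recl.
Qed.

Lemma sumw_widen n F : (forall w, (n <= size w)%N -> F w = 0) -> sumw n.+1 F = sumw n F.
Proof.
elim: n F => [|n IH] F F0; first by rewrite /= F0 // !addr0.
rewrite -[LHS]/(F [::] + (sumw n.+1 (fun w => F (true :: w)) + sumw n.+1 (fun w => F (false :: w)))).
by rewrite (IH (fun w => F (true :: w))) ?(IH (fun w => F (false :: w))) // => w nw; apply: F0.
Qed.

Definition consw (c : bool) H w : S := if w is d :: w' then if d == c then H w' else 0 else 0.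

Lemma sumw_consw n c H : sumw n.+1 (consw c H) = sumw n H.
Proof.
rewrite /= add0r; case: c => /=.
  by rewrite [X in _ + X]sumw0 ?addr0.
by rewrite [X in X + _]sumw0 ?add0r.
Qed.

(** Reindexing by w = c^k w'. The words c^k w' that leave the range contribute nothing, since g
    vanishes there. *)
Lemma sumw_prefix k n c (h g : seq bool -> S) : (forall w, (n <= size w)%N -> g w = 0) ->
  sumw n (fun w => if prefix (nseq k c) w then h (drop k w) * g w else 0)
  = sumw n (fun w => h w * g (nseq k c ++ w)).
Proof.
elim: k n g => [|k IH] n g g0.
  by apply: (@eq_sumw n) => w; rewrite drop0 prefix0s.
case: n g0 => [|n] g0 //.
have := IH n (fun w => g (c :: w)) => IH'.
transitivity (sumw n.+1 (consw c (fun w => if prefix (nseq k c) w then h (drop k w) * g (c :: w) else 0))).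
  apply: eq_sumw => -[|d w] //=; rewrite eq_sym.
  by case: eqP => //= ->.
rewrite sumw_consw IH'; last by move=> w nw; apply: g0.
rewrite -sumw_widen // => w nw; rewrite g0 ?mulr0 //= size_cat.
by rewrite ltnS (leq_trans nw) ?leq_addl.
Qed.

(* The transpose of left multiplication by [x c] on the basis [wordp w]. *)
Definition actw (m : nat) (f : nat -> S) (c : bool) (g : seq bool -> S) w : S :=
  consw c g w + \sum_(k < m) f k.+1 * g (nseq k c ++ w).

(** Used with h w = phi(l E(w)), where it moves the multiplication by [x c] from E(w) to g. The
    range is n + 1 because c :: w is one letter longer than w. *)
Lemma sumw_actw n m f c (h g : seq bool -> S) : (forall w, (n <= size w)%N -> g w = 0) ->
  sumw n.+1 (fun w => (h (c :: w) + \sum_(k < m)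
     (if prefix (nseq k c) w then f k.+1 * h (drop k w) else 0)) * g w)
  = sumw n.+1 (fun w => h w * actw m f c g w).
Proof.
move=> g0; have g0' w : (n.+1 <= size w)%N -> g w = 0 by move/ltnW/g0.
rewrite (eq_sumw _ (G := fun w => h (c :: w) * g w + \sum_(k < m)
    f k.+1 * (if prefix (nseq k c) w then h (drop k w) * g w else 0))); last first.
  move=> w; rewrite mulrDl; congr (_ + _); rewrite mulr_suml; apply: eq_bigr => k _.
  by case: ifP; rewrite ?mulr0 ?mul0r ?mulrA.
rewrite [RHS](eq_sumw _ (G := fun w => h w * consw c g w + \sum_(k < m)
    f k.+1 * (h w * g (nseq k c ++ w)))); last first.
  move=> w; rewrite mulrDr; congr (_ + _); rewrite mulr_sumr; apply: eq_bigr => k _.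
  by rewrite mulrCA.
rewrite !sumwD !sumw_sum; congr (_ + _); last first.
  by apply: eq_bigr => k _; rewrite !sumwZ sumw_prefix.
have E w : h w * consw c g w = consw c (fun w' => h (c :: w') * g w') w.
  by case: w => [|d w] /=; rewrite ?mulr0 //; case: eqP => [->|]; rewrite ?mulr0.
rewrite [RHS](eq_sumw _ E) sumw_consw sumw_widen // => w nw; by rewrite g0 // mulr0.
Qed.

End WordSums.

Lemma triangle_sum (V : nmodType) m (F : nat -> nat -> V) :
  \sum_(j < m) \sum_(k < j.+1) F k (j - k)%N = \sum_(i < m) \sum_(k < m - i) F k i.
Proof.
elim: m => [|m IH]; first by rewrite !big_ord0.
rewrite big_ord_recr /= IH.
transitivity (\sum_(i < m.+1) (\sum_(k < m - i) F k i + F (m - i)%N i)); last first.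
  by apply: eq_bigr => i _; rewrite subSn ?big_ord_recr // -ltnS.
rewrite big_split /= [X in _ = X + _]big_ord_recr /= subnn big_ord0 addr0; congr (_ + _).
rewrite (reindex_inj rev_ord_inj) /=; apply: eq_bigr => i _.
by rewrite subSS subKn // -ltnS.
Qed.

(** * Free Appell polynomials *)

Section Appell.
Variables (K : comNzRingType) (f : nat -> K).

(* The list of the polynomials of index [n], ..., 0. *)
Fixpoint appell_seq (n : nat) : seq {poly K} :=
  if n is n'.+1 then
    let s := appell_seq n' in
    ('X * s`_0 - \sum_(k < n) f k.+1 *: s`_k) :: s
  else [:: 1].

(* The free Appell polynomials, with generating series 1 / (1 + C(z) - z X). *)
Definition appell (n : nat) : {poly K} := (appell_seq n)`_0.

Lemma nth_appell_seq n k : (k <= n)%N -> (appell_seq n)`_k = appell (n - k).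
Proof. by elim: n k => [|n IH] [|k] //= kn; rewrite IH. Qed.

Lemma appell_rec n :
  'X * appell n = appell n.+1 + \sum_(k < n.+1) f k.+1 *: appell (n - k).
Proof.
rewrite {2}/appell /= -/(appell n) -[LHS](subrK (\sum_(k < n.+1) f k.+1 *: (appell_seq n)`_k)).
congr (_ + _); apply: eq_bigr => k _; rewrite nth_appell_seq // -ltnS //.
Qed.

Variable L : nat.
Local Notation M := (momser f L).

Lemma momser0 : (0 < L)%N -> M`_0 = 1.
Proof. by move=> L0; rewrite coef_poly L0 ncsum0. Qed.

(** If s = z M(z), then 1 + C(s) = M(z), so the generating series of the Appell polynomials at s is
    1 / (M(z) (1 - z X)). Hence the sum of the z^n X^n is the sum of the z^j M(z)^(j+1) P_j. *)
Lemma expX_appell n : (n < L)%N ->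
  'X^n = \sum_(j < n.+1) ('X^j * M ^+ j.+1)`_n *: appell j.
Proof.
elim: n => [|n IH] nL.
  by rewrite big_ord_recl big_ord0 !mul1r expr1 momser0 // scale1r addr0.
have {}IH := IH (ltnW nL).
rewrite exprS IH mulr_sumr.
pose c j m := ('X^j * M ^+ j.+1)`_m.
have c0 j m : (m < j)%N -> c j m = 0 by move=> mj; rewrite /c coefXnM mj.
(* This is M^(i+1) = M^i (1 + C('X * M)), valid for coefficients of index below L. *)
have cS i : c i n.+1 = (if i is i'.+1 then c i' n else 0) + \sum_(k < L) f k.+1 * c (i + k)%N n.
  have split : forall m, (m < L)%N -> M`_m = (1 + \sum_(k < L) (f k.+1)%:P * ('X * M) ^+ k.+1)`_m.
    move=> m mL; rewrite coefD coef1 coef_sum; under eq_bigr do rewrite coefCM.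
    case: m mL => [|m] mL; last by rewrite coef_poly mL (ncsum_rec _ _ mL) // add0r.
    by rewrite momser0 // big1 ?addr0 // => k _; rewrite coef_XMexp ?mulr0.
  have -> : c i n.+1 = ('X^i * M ^+ i * (1 + \sum_(k < L) (f k.+1)%:P * ('X * M) ^+ k.+1))`_n.+1.
    rewrite /c exprSr mulrA !coefM; apply: eq_bigr => k _; congr (_ * _).
    by apply: split; apply: leq_ltn_trans (leq_subr _ _) nL.
  rewrite mulrDr mulr1 coefD; congr (_ + _).
    case: i => [|i]; first by rewrite mul1r coef1.
    by rewrite exprS -mulrA coefXM.
  rewrite mulr_sumr coef_sum; apply: eq_bigr => k _.
  rewrite mulrCA coefCM; congr (_ * _).
  by rewrite exprMn mulrACA -!exprD addnS exprS -mulrA coefXM /= /c.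
transitivity (\sum_(j < n.+1) c j n *: appell j.+1 +
    \sum_(j < n.+1) \sum_(k < j.+1) (c j n * f k.+1) *: appell (j - k)).
  rewrite -big_split /=; apply: eq_bigr => j _.
  rewrite -scalerAr appell_rec scalerDr scaler_sumr; congr (_ + _).
  by apply: eq_bigr => k _; rewrite scalerA.
transitivity (\sum_(i < n.+2) (if val i is i'.+1 then c i' n else 0) *: appell i +
    \sum_(i < n.+2) (\sum_(k < L) f k.+1 * c (i + k)%N n) *: appell i); last first.
  by rewrite -big_split /=; apply: eq_bigr => i _; rewrite -scalerDl -cS.
congr (_ + _).
  by rewrite [RHS]big_ord_recl scale0r add0r.
rewrite [RHS]big_ord_recr /= [X in _ + X *: _]big1 ?scale0r ?addr0; last first.
  by move=> k _; rewrite c0 ?mulr0 // ltnS leq_addr.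
transitivity (\sum_(j < n.+1) \sum_(k < j.+1) (f k.+1 * c (k + (j - k))%N n) *: appell (j - k)).
  apply: eq_bigr => j _; apply: eq_bigr => k _; rewrite mulrC subnKC //.
  by rewrite -ltnS.
rewrite (triangle_sum n.+1 (fun k i => (f k.+1 * c (k + i)%N n) *: appell i)).
apply: eq_bigr => i _; rewrite -scaler_suml; congr (_ *: _).
have iL : (n.+1 - i <= L)%N by apply: leq_trans (leq_subr _ _) (ltnW nL).
rewrite (big_ord_widen L (fun k => f k.+1 * c (k + i)%N n) iL) big_mkcond.
apply: eq_bigr => k _; rewrite addnC ltn_subRL; case: ltnP => // ki.
by rewrite c0 ?mulr0.
Qed.

End Appell.

Section Moments.
Variables (K : comNzRingType) (A : algType K) (phi : {scalar A}).
Hypothesis phi1 : phi 1 = 1.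

(** Applying phi to [expX_appell], the term j = 0 already gives the moment of order n, the terms 0 <
    j < n vanish by induction, and the last one has coefficient 1. *)
Lemma phi_appell (x : A) (f : nat -> K) : (forall n, phi (x ^+ n) = ncsum f n) ->
  forall n, phi (horner_alg x (appell f n)) = (n == 0%N)%:R.
Proof.
move=> mE; elim/ltn_ind => -[|n] IH; first by rewrite rmorph1.
have := congr1 (fun p => phi (horner_alg x p)) (@expX_appell _ f n.+2 n.+1 (leqnn _)).
rewrite rmorphXn /= horner_algX mE rmorph_sum linear_sum /=.
under eq_bigr do rewrite -mul_polyC rmorphM /= horner_algC mulr_algl linearZ /=.
rewrite big_ord_recr big_ord_recl /=.
rewrite expr0 expr1 mul1r coef_poly leqnn IH // mulr1 coefXnM ltnn subnn.
have -> : (momser f n.+2 ^+ n.+2 : {poly K})`_0 = 1.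
  by rewrite -horner_coef0 horner_exp horner_coef0 momser0 // expr1n.
rewrite mul1r.
rewrite [X in _ + X + _]big1 ?addr0; last first.
  by move=> i _; rewrite IH ?mulr0 // /bump leq0n add1n ltnS.
by rewrite -{1}[ncsum f n.+1]addr0 => /addrI.
Qed.

Section Words.
Variables (x : bool -> A) (kap : bool -> nat -> K).
Hypothesis mom : forall c n, phi (x c ^+ n) = ncsum (kap c) n.

Let P c n := horner_alg (x c) (appell (kap c) n).

(* [wordp w] is the product over the maximal runs c^k of [w] of the Appell
   polynomials of index k in [x c]; [blocks c n w] is [wordp] of c^n w. *)
Fixpoint blocks (c : bool) (n : nat) (w : seq bool) : A :=
  if w is d :: w' then if d == c then blocks c n.+1 w' else P c n * blocks d 1 w'
  else P c n.

Definition wordp (w : seq bool) : A := blocks true 0 w.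

Lemma P0 c : P c 0 = 1. Proof. exact: rmorph1. Qed.

Lemma blocks0 c w : blocks c 0 w = wordp w.
Proof.
rewrite /wordp; case: w => [|d w] /=; first by rewrite !P0.
by rewrite !P0 !mul1r; case: c d => -[].
Qed.

Lemma mul_blocks c n w : ohead w != Some c -> x c * blocks c n w =
  blocks c n.+1 w + \sum_(k < n.+1) kap c k.+1 *: blocks c (n - k) w.
Proof.
have PE m : x c * P c m = P c m.+1 + \sum_(k < m.+1) kap c k.+1 *: P c (m - k).
  have := congr1 (horner_alg (x c)) (appell_rec (kap c) m).
  rewrite rmorphM /= horner_algX => ->; rewrite rmorphD rmorph_sum /=; congr (_ + _).
  by apply: eq_bigr => k _; rewrite -mul_polyC rmorphM /= horner_algC mulr_algl.
case: w => [|d w] dc; first exact: PE.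
have {}dc : (d == c) = false by apply: contraNF dc => /eqP ->.
rewrite /= dc.
by rewrite mulrA PE mulrDl mulr_suml; congr (_ + _); apply: eq_bigr => k _; rewrite scalerAl.
Qed.

Lemma blocks_nseq c m n w : blocks c m (nseq n c ++ w) = blocks c (m + n) w.
Proof. by elim: n m => [|n IH] m /=; rewrite ?addn0 // eqxx IH addSnnS. Qed.

Lemma wordp_nseq c n w : wordp (nseq n c ++ w) = blocks c n w.
Proof. by rewrite -(blocks0 c) blocks_nseq. Qed.

Lemma word_run c (w : seq bool) : exists n w', w = nseq n c ++ w' /\ ohead w' != Some c.
Proof.
elim: w => [|d w [n [w' [-> h]]]]; first by exists 0, [::].
have [->|dc] := eqVneq d c; first by exists n.+1, w'.
by exists 0, (d :: nseq n c ++ w'); split => //=; apply: contra dc => /eqP[->].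
Qed.

Lemma prefix_nseq c k n (w : seq bool) : ohead w != Some c ->
  prefix (nseq k c) (nseq n c ++ w) = (k <= n)%N.
Proof.
move=> h; elim: k n => [|k IH] [|n]; rewrite ?prefix0s //=; last by rewrite eqxx IH.
by case: w h {IH} => [|d w] //= h; rewrite (_ : (c == d) = false) //; apply: contraNF h => /eqP ->.
Qed.

(** For w = c^n w' with w' not starting with c, the prefix test holds exactly when k <= n. This form
    of [mul_blocks] does not mention n, so it can be summed over all w. *)
Lemma mul_wordp L c w : (size w < L)%N -> x c * wordp w = wordp (c :: w) +
  \sum_(k < L) (if prefix (nseq k c) w then kap c k.+1 *: wordp (drop k w) else 0).
Proof.
have [n [w' [-> h]]] := word_run c w => wL.
rewrite wordp_nseq mul_blocks // -(wordp_nseq c n.+1) /=; congr (_ + _).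
have nL : (n < L)%N.
  by move: wL; rewrite size_cat size_nseq; apply: leq_trans; rewrite ltnS leq_addr.
rewrite (big_ord_widen L (fun k => kap c k.+1 *: blocks c (n - k) w') nL) big_mkcond.
apply: eq_bigr => k _; rewrite prefix_nseq // ltnS; case: leqP => // kn.
rewrite -wordp_nseq drop_cat size_nseq; congr (_ *: wordp _).
case: ltngtP kn => // [kn|->] _; last by rewrite subnn drop0.
by rewrite drop_nseq.
Qed.

Hypothesis free : forall (c : bool) (n : nat) (p : 'I_n -> {poly K}),
  (0 < n)%N -> (forall i : 'I_n, phi (horner_alg (x (c (+) odd i)) (p i)) = 0) ->
  phi (\prod_(i < n) horner_alg (x (c (+) odd i)) (p i)) = 0.

(** Consecutive maximal runs carry different letters, and Appell polynomials of positive index are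
    centred: this is an alternating product to which freeness applies. *)
Lemma blocks_prod c n w : (0 < n)%N -> exists m (p : nat -> {poly K}),
  [/\ (0 < m)%N, forall i, phi (horner_alg (x (c (+) odd i)) (p i)) = 0
    & blocks c n w = \prod_(i < m) horner_alg (x (c (+) odd i)) (p i)].
Proof.
have P00 d k : (0 < k)%N -> phi (horner_alg (x d) (appell (kap d) k)) = 0.
  by move=> k0; rewrite phi_appell // eqn0Ngt k0.
elim: w c n => [|d w IH] c n n0 /=.
  exists 1%N, (fun i => appell (kap (c (+) odd i)) n); split => // [i|]; first exact: P00.
  by rewrite big_ord1 /= addbF.
have [_|dc] := eqVneq d c; first exact: IH.
have {dc} -> : d = ~~ c by case: c d dc => -[].
have [m [p [m0 p0 ->]]] := IH (~~ c) 1%N isT.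
exists m.+1, (fun i => if i is j.+1 then p j else appell (kap c) n); split => // [[|i]|].
- by rewrite /= addbF; apply: P00.
- by have := p0 i; rewrite /= addbN addNb.
- rewrite big_ord_recl /= addbF; congr (_ * _); apply: eq_bigr => i _.
  by rewrite /= addbN addNb.
Qed.

Lemma phi_wordp w : phi (wordp w) = (w == [::])%:R.
Proof.
case: w => [|c w]; first by rewrite /wordp /= P0 phi1.
have -> : wordp (c :: w) = blocks c 1 w by rewrite -(wordp_nseq c 1).
have [m [p [m0 p0 ->]]] := blocks_prod c w (ltn0Sn 0).
exact: (@free c m (fun i => p i)).
Qed.

End Words.
End Moments.

(** * The function g on words *)

Section LinearRecurrence.
Variables (S : comNzRingType) (x y : S).

(** The values at n and n - 1 of the solution F with F_0 = 1 and F_(-1) = 0. Its generating series 1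
    / (1 - x t - y t^2) also counts sequences of excursions of degree 1 and 2. *)
Fixpoint linrec (n : nat) : S * S :=
  if n is n'.+1 then let u := linrec n' in (x * u.1 + y * u.2, u.1) else (1, 0).

Lemma linrecE (U : nat -> S) n : (forall k, U k.+2 = x * U k.+1 + y * U k) ->
  U n = (linrec n).1 * U 0 + (linrec n).2 * (U 1%N - x * U 0).
Proof.
move=> UE; elim/ltn_ind: n => -[|[|n]] IH /=; [ring|ring|].
by rewrite UE (IH n) // (IH n.+1) //=; ring.
Qed.

Lemma linrec_sum (U k : nat -> S) m : (forall k, U k.+2 = x * U k.+1 + y * U k) ->
  \sum_(i < m) k i * U i = (\sum_(i < m) k i * (linrec i).1) * U 0
   + (\sum_(i < m) k i * (linrec i).2) * (U 1%N - x * U 0).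
Proof.
move=> UE; rewrite !mulr_suml -big_split /=; apply: eq_bigr => i _.
by rewrite {1}(linrecE i UE); ring.
Qed.

End LinearRecurrence.

Section StackVector.
Variables (S : comNzRingType) (s : S) (f r : bool -> S) (w0 : S).
Hypothesis w0E : w0 = s ^+ 2 * r true * r false * (1 + w0).

Let y c := s * r c * (1 + w0).

(* These formulas were found by solving [act_G0] and [act_G1] for a vector that
   depends on the word through a linear recursion on each run of letters. *)
Definition G0 (v : S * (bool -> S)) : S :=
  v.1 + s * f true * v.2 false + s * f false * v.2 true.

Definition G1 (v : S * (bool -> S)) (d : bool) : S :=
  f d * v.1 + (1 + s * f d * f (~~ d) + w0) * v.2 d + (s * f d ^+ 2 + y d) * v.2 (~~ d).

Lemma G0E c v : G0 v = v.1 + s * f (~~ c) * v.2 c + s * f c * v.2 (~~ c).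
Proof. by rewrite /G0; case: c => //=; ring. Qed.

(** [vec w] records what the shift [consw] contributes at w: in [act_G0] its second component, in
    [act_G1] its first one, which is 1 at the empty word. [G0] is g between factors of x; [G1] at d
    is g once the right letter d of a factor has been absorbed. *)
Fixpoint vec (w : seq bool) : S * (bool -> S) :=
  if w is c :: w' then
    (s * G1 (vec w') (~~ c), fun d => if d == c then G0 (vec w') else 0)
  else (1, fun _ => 0).

(** Two letters cost at least one power of s, so over a nilpotent s the sums over words are
    finite. *)
Lemma vec_div w : exists a (b : bool -> S),
  (vec w).1 = s ^+ uphalf (size w) * a /\ forall d, (vec w).2 d = s ^+ (size w)./2 * b d.
Proof.
elim: w => [|c w [a [b [aE bE]]]] /=; first by exists 1, (fun _ => 0); rewrite mul1r mulr0.
have uE : s ^+ uphalf (size w) = s ^+ (size w)./2 * s ^+ odd (size w).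
  by rewrite -exprD uphalf_half addnC.
pose h d := f d * (s ^+ odd (size w) * a) + (1 + s * f d * f (~~ d) + w0) * b d
   + (s * f d ^+ 2 + y d) * b (~~ d).
(* The product of s and s^half is s^uphalf for odd size, and s times s^uphalf for even size. *)
pose g := a + (if odd (size w) then 1 else s) * (f true * b false + f false * b true).
exists (h (~~ c)), (fun d => if d == c then g else 0); split => [|d].
  rewrite /G1 aE !bE uE /h -[(size w)./2.+1]addn1 exprD expr1.
  by move: (s ^+ _./2) (s ^+ odd _) => t t'; ring.
case: eqP => // _; last by rewrite mulr0.
rewrite /G0 aE !bE /g uE; move: (s ^+ _./2) => t.
by case: (odd (size w)); rewrite ?expr1 ?expr0; ring.
Qed.

(* The cumulant series of ab + ba in terms of [f] and [w0]. *)
Definition Ktot := 2%:R * (s * f true * f false + w0).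

Variables (kap : bool -> nat -> S) (m : nat).
Let xx c := 2%:R * s * f (~~ c).
Let yy c := s * y (~~ c).
Hypothesis fE : forall c, f c = \sum_(k < m) kap c k.+1 * (linrec (xx c) (yy c) k).1.
Hypothesis rE : forall c, r c = \sum_(k < m) kap c k.+1 * (linrec (xx c) (yy c) k).2.

(** Inside a run of c the component at [~~ c] vanishes, so one more c acts linearly on the pair of
    v.1 and v.2 c. The matrix has trace [xx c] and determinant [- yy c]; the recurrence is
    Cayley-Hamilton. *)
Lemma vec_run c w k : let u k := vec (nseq k.+1 c ++ w) in
  (u k.+2).1 = xx c * (u k.+1).1 + yy c * (u k).1
  /\ (u k.+2).2 c = xx c * (u k.+1).2 c + yy c * (u k).2 c.
Proof.
move=> u; set v := u k.
have nc : (~~ c == c) = false by case: (c).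
have v0 : v.2 (~~ c) = 0 by rewrite /v /u /= nc.
have v1 : (u k.+1).2 (~~ c) = 0 by rewrite /u /= nc.
have E1 : (u k.+1).1 = s * G1 v (~~ c) by [].
have E2 : (u k.+1).2 c = G0 v by rewrite /= eqxx.
have E3 : (u k.+2).1 = s * G1 (u k.+1) (~~ c) by [].
have E4 : (u k.+2).2 c = G0 (u k.+1) by rewrite /= eqxx.
rewrite E3 E4 /G1 (G0E c) v1 negbK E1 E2 (G0E c) /G1 v0 negbK /xx /yy.
by split; ring.
Qed.

Lemma act_run c w (U : S * (bool -> S) -> S) :
  (U = (fun v => v.1) \/ U = (fun v => v.2 c)) ->
  \sum_(k < m) kap c k.+1 * U (vec (nseq k.+1 c ++ w))
  = f c * U (vec (c :: w)) + r c * (U (vec [:: c, c & w]) - xx c * U (vec (c :: w))).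
Proof.
move=> UE; rewrite fE rE.
apply: (linrec_sum (U := fun k => U (vec (nseq k.+1 c ++ w))) (fun k => kap c k.+1)) => k.
by have [h1 h2] := vec_run c w k; case: UE => ->.
Qed.

(** Absorbs the right letter of a factor. [act_run] reduces the sum over runs to f c and r c, and
    then the two sides differ by a multiple of the defect of [w0E]. *)
Lemma act_G0 c w : actw m (kap c) c (fun w => G0 (vec w)) w = G1 (vec w) c.
Proof.
have nc : (~~ c == c) = false by case: (c).
have E := act_run w (or_intror (erefl (fun v : S * (bool -> S) => v.2 c))).
have E1 k : G0 (vec (nseq k c ++ w)) = (vec (nseq k.+1 c ++ w)).2 c by rewrite /= eqxx.
rewrite /actw; under eq_bigr do rewrite E1.
rewrite E.
have -> : consw c (fun w => G0 (vec w)) w = (vec w).2 c.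
  by case: (w) => //= d w'; rewrite eq_sym.
rewrite /= !eqxx; move: (vec w) => v.
have wE : w0 = s ^+ 2 * r c * r (~~ c) * (1 + w0) by case: (c); rewrite {1}w0E //=; ring.
apply/eqP; rewrite -subr_eq0 !(G0E c) /= !eqxx nc /G1 /xx /y negbK.
rewrite (_ : _ - _ = (s ^+ 2 * r c * r (~~ c) * (1 + w0) - w0) * v.2 c); last by ring.
by rewrite -wE subrr mul0r.
Qed.

(** Absorbs the left letter, summed over ab and ba. Paired with phi(x^j E(w)), the indicator of the
    empty word gives phi(x^j), and the identity becomes the recurrence for t_j. *)
Lemma act_G1 w : (w == [::])%:R +
    s * (actw m (kap true) true (fun w => G1 (vec w) false) w
         + actw m (kap false) false (fun w => G1 (vec w) true) w)
  = (1 + Ktot) * G0 (vec w).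
Proof.
have E c : s * actw m (kap c) c (fun w => G1 (vec w) (~~ c)) w =
    consw c (fun w => s * G1 (vec w) (~~ c)) w +
    (f c * (vec (c :: w)).1 + r c * ((vec [:: c, c & w]).1 - xx c * (vec (c :: w)).1)).
  rewrite -(act_run w (or_introl (erefl (fun v : S * (bool -> S) => v.1)))).
  rewrite /actw mulrDr mulr_sumr; congr (_ + _); last by apply: eq_bigr => k _; rewrite mulrCA.
  by case: w => [|d w] /=; rewrite ?mulr0 //; case: eqP; rewrite ?mulr0.
rewrite mulrDr (E true) (E false).
set u1 := (vec w).1.
have cE : (w == [::])%:R + (consw true (fun w => s * G1 (vec w) (~~ true)) w +
    consw false (fun w => s * G1 (vec w) (~~ false)) w) = u1.
  by rewrite /u1; case: (w) => [|[] w'] /=; ring.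
rewrite addrACA [LHS]addrA cE {cE} /u1 /=; move: (vec w) => v.
apply/eqP; rewrite -subr_eq0.
rewrite (_ : _ - _ = (s ^+ 2 * r true * r false * (1 + w0) - w0) * (G0 v + v.1)).
  by rewrite -w0E subrr mul0r.
by rewrite /Ktot /G1 /G0 /xx /y /=; ring.
Qed.

End StackVector.

Section StackMoments.
Variables (K : comNzRingType) (A : algType K) (phi : {scalar A}).
Variables (x : bool -> A) (kap : bool -> nat -> K).
Hypothesis phi1 : phi 1 = 1.
Hypothesis mom : forall c n, phi (x c ^+ n) = ncsum (kap c) n.
Hypothesis free : forall (c : bool) (n : nat) (p : 'I_n -> {poly K}),
  (0 < n)%N -> (forall i : 'I_n, phi (horner_alg (x (c (+) odd i)) (p i)) = 0) ->
  phi (\prod_(i < n) horner_alg (x (c (+) odd i)) (p i)) = 0.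

Variables (S : comNzRingType) (s : S) (N : nat) (e : {rmorphism K -> S}).
Hypothesis sN : s ^+ N = 0.
Variables (f r : bool -> S) (w0 : S).
Hypothesis w0E : w0 = s ^+ 2 * r true * r false * (1 + w0).
Variable m : nat.
Hypothesis Nm : (N.*2 < m)%N.
Let xx c := 2%:R * s * f (~~ c).
Let yy c := s * (s * r (~~ c) * (1 + w0)).
Hypothesis fE : forall c,
  f c = \sum_(k < m) e (kap c k.+1) * (linrec (xx c) (yy c) k).1.
Hypothesis rE : forall c,
  r c = \sum_(k < m) e (kap c k.+1) * (linrec (xx c) (yy c) k).2.

Let g0 w := G0 s f (vec s f r w0 w).
Let g1 d w := G1 s f r w0 (vec s f r w0 w) d.
Let W w := wordp x kap w.

Lemma g_vanish w : (N.*2 <= size w)%N -> g0 w = 0 /\ forall d, g1 d w = 0.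
Proof.
move=> Nw; have [a [b [aE bE]]] := vec_div s f r w0 w.
have z k : (N <= k)%N -> s ^+ k = 0 by move=> Nk; rewrite -(subnKC Nk) exprD sN mul0r.
have hN : (N <= (size w)./2)%N by rewrite -(doubleK N) half_leq.
have uN : (N <= uphalf (size w))%N by apply: leq_trans hN _; rewrite uphalf_half leq_addl.
by rewrite /g0 /g1 /G0 /G1 aE !bE !z //; split=> [|d]; rewrite ?bE ?z // !mul0r !mulr0 ?addr0 // !mulr0 !addr0.
Qed.

Lemma pairing c (l : A) (g : seq bool -> S) : (forall w, (N.*2 <= size w)%N -> g w = 0) ->
  sumw N.*2.+1 (fun w => e (phi (l * (x c * W w))) * g w)
  = sumw N.*2.+1 (fun w => e (phi (l * W w)) * actw m (fun k => e (kap c k)) c g w).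
Proof.
move=> g00; rewrite -sumw_actw //; apply: eq_sumw_size => w wn; congr (_ * _).
(* The words summed over have at most 2N letters, so m > 2N bounds every run. *)
rewrite (@mul_wordp _ _ x kap m c w) ?(leq_trans wn) // mulrDr linearD rmorphD; congr (_ + _).
rewrite mulr_sumr linear_sum rmorph_sum; apply: eq_bigr => k _ /=.
by case: ifP => _; rewrite ?mulr0 ?linear0 ?rmorph0 // -scalerAr linearZ rmorphM.
Qed.

Let X := x true * x false + x false * x true.

Lemma stack_moments z : z * (1 + Ktot s f w0) = s ->
  \sum_(j < N) z ^+ j * e (phi (X ^+ j)) = 1 + Ktot s f w0.
Proof.
move=> zs.
pose t j := sumw N.*2.+1 (fun w => e (phi (X ^+ j * W w)) * g0 w).
have t0 : t 0%N = 1.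
  rewrite /t /= !sumw0 => [|w|w]; rewrite !mul1r ?phi_wordp // ?rmorph0 ?mul0r //.
  by rewrite rmorph1 /g0 /G0 /= !mulr0 !addr0 mul1r.
(* z is a multiple of s because [Ktot] is; this removes the end term z^N t_N of the telescoping
   sum. *)
have zN : z ^+ N = 0.
  have -> : z = s * (1 - z * (2%:R * (f true * f false + s * r true * r false * (1 + w0)))).
    rewrite mulrBr mulr1 -[X in X - _]zs.
    have -> : Ktot s f w0 = s * (2%:R * (f true * f false + s * r true * r false * (1 + w0))).
      by rewrite /Ktot {1}w0E; ring.
    by ring.
  by rewrite exprMn sN mul0r.
rewrite (@telescope_moments _ s _ z t (fun j => e (phi (X ^+ j))) N zs) ?zN ?mul0r ?t0 ?subr0 ?mulr1 // => j.
(* First the letter [~~ c] next to E(w) is absorbed, by [act_G0], then c by a second use of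
   [pairing]. *)
have twice c : sumw N.*2.+1 (fun w => e (phi (X ^+ j * (x c * (x (~~ c) * W w)))) * g0 w)
  = sumw N.*2.+1 (fun w => e (phi (X ^+ j * W w)) * actw m (fun k => e (kap c k)) c (g1 (~~ c)) w).
  transitivity (sumw N.*2.+1 (fun w => e (phi (X ^+ j * x c * W w)) * g1 (~~ c) w)).
    under eq_sumw do rewrite mulrA.
    rewrite pairing; last by move=> w /g_vanish[].
    apply: eq_sumw => w; congr (_ * _).
    exact: (@act_G0 _ s f r w0 w0E (fun c k => e (kap c k)) m fE rE (~~ c) w).
  under eq_sumw do rewrite -mulrA.
  by rewrite pairing // => w /g_vanish[_ ->].
have -> : s * t j.+1 = sumw N.*2.+1 (fun w => e (phi (X ^+ j * W w)) *
    (s * (actw m (fun k => e (kap true k)) true (g1 false) w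
        + actw m (fun k => e (kap false k)) false (g1 true) w))).
  under [RHS]eq_sumw do rewrite mulrCA.
  rewrite sumwZ; congr (_ * _).
  under [RHS]eq_sumw do rewrite mulrDr.
  rewrite sumwD -(twice true) -(twice false) -sumwD; apply: eq_sumw => w.
  by rewrite -mulrDl -rmorphD -linearD -mulrDr exprSr -mulrA /X [in LHS]mulrDl -!mulrA.
have E w : s * (actw m (fun k => e (kap true k)) true (g1 false) w
        + actw m (fun k => e (kap false k)) false (g1 true) w)
  = (1 + Ktot s f w0) * g0 w + - (w == [::])%:R.
  have E := @act_G1 _ s f r w0 w0E (fun c k => e (kap c k)) m fE rE w.
  by rewrite -[X in X - _]E [RHS]addrC addKr.
under eq_sumw do rewrite E mulrDr mulrCA.
rewrite sumwD sumwZ -/(t j) opprD addNKr.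
rewrite /= !sumw0 => [|w|w]; rewrite ?oppr0 ?mulr0 //.
by rewrite !addr0 mulrN mulr1 opprK /W /wordp /= P0 mulr1.
Qed.

End StackMoments.

(** * Excursion trees *)

(* The excursion decomposition of a closed walk from a vertex: [Flex T T'] is a
   flexible edge to a vertex carrying [T], followed by the excursions [T'];
   [Rigid Y T'] is a simple cycle, described by [Y], followed by [T'].  In a
   chain, [Link T Y] is an edge to a new vertex carrying [T], and [Last] is the
   edge closing the cycle. *)
Inductive tree : Type := Leaf | Flex of tree & tree | Rigid of chain & tree
with chain : Type := Last | Link of tree & chain.

HB.instance Definition _ := gen_eqMixin tree.
HB.instance Definition _ := gen_eqMixin chain.

Scheme tree_mut := Induction for tree Sort Prop
with chain_mut := Induction for chain Sort Prop.
Combined Scheme tree_chain_ind from tree_mut, chain_mut.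

Fixpoint nedge (T : tree) : nat :=
  match T with
  | Leaf => 0
  | Flex T T' => (nedge T + nedge T').+1
  | Rigid Y T' => nedgec Y + nedge T'
  end
with nedgec (Y : chain) : nat :=
  match Y with
  | Last => 1
  | Link T Y => (nedge T + nedgec Y).+1
  end.

(* The degree contributed to the root vertex. *)
Fixpoint tdeg (T : tree) : nat :=
  match T with
  | Leaf => 0
  | Flex _ T' => (tdeg T').+1
  | Rigid _ T' => (tdeg T').+2
  end.

Lemma nedgec_gt0 Y : (0 < nedgec Y)%N.
Proof. by case: Y. Qed.

Fixpoint trees_upto (d : nat) : seq tree :=
  if d is d'.+1 then
    Leaf :: [seq Flex T T' | T <- trees_upto d', T' <- trees_upto d']
      ++ [seq Rigid Y T' | Y <- chains_upto d', T' <- trees_upto d']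
  else [::]
with chains_upto (d : nat) : seq chain :=
  if d is d'.+1 then
    Last :: [seq Link T Y | T <- trees_upto d', Y <- chains_upto d']
  else [::].

(** The nesting depth exceeds the number of edges by at most one for a tree, and not at all for a
    chain, which always ends with the edge of [Last]. *)
Lemma mem_upto d : (forall T, (nedge T < d)%N -> T \in trees_upto d) /\
  (forall Y, (nedgec Y <= d)%N -> Y \in chains_upto d).
Proof.
elim: d => [|d [IHt IHc]]; first by split => // Y; rewrite leqn0 eqn0Ngt nedgec_gt0.
split=> [[|T T'|Y T']|[|T Y]] /=; rewrite ?in_cons ?mem_cat ?eqxx // ltnS => h.
- apply/or3P/Or32/allpairsP; exists (T, T'); split => //=; apply: IHt;
    by apply: leq_trans h; rewrite ltnS ?leq_addr ?leq_addl.
- apply/or3P/Or33/allpairsP; exists (Y, T'); split => //=.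
    by apply: IHc; apply: leq_trans h; rewrite leq_addr.
  by apply: IHt; apply: leq_trans h; rewrite -{1}[nedge T']add0n ltn_add2r nedgec_gt0.
- apply/orP; right; apply/allpairsP; exists (T, Y); split => //=.
    by apply: IHt; apply: leq_trans h; rewrite -{1}[nedge T]addn0 ltn_add2l nedgec_gt0.
  by apply: IHc; apply: leq_trans h; rewrite leq_addl.
Qed.

Definition trees (N : nat) : seq tree := undup [seq T <- trees_upto N | (nedge T < N)%N].
Definition chains (N : nat) : seq chain := undup [seq Y <- chains_upto N | (nedgec Y < N)%N].

Lemma mem_trees N T : (T \in trees N) = (nedge T < N)%N.
Proof.
rewrite mem_undup mem_filter; case: ltnP => // h /=.
exact: (mem_upto N).1.
Qed.

Lemma mem_chains N Y : (Y \in chains N) = (nedgec Y < N)%N.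
Proof.
rewrite mem_undup mem_filter; case: ltnP => // h /=.
by apply: (mem_upto N).2; apply: ltnW.
Qed.

Lemma tdeg_le T : (tdeg T <= (nedge T).*2)%N.
Proof.
elim: T => //= [T _ T' IH|Y T' IH]; rewrite ?doubleS ?doubleD.
  by apply: leq_trans (leqnSn _); rewrite ltnS (leq_trans IH) // leq_addl.
rewrite -[_.+2]/(1.*2 + tdeg T')%N leq_add // leq_double nedgec_gt0 //.
Qed.

(** * Generating series of weighted trees *)

Section TreeSums.
Variables (V : zmodType) (N : nat).

(** The vanishing of g on large trees lets both subtrees range over all of [trees N] independently,
    so that the double sums become products of series. *)
Lemma sum_trees (g : tree -> V) : (forall T, (N <= nedge T)%N -> g T = 0) ->
  \sum_(T <- trees N) g T = g Leaf
    + \sum_(T <- trees N) \sum_(T' <- trees N) g (Flex T T')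
    + \sum_(Y <- chains N) \sum_(T' <- trees N) g (Rigid Y T').
Proof.
move=> g0.
pose l := Leaf :: [seq Flex T T' | T <- trees N, T' <- trees N]
      ++ [seq Rigid Y T' | Y <- chains N, T' <- trees N].
have ul : uniq l.
  rewrite /= cat_uniq !allpairs_uniq ?undup_uniq //=; last 2 first.
  - by move=> [Y T] [Y' T'] _ _ [-> ->].
  - by move=> [Y T] [Y' T'] _ _ [-> ->].
  rewrite andbT mem_cat negb_or -andbA; apply/and3P; split.
  - by apply/negP => /allpairsP[[? ?] []].
  - by apply/negP => /allpairsP[[? ?] []].
  - by apply/hasPn => _ /allpairsP[[? ?] [_ _ ->]]; apply/negP => /allpairsP[[? ?] []].
have pl : perm_eq (trees N) [seq T <- l | (nedge T < N)%N].
  apply: uniq_perm; rewrite ?undup_uniq ?filter_uniq // => T.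
  rewrite mem_trees mem_filter; apply/esym/andb_idr => TN.
  rewrite in_cons mem_cat; case: T TN => [|T T'|Y T'] /= h; rewrite ?eqxx //.
    by apply/or3P/Or32/allpairsP; exists (T, T'); rewrite !mem_trees; split => //=;
      apply: leq_trans h; rewrite !ltnS ?leq_addr ?leq_addl // ltnW // ltnS ?leq_addr ?leq_addl.
  by apply/or3P/Or33/allpairsP; exists (Y, T'); rewrite mem_chains mem_trees; split => //=;
      apply: leq_ltn_trans h; rewrite ?leq_addr ?leq_addl.
rewrite (perm_big _ pl) big_filter.
transitivity (\sum_(T <- l) g T).
  rewrite [RHS](bigID (fun T => nedge T < N)%N) /= [X in _ = _ + X]big1 ?addr0 // => T.
  by rewrite -leqNgt; apply: g0.
rewrite big_cons big_cat /= -addrA; congr (_ + (_ + _)).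
  by rewrite big_allpairs_dep.
by rewrite big_allpairs_dep.
Qed.

Lemma sum_chains (g : chain -> V) : (forall Y, (N <= nedgec Y)%N -> g Y = 0) ->
  \sum_(Y <- chains N) g Y = g Last
    + \sum_(T <- trees N) \sum_(Y <- chains N) g (Link T Y).
Proof.
move=> g0.
pose l := Last :: [seq Link T Y | T <- trees N, Y <- chains N].
have ul : uniq l.
  rewrite /= allpairs_uniq ?undup_uniq ?andbT //=.
    by apply/negP => /allpairsP[[? ?] []].
  by move=> [Y T] [Y' T'] _ _ [-> ->].
have pl : perm_eq (chains N) [seq Y <- l | (nedgec Y < N)%N].
  apply: uniq_perm; rewrite ?undup_uniq ?filter_uniq // => Y.
  rewrite mem_chains mem_filter; apply/esym/andb_idr.
  rewrite in_cons; case: Y => [|T Y] /= h; rewrite ?eqxx //.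
  by apply/orP; right; apply/allpairsP; exists (T, Y); rewrite mem_chains mem_trees; split => //=;
      apply: leq_trans h; rewrite !ltnS ?leq_addr ?leq_addl // ltnW // ltnS ?leq_addr ?leq_addl.
rewrite (perm_big _ pl) big_filter.
transitivity (\sum_(Y <- l) g Y).
  rewrite [RHS](bigID (fun Y => nedgec Y < N)%N) /= [X in _ = _ + X]big1 ?addr0 // => Y.
  by rewrite -leqNgt; apply: g0.
by rewrite big_cons big_allpairs_dep.
Qed.

End TreeSums.

Section TreeWeights.
Variables (K : comNzRingType) (kap : bool -> nat -> K).

(* Weights of vertices other than the root, which has colour [c]; the boolean
   [b] tells whether the current colour differs from that of the end of the
   chain, so that cycles of odd length have weight [0]. *)
Fixpoint weight (c : bool) (T : tree) : K :=
  match T with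
  | Leaf => 1
  | Flex T T' => 2%:R * kap (~~ c) (tdeg T).+1 * weight (~~ c) T * weight c T'
  | Rigid Y T' => weightc c false Y * weight c T'
  end
with weightc (c b : bool) (Y : chain) : K :=
  match Y with
  | Last => b%:R
  | Link T Y => kap (~~ c) (tdeg T).+2 * weight (~~ c) T * weightc (~~ c) (~~ b) Y
  end.

(* The first edge does not get the factor 2 of the other flexible edges. *)
Definition weight_root (c : bool) (T : tree) : K :=
  match T with
  | Leaf => 0
  | Flex T T' => kap (~~ c) (tdeg T).+1 * weight (~~ c) T * (kap c (tdeg T').+1 * weight c T')
  | Rigid Y T' => weightc c false Y * (kap c (tdeg T').+2 * weight c T')
  end.

Variables (S : comNzRingType) (s : S) (N : nat) (e : {rmorphism K -> S}).
Hypothesis sN : s ^+ N = 0.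

Let sge k : (N <= k)%N -> s ^+ k = 0.
Proof. by move=> Nk; rewrite -(subnKC Nk) exprD sN mul0r. Qed.

Local Notation sumt g := (\sum_(T <- trees N) e (g T) * s ^+ nedge T).
Local Notation sumy g := (\sum_(Y <- chains N) e (g Y) * s ^+ nedgec Y).

Let sum2 (I J : Type) (r : seq I) (r' : seq J) (F : I -> S) (G : J -> S) :
  \sum_(i <- r) \sum_(j <- r') F i * G j = (\sum_(i <- r) F i) * (\sum_(j <- r') G j).
Proof. by rewrite big_distrlr. Qed.

(** [f] belongs to the vertex at the far end of a flexible edge, [r] to an inner vertex of a cycle,
    which has two further edges. [y] is the series of cycles at a vertex; it equals [yy] and not the
    local [y] of the word vector. *)
Let f c := sumt (fun T => kap c (tdeg T).+1 * weight c T).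
Let r c := sumt (fun T => kap c (tdeg T).+2 * weight c T).
Let h c k := sumt (fun T => (tdeg T == k)%:R * weight c T).
Let y c := sumy (weightc c false).
Let q c := sumy (weightc c true).

Lemma y_eq c : y c = s * r (~~ c) * q (~~ c).
Proof.
rewrite /y sum_chains => [|Y Yn]; last by rewrite sge ?mulr0.
rewrite rmorph0 mul0r add0r -mulrA -sum2 mulr_sumr; apply: eq_bigr => T _.
rewrite mulr_sumr; apply: eq_bigr => Y _ /=.
by rewrite exprS exprD !rmorphM; ring.
Qed.

Lemma q_eq c : q c = s + s * r (~~ c) * y (~~ c).
Proof.
rewrite /q sum_chains => [|Y Yn]; last by rewrite sge ?mulr0.
rewrite rmorph1 mul1r expr1; congr (_ + _).
rewrite -mulrA -sum2 mulr_sumr; apply: eq_bigr => T _.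
rewrite mulr_sumr; apply: eq_bigr => Y _ /=.
by rewrite exprS exprD !rmorphM; ring.
Qed.

Let w0 := r true * y true.

Lemma ry_eq c : r c * y c = s ^+ 2 * r true * r false * (1 + r c * y c).
Proof. by rewrite {1}y_eq q_eq negbK; case: c => /=; ring. Qed.

(** For both colours the product solves w = s^2 r_true r_false (1 + w), which has only one
    solution. *)
Lemma w0_eq c : r c * y c = w0.
Proof.
case: c => //; apply/eqP; rewrite -subr_eq0; apply/eqP.
apply: (@nilp_fix _ s N sN (s * r true * r false)).
by rewrite /w0 {1}ry_eq {1}(ry_eq true); ring.
Qed.

Lemma w0_rec : w0 = s ^+ 2 * r true * r false * (1 + w0).
Proof. exact: ry_eq. Qed.

Lemma y_w0 c : y c = s * (s * r (~~ c) * (1 + w0)).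
Proof. by rewrite y_eq q_eq negbK -(w0_eq c); ring. Qed.

Lemma h_rec c k : h c k = (k == 0%N)%:R
   + (if k is k'.+1 then 2%:R * s * f (~~ c) * h c k' else 0)
   + (if k is k'.+2 then y c * h c k' else 0).
Proof.
rewrite {1}/h sum_trees => [|T Tn]; last by rewrite sge ?mulr0.
congr (_ + _ + _).
- by rewrite eq_sym !mulr1; case: eqP; rewrite ?rmorph1 ?rmorph0.
- case: k => [|k]; first by rewrite big1 // => T _; rewrite big1 // => T' _; rewrite mul0r rmorph0 mul0r.
  rewrite -mulrA -sum2 mulr_sumr; apply: eq_bigr => T _; rewrite mulr_sumr; apply: eq_bigr => T' _ /=.
  by rewrite eqSS exprS exprD !rmorphM rmorph_nat; ring.
- case: k => [|[|k]]; try by rewrite big1 // => T _; rewrite big1 // => T' _; rewrite mul0r rmorph0 mul0r.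
  rewrite -sum2; apply: eq_bigr => T _; apply: eq_bigr => T' _ /=.
  by rewrite !eqSS exprD !rmorphM; ring.
Qed.

Let xx c := 2%:R * s * f (~~ c).
Let yy c := s * (s * r (~~ c) * (1 + w0)).

(** [h_rec] has the coefficients of [vec_run]: trees sorted by root degree are the weights that
    arise on runs of letters. *)
Lemma h_linrec c k : (linrec (xx c) (yy c) k).1 = h c k /\
  (linrec (xx c) (yy c) k).2 = (if k is k'.+1 then h c k' else 0).
Proof.
elim: k => [|k [IH1 IH2]] /=; first by rewrite h_rec !addr0.
split=> //; rewrite IH1 IH2 [RHS]h_rec add0r /xx /yy -y_w0.
by case: k {IH1 IH2} => [|k] //; rewrite mulr0.
Qed.

Let f_eq c : f c = \sum_(k < N.*2.+1) e (kap c k.+1) * (linrec (xx c) (yy c) k).1.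
Proof.
under eq_bigr do rewrite (h_linrec c _).1 /h mulr_sumr.
rewrite exchange_big /= /f; apply: eq_big_seq => T; rewrite mem_trees => TN.
have dT : (tdeg T < N.*2.+1)%N.
  by rewrite ltnS (leq_trans (tdeg_le T)) // leq_double ltnW.
rewrite (bigD1 (Ordinal dT)) //= eqxx mul1r rmorphM mulrA big1 ?addr0 // => k kd.
rewrite (_ : tdeg T == k = false) ?mul0r ?rmorph0 ?mul0r ?mulr0 //.
by apply: contraNF kd => /eqP E; apply/eqP/val_inj.
Qed.

Let r_eq c : r c = \sum_(k < N.*2.+1) e (kap c k.+1) * (linrec (xx c) (yy c) k).2.
Proof.
under eq_bigr do rewrite (h_linrec c _).2.
rewrite big_ord_recl mulr0 add0r /=.
under eq_bigr do rewrite /h mulr_sumr.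
rewrite exchange_big /= /r; apply: eq_big_seq => T; rewrite mem_trees => TN.
have dT : (tdeg T < N.*2)%N.
  by apply: leq_ltn_trans (tdeg_le T) _; rewrite ltn_double.
rewrite (bigD1 (Ordinal dT)) //= eqxx mul1r rmorphM mulrA big1 ?addr0 // => k kd.
rewrite (_ : tdeg T == k = false) ?mul0r ?rmorph0 ?mul0r ?mulr0 //.
by apply: contraNF kd => /eqP E; apply/eqP/val_inj.
Qed.

(** Splitting off the first excursion, a root of either colour gives s f_true f_false + w0; the two
    root colours account for the 2 in [Ktot]. *)
Lemma Ktot_trees : Ktot s f w0 =
  \sum_(T <- trees N) e (weight_root true T + weight_root false T) * s ^+ nedge T.
Proof.
have E c : sumt (weight_root c) = s * f (~~ c) * f c + y c * r c.
  rewrite sum_trees => [|T Tn]; last by rewrite sge ?mulr0.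
  rewrite rmorph0 mul0r add0r; congr (_ + _).
    rewrite -mulrA -sum2 mulr_sumr; apply: eq_bigr => T _; rewrite mulr_sumr; apply: eq_bigr => T' _ /=.
    by rewrite exprS exprD !rmorphM; ring.
  rewrite -sum2; apply: eq_bigr => T _; apply: eq_bigr => T' _ /=.
  by rewrite exprD !rmorphM; ring.
under eq_bigr do rewrite rmorphD mulrDl.
rewrite big_split /= !E ![y _ * _]mulrC !w0_eq /Ktot /=; ring.
Qed.

Variables (A : algType K) (phi : {scalar A}) (x : bool -> A).
Hypothesis phi1 : phi 1 = 1.
Hypothesis mom : forall c n, phi (x c ^+ n) = ncsum (kap c) n.
Hypothesis free : forall (c : bool) (n : nat) (p : 'I_n -> {poly K}),
  (0 < n)%N -> (forall i : 'I_n, phi (horner_alg (x (c (+) odd i)) (p i)) = 0) ->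
  phi (\prod_(i < n) horner_alg (x (c (+) odd i)) (p i)) = 0.

Variable kx : nat -> K.
Hypothesis momx : forall n, phi ((x true * x false + x false * x true) ^+ n) = ncsum kx n.

(** C and K each give a solution z of z M(z) = s, one by the moment-cumulant relation, the other by
    the sums over words. These coincide by [subst_uniq], and then 1 + C = M(z) = 1 + K. *)
Lemma cumser_trees : (0 < N)%N -> cumser e kx N s =
  \sum_(T <- trees N) e (weight_root true T + weight_root false T) * s ^+ nedge T.
Proof.
move=> N0; rewrite -Ktot_trees.
have solve C c : C = s * c -> exists u, s * u * (1 + C) = s.
  by move=> ->; have [u uE] := nilp_unit sN c; exists u; rewrite -mulrA uE mulr1.
pose M := momser kx N.
have M0 : M`_0 = 1 by apply: momser0.
have ME z : evp e M z = \sum_(j < N) z ^+ j * e (ncsum kx j) by rewrite evp_poly.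
have [c cE] := cumser_div e kx N s.
have [u uE] := solve _ _ cE.
have uM : evp e M (s * u) = 1 + cumser e kx N s.
  apply: (moment_inverse sN (leqnn N) M0 _ uE) => n n0 nN.
  by rewrite coef_poly nN (ncsum_rec kx n0 nN).
have [v vE] : exists v, s * v * (1 + Ktot s f w0) = s.
  apply: (solve _ (2%:R * (f true * f false + s * r true * r false * (1 + w0)))).
  by rewrite /Ktot {1}w0_rec; ring.
have vM : evp e M (s * v) = 1 + Ktot s f w0.
  rewrite ME -(stack_moments phi1 mom free sN w0_rec (ltnSn _) f_eq r_eq vE).
  by apply: eq_bigr => j _; rewrite momx.
have uv : s * u = s * v.
  by apply: (subst_uniq sN (e := e) M0); rewrite ?uM ?vM.
by apply: (addrI 1); rewrite -uM -vM uv.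
Qed.

End TreeWeights.

Lemma coef_in_qpolyXn (K : comNzRingType) n (p : {poly K}) i : (i < n.+1)%N ->
  (in_qpoly 'X^(n.+1) p : {poly K})`_i = p`_i.
Proof.
move=> iN; rewrite /= mk_monic_Xn /= -{1}(poly_take_drop n.+1 p) addrC.
rewrite Pdiv.RingMonic.rmodp_addl_mul_small ?monicXn //.
  by rewrite coef_take_poly iN.
by rewrite size_polyXn ltnS size_take_poly.
Qed.

(** The nilpotent ring is K[X]/(X^(n+1)) with s the class of X, and the coefficient of index n is
    compared. *)
Lemma cumulant_trees (K : comNzRingType) (A : algType K) (phi : {scalar A})
    (x : bool -> A) (kap : bool -> nat -> K) (kx : nat -> K) :
  phi 1 = 1 ->
  (forall c n, phi (x c ^+ n) = ncsum (kap c) n) ->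
  (forall (c : bool) (n : nat) (p : 'I_n -> {poly K}),
    (0 < n)%N -> (forall i : 'I_n, phi (horner_alg (x (c (+) odd i)) (p i)) = 0) ->
    phi (\prod_(i < n) horner_alg (x (c (+) odd i)) (p i)) = 0) ->
  (forall n, phi ((x true * x false + x false * x true) ^+ n) = ncsum kx n) ->
  forall n, (0 < n)%N -> kx n =
  \sum_(T <- trees n.+1 | nedge T == n) (weight_root kap true T + weight_root kap false T).
Proof.
move=> phi1 mom free momx n n0.
pose e := @in_qpoly K 'X^(n.+1) \o polyC.
have sN : (in_qpoly 'X^(n.+1) 'X : {poly %/ ('X^(n.+1) : {poly K})}) ^+ n.+1 = 0.
  rewrite -rmorphXn; apply/val_inj/polyP => i; rewrite [RHS]coef0.
  case: (ltnP i n.+1) => iN; first by rewrite coef_in_qpolyXn // coefXn ltn_eqF.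
  rewrite nth_default // (leq_trans _ iN) // -ltnS.
  by apply: leq_trans (size_mk_monic _) _; rewrite mk_monic_Xn size_polyXn.
have := @cumser_trees K kap _ _ n.+1 e sN A phi x phi1 mom free kx momx isT.
rewrite /cumser /e /=.
have -> : \sum_(k < n.+1) in_qpoly 'X^(n.+1) (kx k.+1)%:P * in_qpoly 'X^(n.+1) 'X ^+ k.+1
  = in_qpoly 'X^(n.+1) (\sum_(k < n.+1) (kx k.+1)%:P * 'X ^+ k.+1).
  by rewrite rmorph_sum; apply: eq_bigr => k _; rewrite rmorphM rmorphXn.
set w := fun T => weight_root kap true T + weight_root kap false T.
have -> : \sum_(T <- trees n.+1) in_qpoly 'X^(n.+1) (w T)%:P * in_qpoly 'X^(n.+1) 'X ^+ nedge T
  = in_qpoly 'X^(n.+1) (\sum_(T <- trees n.+1) (w T)%:P * 'X ^+ nedge T).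
  by rewrite rmorph_sum; apply: eq_bigr => T _; rewrite rmorphM rmorphXn.
move=> /(congr1 (fun q : {poly %/ ('X^(n.+1) : {poly K})} => (q : {poly K})`_n)).
have cf (I : Type) (r : seq I) (F : I -> K) (d : I -> nat) :
    (\sum_(i <- r) (F i)%:P * 'X^(d i))`_n = \sum_(i <- r) F i * (n == d i)%:R.
  by rewrite coef_sum; apply: eq_bigr => i _; rewrite coefCM coefXn.
rewrite !coef_in_qpolyXn // !cf.
case: n n0 {e sN cf} @w => // n _ w E.
rewrite (bigD1 (Ordinal (ltnW (ltnSn n.+1)))) //= eqxx mulr1 big1 ?addr0 in E; last first.
  move=> k kn; rewrite eqSS (_ : n == k = false) ?mulr0 //.
  by apply: contraNF kn => /eqP E'; apply/eqP/val_inj.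
rewrite E [RHS]big_mkcond; apply: eq_bigr => T _.
by rewrite eq_sym; case: eqP; rewrite ?mulr1 ?mulr0.
Qed.

Lemma kappa_ncsum (R : realType) (A : algType R[i]) (phi : {scalar A}) (a : A) n :
  phi 1 = 1 -> phi (a ^+ n) = ncsum (fun k => kappa phi k a) n.
Proof.
move=> phi1; have := moment_cumulant (nseq n a) phi1.
have -> : \prod_(x <- nseq n a) x = a ^+ n by rewrite big_nseq /GRing.exp Monoid.iteropE.
move=> ->; rewrite -[n in RHS](size_nseq n a) /ncsum /ncwt.
apply: eq_bigr => P _; apply: eq_bigr => B _; congr (fcum phi).
rewrite /restr cardE; move: (enum B) => e; elim: e => //= i e ->.
by rewrite nth_nseq -{2}(size_nseq n a) ltn_ord.
Qed.

Lemma cumulant_sum (R : realType) (A : algType R[i]) (phi : {scalar A})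
    (a b : A) (n : nat) (phi1 : phi 1 = 1) (ab_free : free_indep phi a b)
    (n_gt0 : (0 < n)%N) :
  let kap c k := kappa phi k (if c then a else b) in
  kappa phi n (a * b + b * a) =
  \sum_(T <- trees n.+1 | nedge T == n) (weight_root kap true T + weight_root kap false T).
Proof.
move=> kap.
apply: (@cumulant_trees _ A phi (fun c => if c then a else b) kap
  (fun k => kappa phi k (a * b + b * a))) => // [c k|c k p k0 p0|k];
  [exact: kappa_ncsum| |exact: kappa_ncsum].
(* In [free_indep] the value true stands for b, here it stands for a. *)
pose c' := ~~ c.
have E i : (if c (+) odd i then a else b) = (if c' (+) odd i then b else a).
  by rewrite /c' addNb; case: (c (+) odd i).
under eq_bigr do rewrite E.
by apply: (ab_free c' k p k0) => i; rewrite -E.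
Qed.

(** * Closed walks and their excursion trees *)

Lemma unzip1_cat (S T : Type) (s t : seq (S * T)) : unzip1 (s ++ t) = unzip1 s ++ unzip1 t.
Proof. exact: map_cat. Qed.

Lemma unzip2_cat (S T : Type) (s t : seq (S * T)) : unzip2 (s ++ t) = unzip2 s ++ unzip2 t.
Proof. exact: map_cat. Qed.

Section Parse.
Variables (V E : eqType).
Implicit Types (C : seq (V * E)) (T : tree) (Y : chain).

Definition disj (X : eqType) (s t : seq X) : bool := ~~ has (mem s) t.

Lemma disjP (X : eqType) (s t : seq X) : reflect (forall x, x \in s -> x \notin t) (disj s t).
Proof.
apply: (iffP hasPn) => h x; last by move=> xt; apply/negP => /h; rewrite xt.
by move=> xs; apply/negP => /h; rewrite /= xs.
Qed.

(* [parse T v C]: the closed walk [C] from [v] has excursion tree [T], where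
   different branches of [T] share no edge and only the vertex they hang from.
   In [parsec Y p C] the walk goes from [p] around the rest of a simple cycle,
   whose base point is not among the vertices of [C] unless it is [p]. *)
Fixpoint parse (T : tree) (v : V) (C : seq (V * E)) : Prop :=
  match T with
  | Leaf => C = [::]
  | Flex T T' => exists e u C1 C2,
      [/\ C = (v, e) :: C1 ++ (u, e) :: C2, parse T u C1 /\ parse T' v C2,
          e \notin unzip2 C1 ++ unzip2 C2, disj (unzip2 C1) (unzip2 C2)
        & disj (u :: unzip1 C1) (v :: unzip1 C2)]
  | Rigid Y T' => exists C1 C2,
      [/\ C = C1 ++ C2, parsec Y v C1 /\ parse T' v C2,
          disj (unzip2 C1) (unzip2 C2)
        & disj (behead (unzip1 C1)) (v :: unzip1 C2)]
  end
with parsec (Y : chain) (p : V) (C : seq (V * E)) : Prop :=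
  match Y with
  | Last => exists e, C = [:: (p, e)]
  | Link T Y => exists e u C1 C2,
      [/\ C = (p, e) :: C1 ++ C2, parse T u C1 /\ parsec Y u C2,
          e \notin unzip2 C1 ++ unzip2 C2 /\ disj (unzip2 C1) (unzip2 C2),
          p \notin u :: unzip1 C1 ++ unzip1 C2
        & disj (u :: unzip1 C1) (behead (unzip1 C2))]
  end.

(* The vertex reached by the step before [C], for a walk [C] that ends at [y]. *)
Definition nextv C (y : V) : V := head y (unzip1 C).

Lemma nextv_cat C D y : nextv (C ++ D) y = nextv C (nextv D y).
Proof. by case: C. Qed.

Lemma parsec_head Y p C : parsec Y p C ->
  exists e C', [/\ C = (p, e) :: C', e \notin unzip2 C' & p \notin unzip1 C'].
Proof.
case: Y => [|T Y] /=; first by move=> [e ->]; exists e, [::].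
move=> [e [u [C1 [C2 [-> _ [h _] h' _]]]]]; exists e, (C1 ++ C2); split => //.
  by rewrite /unzip2 map_cat.
by move: h'; rewrite inE negb_or => /andP[_]; rewrite /unzip1 map_cat.
Qed.

Lemma parse_nextv T v C : parse T v C -> nextv C v = v.
Proof.
case: T => [|T T'|Y T'] /=; first by move=> ->.
  by move=> [e [u [C1 [C2 [-> _ _ _ _]]]]].
by move=> [C1 [C2 [-> [/parsec_head[e [C' [-> _ _]]] _] _ _]]].
Qed.

Lemma cat_last_inj (X : Type) (P : pred X) (s1 s2 r1 r2 : seq X) a1 a2 :
  s1 ++ a1 :: r1 = s2 ++ a2 :: r2 -> P a1 -> P a2 -> ~~ has P r1 -> ~~ has P r2 ->
  [/\ s1 = s2, a1 = a2 & r1 = r2].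
Proof.
elim: s1 s2 => [|b s1 IH] [|c s2] //= [].
- by move=> -> ->.
- by move=> _ -> _ Pa; rewrite has_cat /= Pa orbT.
- by move=> _ <- Pa _ _; rewrite has_cat /= Pa orbT.
- by move=> -> /IH h Pa1 Pa2 n1 n2; have [-> -> ->] := h Pa1 Pa2 n1 n2.
Qed.

Lemma cat_first_inj (X : Type) (P : pred X) (s1 s2 r1 r2 : seq X) a1 a2 :
  s1 ++ a1 :: r1 = s2 ++ a2 :: r2 -> P a1 -> P a2 -> ~~ has P s1 -> ~~ has P s2 ->
  [/\ s1 = s2, a1 = a2 & r1 = r2].
Proof.
elim: s1 s2 => [|b s1 IH] [|c s2] //= [].
- by move=> -> ->.
- by move=> -> _ ->.
- by move=> <- _ _ ->.
- move=> -> /IH h Pa1 Pa2; rewrite !negb_or => /andP[_ n1] /andP[_ n2].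
  by have [-> -> ->] := h Pa1 Pa2 n1 n2.
Qed.

(** A first edge that recurs means [Flex], and its second occurrence ends the branch; otherwise it
    is [Rigid]. Along a chain, the last visit to u ends the tree at u, and the chain ends when the
    next vertex is the base v. The chain statement carries the rest C2 of the walk because its end
    is not known beforehand. *)
Lemma parse_uniq_aux :
  (forall T v C T', parse T v C -> parse T' v C -> T = T') /\
  (forall Y p C1 C2 Y' C1' C2' v, parsec Y p C1 -> parsec Y' p C1' ->
     C1 ++ C2 = C1' ++ C2' -> nextv C2 v = v -> nextv C2' v = v ->
     disj (behead (unzip1 C1)) (v :: unzip1 C2) ->
     disj (behead (unzip1 C1')) (v :: unzip1 C2') ->
     [/\ Y = Y', C1 = C1' & C2 = C2']).
Proof.
have FR T1 T2 Y T3 v C : parse (Flex T1 T2) v C -> parse (Rigid Y T3) v C -> False.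
  move=> /= [e [u [C1 [C2 [-> _ _ _ _]]]]] [D1 [D2 [ED [/parsec_head[f [D' [D1E fD' _]]] _] dE _]]].
  move: ED dE; rewrite D1E /= => -[ef EE] /disjP/(_ f).
  rewrite !inE eqxx => /(_ isT) fD2.
  have : f \in unzip2 (D' ++ D2).
    by rewrite -EE /unzip2 map_cat mem_cat /= inE ef eqxx orbT.
  by rewrite /unzip2 map_cat mem_cat (negbTE fD') (negbTE fD2).
have LL T Y p C1 C2 C1' C2' v : parsec Last p C1 -> parsec (Link T Y) p C1' ->
    C1 ++ C2 = C1' ++ C2' -> nextv C2 v = v -> disj (behead (unzip1 C1')) (v :: unzip1 C2') -> False.
  move=> /= [f ->] [f' [u [D1 [D2 [-> [q1 q2] _ _ _]]]]] /= [_ EE] n2 /disjP d.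
  have [g [G [D2E _ _]]] := parsec_head q2.
  have uv : u = v by rewrite -n2 EE !nextv_cat D2E /= (parse_nextv q1).
  have := d u; rewrite D2E /unzip1 map_cat mem_cat /= inE eqxx orbT => /(_ isT).
  by rewrite uv inE eqxx.
apply: tree_chain_ind.
- move=> v C [|T T'|Y T'] //= ->.
    by move=> [e [u [C1 [C2 []]]]].
  by move=> [C1 [C2 [EE [/parsec_head[e [C' [C1E _ _]]] _] _ _]]]; rewrite C1E in EE.
- move=> T1 IH1 T2 IH2 v C [|T T'|Y T'] h; last by move=> /(FR _ _ _ _ _ _ h).
    by move: h => /= [e [u [C1 [C2 [-> _ _ _ _]]]]].
  move: h => /= [e [u [C1 [C2 [-> [p1 p2] eN _ _]]]]] [e' [u' [D1 [D2 [+ [q1 q2] eN' _ _]]]]].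
  case=> ee; subst e' => EQ.
  have [] := cat_first_inj (P := fun p => p.2 == e) EQ; rewrite /= ?eqxx //.
  + by apply: contra eN => /hasP[q qC /eqP <-]; rewrite mem_cat map_f.
  + by apply: contra eN' => /hasP[q qC /eqP <-]; rewrite mem_cat map_f.
  by move=> E1 [E2] E3; subst; rewrite (IH1 _ _ _ p1 q1) (IH2 _ _ _ p2 q2).
- move=> Y IHY T IHT v C [|T1 T2|Y' T'] h; last 1 first.
  + move: h => /= [C1 [C2 [-> [p1 p2] _ d]]] [D1 [D2 [EQ [q1 q2] _ d']]].
    have [-> E1 E2] := IHY _ _ _ _ _ _ _ p1 q1 EQ (parse_nextv p2) (parse_nextv q2) d d'.
    by subst; rewrite (IHT _ _ _ p2 q2).
  + by move: h => /= [C1 [C2 [-> [/parsec_head[e [C' [-> _ _]]] _] _ _]]].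
  + by move=> /FR/(_ h).
- move=> p C1 C2 [|T Y'] C1' C2' v h h' EQ n n' d d'; last first.
    by case: (LL _ _ _ _ _ _ _ _ h h' EQ n d').
  by move: h h' EQ => /= [e ->] [e' ->] /= [-> ->].
- move=> T IHT Y IHY p C1 C2 [|T' Y'] C1' C2' v h h' EQ n n' d d'.
    by case: (LL _ _ _ _ _ _ _ _ h' h (esym EQ) n' d).
  move: h h' EQ d d' => /= [e [u [D1 [D2 [-> [p1 p2] _ pN dD]]]]].
  move=> [e' [u' [D1' [D2' [-> [p1' p2'] _ pN' dD']]]]].
  rewrite /= -!catA => -[ee EE] d d'; subst e'.
  have [f [F [D2E _ uF]]] := parsec_head p2.
  have [f' [F' [D2E' _ uF']]] := parsec_head p2'.
  have uu : u = u'.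
    have := congr1 (nextv^~ v) EE.
    by rewrite !nextv_cat D2E D2E' /= (parse_nextv p1) (parse_nextv p1').
  subst u' D2 D2'.
  have last_u G G' H f0 : u \notin unzip1 G -> disj (unzip1 (G' ++ (u, f0) :: G)) (v :: unzip1 H) ->
      ~~ has (fun q : V * E => q.1 == u) (G ++ H).
    move=> uG /disjP/(_ u); rewrite /unzip1 map_cat mem_cat /= inE eqxx orbT => /(_ isT).
    rewrite inE negb_or => /andP[_ uH]; rewrite has_cat negb_or.
    by apply/andP; split; [apply: contra uG|apply: contra uH] => /hasP[q qG /eqP <-];
      apply: map_f.
  have [] := cat_last_inj (P := fun q => q.1 == u) EE; rewrite /= ?eqxx //.
  + exact: last_u uF d.
  + exact: last_u uF' d'.
  move=> E1 [E2] E3; subst D1' f'.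
  rewrite (IHT _ _ _ p1 p1').
  have [] := IHY _ _ _ _ _ _ v p2 p2' _ n n'.
  + by rewrite !cat_cons (E3 : F ++ C2 = F' ++ C2').
  + apply/disjP => z zF; apply: (disjP _ _ d).
    by rewrite /= /unzip1 map_cat mem_cat /= inE (zF : z \in map _ F) !orbT.
  + apply/disjP => z zF; apply: (disjP _ _ d').
    by rewrite /= /unzip1 map_cat mem_cat /= inE (zF : z \in map _ F') !orbT.
  by move=> -> [->] ->.
Qed.

Lemma parse_uniq T T' v C : parse T v C -> parse T' v C -> T = T'.
Proof. exact: parse_uniq_aux.1. Qed.

End Parse.

(** * Equality patterns of walks *)

Section Pattern.
Variables (X X' : eqType).
Implicit Types l : seq (X * X').

(** The pairs of l form the graph of a partial injection, that is, of a renaming. *)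
Definition coherent l := {in l &, forall p q, (p.1 == q.1) = (p.2 == q.2)}.

Lemma coherentS l l' : {subset l' <= l} -> coherent l -> coherent l'.
Proof. by move=> s c p q /s pl /s ql; apply: c. Qed.

Lemma coherent_cat l l' : coherent l -> coherent l' ->
  disj (unzip1 l) (unzip1 l') -> disj (unzip2 l) (unzip2 l') -> coherent (l ++ l').
Proof.
move=> c c' /disjP d1 /disjP d2.
have h p q : p \in l -> q \in l' -> (p.1 == q.1) = (p.2 == q.2).
  move=> pl ql; have /negP n1 := d1 _ (map_f fst pl); have /negP n2 := d2 _ (map_f snd pl).
  by apply/eqP/eqP => E; [case: n1|case: n2]; rewrite E map_f.
move=> p q; rewrite !mem_cat => /orP[pl|pl] /orP[ql|ql]; [exact: c|exact: h| |exact: c'].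
by rewrite eq_sym [RHS]eq_sym; apply: h.
Qed.

Lemma coherent1 p : coherent [:: p].
Proof. by move=> q r; rewrite !inE => /eqP -> /eqP ->; rewrite !eqxx. Qed.

Lemma disj_zip (s s' : seq X) (t t' : seq X') : size s = size t -> size s' = size t' ->
  disj s s' -> disj t t' -> coherent (zip s t) -> coherent (zip s' t') ->
  coherent (zip (s ++ s') (t ++ t')).
Proof.
move=> st st' d d' c c'; rewrite zip_cat //; apply: coherent_cat => //.
  by rewrite !unzip1_zip ?st ?st'.
by rewrite !unzip2_zip ?st ?st'.
Qed.

End Pattern.

Lemma size_cons2 (X X' : Type) (x : X) (x' : X') s s' :
  size s = size s' -> size (x :: s) = size (x' :: s').
Proof. by move=> /= ->. Qed.

Lemma disj1s (X : eqType) (x : X) s : disj [:: x] s = (x \notin s).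
Proof.
apply/disjP/idP => [/(_ x)|xs y]; first by rewrite inE eqxx; apply.
by rewrite inE => /eqP ->.
Qed.

Section ParsePattern.
Variables (V E V' E' : eqType).

(* Two walks with the same tree repeat vertices and edges at the same places,
   hence differ by a renaming. *)
Lemma parse_pattern :
  (forall T (v : V) (v' : V') (C : seq (V * E)) (C' : seq (V' * E')), parse T v C -> parse T v' C' ->
    [/\ size C = size C', coherent (zip (v :: unzip1 C) (v' :: unzip1 C'))
      & coherent (zip (unzip2 C) (unzip2 C'))]) /\
  (forall Y (v : V) (v' : V') (C : seq (V * E)) (C' : seq (V' * E')), parsec Y v C -> parsec Y v' C' ->
    [/\ size C = size C', coherent (zip (unzip1 C) (unzip1 C'))
      & coherent (zip (unzip2 C) (unzip2 C'))]).
Proof.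
have sz (D : seq (V * E)) (D' : seq (V' * E')) : size D = size D' ->
  size (unzip1 D) = size (unzip1 D') /\ size (unzip2 D) = size (unzip2 D').
  by rewrite !size_map.
apply: tree_chain_ind => /=.
- by move=> v v' C C' -> ->; split => //; apply: coherent1.
- move=> T1 IH1 T2 IH2 v v' C C'.
  move=> [e [u [C1 [C2 [-> [p1 p2] eN dE dV]]]]] [e' [u' [D1 [D2 [-> [q1 q2] eN' dE' dV']]]]].
  have [s1 v1 w1] := IH1 _ _ _ _ p1 q1; have [s2 v2 w2] := IH2 _ _ _ _ p2 q2.
  have [a1 b1] := sz _ _ s1; have [a2 b2] := sz _ _ s2.
  split; first by rewrite /= !size_cat /= s1 s2.
    have := disj_zip (size_cons2 _ _ a1) (size_cons2 _ _ a2) dV dV' v1 v2.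
    apply: coherentS => x; rewrite /= !unzip1_cat /= !zip_cat //= => xl.
    by move: xl; rewrite /= !inE !mem_cat !inE; do !case: (_ == _); rewrite ?orbT //= ?orbF.
  have c12 := disj_zip b1 b2 dE dE' w1 w2.
  have h : size [:: e] = size [:: e'] by [].
  have := disj_zip h _ _ _ (@coherent1 _ _ (e, e')) c12.
  rewrite !disj1s !size_cat b1 b2 => /(_ erefl eN eN').
  apply: coherentS => x; rewrite /= !unzip2_cat /= !zip_cat //.
  by rewrite /= !inE !mem_cat !inE; do !case: (_ == _); rewrite ?orbT //= ?orbF.
- move=> Y IHY T IHT v v' C C'.
  move=> [C1 [C2 [-> [p1 p2] dE dV]]] [D1 [D2 [-> [q1 q2] dE' dV']]].
  have [s1 v1 w1] := IHY _ _ _ _ p1 q1; have [s2 v2 w2] := IHT _ _ _ _ p2 q2.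
  have [a1 b1] := sz _ _ s1; have [a2 b2] := sz _ _ s2.
  split; first by rewrite /= !size_cat /= s1 s2.
    have [f [F [C1E _ _]]] := parsec_head p1; have [f' [F' [D1E _ _]]] := parsec_head q1.
    subst C1 D1; move: a1 dV dV' v1 => /= [a1] dV dV' v1.
    have v1' := coherentS (@mem_behead _ _) v1.
    have := disj_zip a1 (size_cons2 _ _ a2) dV dV' v1' v2.
    apply: coherentS => x; rewrite /= !unzip1_cat /= !zip_cat //= => xl.
    by move: xl; rewrite /= !inE !mem_cat !inE; do !case: (_ == _); rewrite ?orbT //= ?orbF.
  rewrite !unzip2_cat.
  exact: disj_zip b1 b2 dE dE' w1 w2.
- move=> v v' C C' [e ->] [e' ->]; split => //; exact: coherent1.
- move=> T IHT Y IHY v v' C C'.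
  move=> [e [u [C1 [C2 [-> [p1 p2] [eN dE] vN dV]]]]] [e' [u' [D1 [D2 [-> [q1 q2] [eN' dE'] vN' dV']]]]].
  have [s1 v1 w1] := IHT _ _ _ _ p1 q1; have [s2 v2 w2] := IHY _ _ _ _ p2 q2.
  have [a1 b1] := sz _ _ s1; have [a2 b2] := sz _ _ s2.
  split; first by rewrite /= !size_cat /= s1 s2.
    have [f [F [C2E _ _]]] := parsec_head p2; have [f' [F' [D2E _ _]]] := parsec_head q2.
    subst C2 D2; move: a2 vN vN' dV dV' v2 => /= [a2] vN vN' dV dV' v2.
    have v2' := coherentS (@mem_behead _ _) v2.
    have c12 := disj_zip (size_cons2 _ _ a1) a2 dV dV' v1 v2'.
    have sub (X : eqType) (x y : X) (s t : seq X) : x \notin y :: s ++ y :: t -> x \notin (y :: s) ++ t.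
      by rewrite /= !inE !mem_cat !inE; do !case: (_ == _); rewrite ?orbT //= ?orbF.
    have h : size [:: v] = size [:: v'] by [].
    have := disj_zip h _ _ _ (@coherent1 _ _ (v, v')) c12.
    rewrite !disj1s !size_cat /= a1 a2 => /(_ erefl (sub _ _ _ _ _ vN) (sub _ _ _ _ _ vN')).
    apply: coherentS => x; rewrite /= !unzip1_cat /= !zip_cat //=.
    by rewrite /= !inE !mem_cat !inE; do !case: (_ == _); rewrite ?orbT //= ?orbF.
  have c12 := disj_zip b1 b2 dE dE' w1 w2.
  have h : size [:: e] = size [:: e'] by [].
  have := disj_zip h _ _ _ (@coherent1 _ _ (e, e')) c12.
  rewrite !disj1s !size_cat b1 b2 => /(_ erefl eN eN') c.
  by rewrite /= !unzip2_cat.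
Qed.

End ParsePattern.

Section Walk.
Variables (V E : eqType).
Implicit Types (C D : seq (V * E)) (st : V -> E -> V -> bool).

(** The step relation is a parameter: walks are followed in a graph ([gstep]) and in a graph with a
    proper colouring ([cstep]). *)
Fixpoint walk st (x : V) C (y : V) : bool :=
  if C is p :: C' then
    [&& p.1 == x, st x p.2 (nextv C' y) & walk st (nextv C' y) C' y]
  else x == y.

Lemma walk_nextv st x C y : walk st x C y -> nextv C y = x.
Proof. by case: C => [/eqP|p C /and3P[/eqP]]. Qed.

Lemma walk_cat st x C D y :
  walk st x (C ++ D) y = walk st x C (nextv D y) && walk st (nextv D y) D y.
Proof.
elim: C x => [|p C IH] x /=.
  by case: eqP => [<-//|n]; apply/negP => /walk_nextv /esym.
by rewrite nextv_cat IH !andbA.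
Qed.

Lemma eq_walk st st' x C y :
  (forall a e b, a \in unzip1 C -> e \in unzip2 C -> b \in y :: behead (unzip1 C) ->
     st a e b -> st' a e b) -> walk st x C y -> walk st' x C y.
Proof.
elim: C x => [//|p C IH] x h /= /and3P[/eqP px s w]; rewrite px eqxx /=.
have nC : nextv C y \in y :: unzip1 C.
  by case: (C) => [|q D] /=; rewrite !inE eqxx ?orbT.
rewrite h ?inE -?px ?eqxx //=; last by rewrite px.
apply: IH w => a e b aC eC bC; apply: h; rewrite ?inE ?aC ?eC ?orbT //=.
by move: bC; rewrite !inE => /orP[->//|/mem_behead ->]; rewrite orbT.
Qed.

Lemma walk_mem st x C y e : walk st x C y -> e \in unzip2 C ->
  exists a b, [/\ a \in unzip1 C, b \in y :: behead (unzip1 C) & st a e b].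
Proof.
elim: C x => [//|p C IH] x /= /and3P[/eqP px s w].
rewrite inE => /orP[/eqP ->|/(IH _ w)[a [b [aC bC ab]]]]; last first.
  exists a, b; rewrite !inE aC orbT; split=> //.
  by move: bC; rewrite inE => /orP[->//|/mem_behead ->]; rewrite orbT.
exists x, (nextv C y); rewrite px mem_head; split => //.
by case: (C) => [|q D] /=; rewrite !inE eqxx ?orbT.
Qed.

End Walk.

Section ParseMap.
Variables (V E V' E' : eqType) (s : V -> V') (t : E -> E').

Definition map_steps (C : seq (V * E)) := [seq (s p.1, t p.2) | p <- C].

Lemma unzip1_map_steps C : unzip1 (map_steps C) = map s (unzip1 C).
Proof. by rewrite /map_steps /unzip1 -!map_comp. Qed.

Lemma unzip2_map_steps C : unzip2 (map_steps C) = map t (unzip2 C).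
Proof. by rewrite /map_steps /unzip2 -!map_comp. Qed.

Lemma nextv_map C y : nextv (map_steps C) (s y) = s (nextv C y).
Proof. by case: C. Qed.

Lemma walk_map_mem (st : V -> E -> V -> bool) (st' : V' -> E' -> V' -> bool) x C y e :
  walk st x C y -> walk st' (s x) (map_steps C) (s y) -> e \in unzip2 C ->
  exists a b, st a e b /\ st' (s a) (t e) (s b).
Proof.
elim: C x => [//|p C IH] x /= /and3P[_ h w] /and3P[_ h' w'].
rewrite nextv_map in h' w'.
by rewrite inE => /orP[/eqP ->|/(IH _ w w')//]; exists x, (nextv C y).
Qed.

Hypotheses (s_inj : injective s) (t_inj : injective t).

Lemma disj_map (X X' : eqType) (f : X -> X') l l' : injective f ->
  disj (map f l) (map f l') = disj l l'.
Proof.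
move=> fi; apply/disjP/disjP => h x xl.
  by have := h (f x); rewrite !mem_map // => /(_ xl).
by case/mapP: xl => y yl ->; rewrite mem_map // h.
Qed.

Lemma parse_map :
  (forall T v C, parse T v C -> parse T (s v) (map_steps C)) /\
  (forall Y p C, parsec Y p C -> parsec Y (s p) (map_steps C)).
Proof.
apply: tree_chain_ind => /=.
- by move=> v C ->.
- move=> T1 IH1 T2 IH2 v C [e [u [C1 [C2 [-> [p1 p2] eN dE dV]]]]].
  exists (t e), (s u), (map_steps C1), (map_steps C2); split.
  + by rewrite /map_steps /= map_cat.
  + by split; [apply: IH1|apply: IH2].
  + by rewrite !unzip2_map_steps -map_cat mem_map.
  + by rewrite !unzip2_map_steps disj_map.
  + by rewrite !unzip1_map_steps -!map_cons disj_map.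
- move=> Y IHY T IHT v C [C1 [C2 [-> [p1 p2] dE dV]]].
  exists (map_steps C1), (map_steps C2); split.
  + by rewrite /map_steps map_cat.
  + by split; [apply: IHY|apply: IHT].
  + by rewrite !unzip2_map_steps disj_map.
  + by rewrite !unzip1_map_steps behead_map -!map_cons disj_map.
- by move=> p C [e ->]; exists (t e).
- move=> T IHT Y IHY v C [e [u [C1 [C2 [-> [p1 p2] [eN dE] vN dV]]]]].
  exists (t e), (s u), (map_steps C1), (map_steps C2); split.
  + by rewrite /map_steps /= map_cat.
  + by split; [apply: IHT|apply: IHY].
  + by rewrite !unzip2_map_steps -map_cat mem_map // disj_map.
  + by rewrite !unzip1_map_steps -map_cat -map_cons mem_map.
  + by rewrite !unzip1_map_steps behead_map -!map_cons disj_map.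
Qed.

End ParseMap.

Lemma coherent_perm (X : finType) (l l' : seq X) : size l = size l' -> coherent (zip l l') ->
  (forall x, x \in l) -> exists s : {perm X}, map s l = l'.
Proof.
move=> sl c all.
pose f x := nth x l' (index x l).
have iz i x : (i < size l)%N -> (nth x l i, nth x l' i) \in zip l l'.
  by move=> il; rewrite -nth_zip // mem_nth // size_zip -sl minnn.
have fz x : (x, f x) \in zip l l'.
  by have := iz (index x l) x; rewrite index_mem all nth_index // => /(_ isT).
have fi : injective f.
  by move=> x y /eqP fxy; apply/eqP; have := c _ _ (fz x) (fz y); rewrite /= fxy.
exists (perm fi); have [l0|l0] := posnP (size l).
  by rewrite (size0nil l0) (size0nil (etrans (esym sl) l0)).
have x0 : X by case: (l) l0.
apply: (@eq_from_nth _ x0); rewrite size_map // => i il.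
rewrite (nth_map x0) // permE; apply/eqP.
by have := c _ _ (fz (nth x0 l i)) (iz i x0 il); rewrite /= eqxx => <-.
Qed.

Definition gstep (V E : finType) (G : {ffun E -> {set V}}) (x : V) (e : E) (y : V) : bool :=
  G e == [set x; y].

Lemma gcycle_walk (V E : finType) (G : {ffun E -> {set V}}) p C :
  gcycle G (p :: C) = walk (gstep G) p.1 (p :: C) p.1.
Proof.
suff h q : path (fun p q : V * E => G p.2 == [set p.1; q.1]) p (rcons C q)
    = walk (gstep G) p.1 (p :: C) q.1 by exact: h.
elim: C p => [|r C IH] p; first by rewrite /= !eqxx !andbT.
by rewrite [LHS]/= IH [RHS]/= eqxx.
Qed.

Lemma gwalk_ends (V E : finType) (G : {ffun E -> {set V}}) x C y f :
  walk (gstep G) x C y -> f \in unzip2 C ->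
  exists a b, [/\ G f = [set a; b], a \in y :: unzip1 C & b \in y :: unzip1 C].
Proof.
move=> w /(walk_mem w)[a [b [aC bC /eqP Gf]]]; exists a, b; split=> //.
  by rewrite inE aC orbT.
by move: bC; rewrite !inE => /orP[->//|/mem_behead ->]; rewrite orbT.
Qed.

(** Both walks have the same pattern and the first covers all labels, so the renamings are
    permutations. They respect incidence because the ends of an edge can be read off at a step of
    the walk. *)
Lemma parse_iso (n m : nat) (x y : orgraph n m) T v v' :
  parse T v x.2 -> parse T v' y.2 ->
  walk (gstep x.1) v x.2 v -> walk (gstep y.1) v' y.2 v' ->
  (forall w, w \in v :: unzip1 x.2) -> (forall e, e \in unzip2 x.2) -> oc_iso x y.
Proof.
move=> px py wx wy allv alle.
have [sz cv ce] := (parse_pattern _ _ _ _).1 _ _ _ _ _ px py.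
have [s sE] : exists s : {perm 'I_m}, map s (v :: unzip1 x.2) = v' :: unzip1 y.2.
  by apply: coherent_perm => //=; rewrite !size_map sz.
have [t tE] : exists t : {perm 'I_n}, map t (unzip2 x.2) = unzip2 y.2.
  by apply: coherent_perm => //; rewrite !size_map sz.
case: sE => sv sE.
have CE : map_steps s t x.2 = y.2.
  rewrite -[RHS]zip_unzip -sE -tE -[LHS]zip_unzip.
  by rewrite unzip1_map_steps unzip2_map_steps.
apply/existsP; exists s; apply/existsP; exists t; apply/andP; split; last by rewrite -CE.
apply/forallP => e; rewrite -sv -CE in wy.
have [a [b [/eqP -> /eqP ->]]] := walk_map_mem wx wy (alle e).
by rewrite imsetU1 imset_set1.
Qed.

Fixpoint nvert (T : tree) : nat :=
  match T with
  | Leaf => 0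
  | Flex T T' => (nvert T + nvert T').+1
  | Rigid Y T' => nvertc Y + nvert T'
  end
with nvertc (Y : chain) : nat :=
  match Y with
  | Last => 0
  | Link T Y => (nvert T + nvertc Y).+1
  end.

Lemma nvert_le : (forall T, nvert T <= nedge T)%N /\ (forall Y, nvertc Y < nedgec Y)%N.
Proof.
apply: tree_chain_ind => //= [T IH T' IH'|Y IH T IH'|T IH Y IH'].
- by rewrite ltnS leq_add.
- by rewrite leq_add // ltnW.
- by rewrite ltnS -addnS leq_add.
Qed.

(* The boolean [b] tells whether the start of the chain and its
   end are to have different colours. *)
Fixpoint even_cycles (T : tree) : bool :=
  match T with
  | Leaf => true
  | Flex T T' => even_cycles T && even_cycles T'
  | Rigid Y T' => even_cyclesc false Y && even_cycles T'
  end
with even_cyclesc (b : bool) (Y : chain) : bool :=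
  match Y with
  | Last => b
  | Link T Y => even_cycles T && even_cyclesc (~~ b) Y
  end.

Lemma size_split (X : Type) (s : seq X) a b : size s = (a + b)%N ->
  exists s1 s2, [/\ s = s1 ++ s2, size s1 = a & size s2 = b].
Proof.
move=> sE; exists (take a s), (drop a s); rewrite cat_take_drop size_drop sE addKn.
by rewrite size_takel // sE leq_addr.
Qed.

Lemma eq_disj (X : eqType) (s s' t t' : seq X) : s =i s' -> t =i t' -> disj s t = disj s' t'.
Proof. by move=> ss tt; apply/disjP/disjP => h x; have := h x; rewrite ss tt. Qed.

Lemma disjC (X : eqType) (s t : seq X) : disj s t = disj t s.
Proof. by rewrite /disj has_sym. Qed.

Lemma disj_cons (X : eqType) (x : X) s t : disj (x :: s) t = (x \notin t) && disj s t.
Proof.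
apply/disjP/andP => [h|[xt /disjP h] y]; last by rewrite inE => /orP[/eqP ->|/h].
by split; [apply: h; rewrite mem_head|apply/disjP => y ys; apply: h; rewrite inE ys orbT].
Qed.

(** * Realising a tree by a walk in a coloured graph *)

Section ParseExists.
Variables (V E : eqType).

Lemma parse_exists :
  (forall T (v : V) (sv : seq V) (se : seq E), uniq (v :: sv) -> size sv = nvert T ->
     uniq se -> size se = nedge T ->
     exists C, [/\ parse T v C, v :: unzip1 C =i v :: sv & unzip2 C =i se]) /\
  (forall Y (v : V) (sv : seq V) (se : seq E), uniq (v :: sv) -> size sv = nvertc Y ->
     uniq se -> size se = nedgec Y ->
     exists C, [/\ parsec Y v C, unzip1 C =i v :: sv, behead (unzip1 C) =i sv & unzip2 C =i se]).
Proof.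
have mem_cons (X : eqType) (x : X) s t : s =i t -> x :: s =i x :: t.
  by move=> st y; rewrite !inE st.
apply: tree_chain_ind => /=.
- by move=> v sv se _ /size0nil -> _ /size0nil ->; exists [::].
- move=> T1 IH1 T2 IH2 v [//|u sv] [//|e se] uv [/size_split[s1 [s2 [? a1 a2]]]]; subst sv.
  move=> ue [/size_split[t1 [t2 [? b1 b2]]]]; subst se.
  move: uv; rewrite /= !inE !mem_cat cat_uniq !negb_or => /and3P[/and3P[vu vs1 vs2] /andP[us1 us2] /and3P[n1 d12 n2]].
  move: ue; rewrite /= !mem_cat cat_uniq !negb_or => /andP[/andP[et1 et2] /and3P[m1 dt m2]].
  have [||C1 [p1 v1 w1]] := IH1 u s1 t1 _ a1 _ b1; rewrite /= ?us1 //.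
  have [||C2 [p2 v2 w2]] := IH2 v s2 t2 _ a2 _ b2; rewrite /= ?vs2 //.
  exists ((v, e) :: C1 ++ (u, e) :: C2); split.
  + exists e, u, C1, C2; split => //.
    * by rewrite mem_cat w1 w2 negb_or et1.
    * by rewrite (eq_disj w1 w2).
    * rewrite (eq_disj v1 v2) disj_cons inE negb_or eq_sym vu us2 /= disjC disj_cons vs1 disjC //.
  + move=> x; rewrite /= unzip1_cat /=.
    have := v1 x; have := v2 x; rewrite !inE !mem_cat !inE.
    by do !case: (_ == _) => //=; rewrite ?orbT // => -> ->.
  + move=> x; rewrite /= unzip2_cat /= !inE !mem_cat !inE w1 w2.
    by do !case: (_ == _) => //=; rewrite ?orbT.
- move=> Y IHY T IHT v sv se uv /size_split[s1 [s2 [? a1 a2]]]; subst sv.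
  move=> ue /size_split[t1 [t2 [? b1 b2]]]; subst se.
  move: uv ue; rewrite /= !mem_cat !cat_uniq !negb_or.
  move=> /andP[/andP[vs1 vs2] /and3P[n1 d12 n2]] /and3P[m1 dt m2].
  have [||C1 [p1 v1 v1' w1]] := IHY v s1 t1 _ a1 _ b1; rewrite /= ?vs1 //.
  have [||C2 [p2 v2 w2]] := IHT v s2 t2 _ a2 _ b2; rewrite /= ?vs2 //.
  exists (C1 ++ C2); split.
  + exists C1, C2; split => //; first by rewrite (eq_disj w1 w2).
    by rewrite (eq_disj v1' v2) disjC disj_cons vs1 disjC.
  + move=> x; rewrite /= unzip1_cat inE mem_cat v1.
    have := v2 x; rewrite !inE !mem_cat; case: (_ == _) => //= ->; case: (x \in s1) => //.
  + by move=> x; rewrite unzip2_cat !mem_cat w1 w2.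
- move=> v sv [//|e se] _ /size0nil -> _ [/size0nil ->]; exists [:: (v, e)]; split => //.
  by exists e.
- move=> T IHT Y IHY v [//|u sv] [//|e se] uv [/size_split[s1 [s2 [? a1 a2]]]]; subst sv.
  move=> ue [/size_split[t1 [t2 [? b1 b2]]]]; subst se.
  move: uv; rewrite /= !inE !mem_cat cat_uniq !negb_or => /and3P[/and3P[vu vs1 vs2] /andP[us1 us2] /and3P[n1 d12 n2]].
  move: ue; rewrite /= !mem_cat cat_uniq !negb_or => /andP[/andP[et1 et2] /and3P[m1 dt m2]].
  have [||C1 [p1 v1 w1]] := IHT u s1 t1 _ a1 _ b1; rewrite /= ?us1 //.
  have [||C2 [p2 v2 v2' w2]] := IHY u s2 t2 _ a2 _ b2; rewrite /= ?us2 //.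
  have vE : unzip1 (C1 ++ C2) =i u :: s1 ++ s2.
    move=> x; rewrite unzip1_cat mem_cat v2; have := v1 x; rewrite !inE !mem_cat.
    by case: (_ == _); rewrite ?orbT //= => ->.
  exists ((v, e) :: C1 ++ C2); split => //=.
  + exists e, u, C1, C2; split => //.
    * by rewrite mem_cat w1 w2 negb_or et1 et2 (eq_disj w1 w2).
    * by rewrite -unzip1_cat inE vE inE mem_cat !negb_or vu vs1 vs2.
    * by rewrite (eq_disj v1 v2') disj_cons us2.
  + exact: mem_cons.
  + by rewrite unzip2_cat; apply: mem_cons => x; rewrite !mem_cat w1 w2.
Qed.

End ParseExists.

Section ParseGraph.
Variables (V E : finType).

Definition cstep (G : E -> {set V}) (col : V -> bool) (x : V) (e : E) (y : V) : bool :=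
  (G e == [set x; y]) && (col x != col y).

Lemma cstep_glue G G' col col' (x y : V) (C : seq (V * E)) :
  {in unzip2 C, G =1 G'} -> {in x :: y :: unzip1 C, col =1 col'} ->
  walk (cstep G col) x C y -> walk (cstep G' col') x C y.
Proof.
move=> GG cc; apply: eq_walk => a e b aC eC bC; rewrite /cstep GG // !cc //.
  by move: bC; rewrite !inE => /orP[->|/mem_behead ->]; rewrite ?orbT.
by rewrite !inE aC !orbT.
Qed.

(** Branches share no edge, so the graph can be defined branch by branch, and colourings of branches
    agreeing at their common vertex glue. For a chain the end q and its colour are prescribed; a
    closed chain forces equal colours, whence the condition on b. *)
Lemma parse_graph :
  (forall T v (C : seq (V * E)) c, parse T v C -> even_cycles T ->
     exists G col, col v = c /\ walk (cstep G col) v C v) /\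
  (forall Y p (C : seq (V * E)) q b c, parsec Y p C -> even_cyclesc b Y ->
     q \notin behead (unzip1 C) -> (q = p -> b = false) ->
     exists G col, [/\ col p = c, col q = c (+) b & walk (cstep G col) p C q]).
Proof.
apply: tree_chain_ind => /=.
- by move=> v C c -> _; exists (fun _ => set0), (fun _ => c); rewrite /= eqxx.
- move=> T1 IH1 T2 IH2 v C c [e [u [C1 [C2 [-> [p1 p2] eN dE dV]]]]] /andP[b1 b2].
  have [G1 [col1 [c1 w1]]] := IH1 _ _ (~~ c) p1 b1.
  have [G2 [col2 [c2 w2]]] := IH2 _ _ c p2 b2.
  pose G f := if f == e then [set v; u] else if f \in unzip2 C1 then G1 f else G2 f.
  pose col x := if x \in u :: unzip1 C1 then col1 x else col2 x.
  move: eN; rewrite mem_cat negb_or => /andP[eC1 eC2].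
  have cu : col u = ~~ c by rewrite /col mem_head.
  have cv : col v = c.
    by rewrite /col ifN //; apply/negP => /(disjP _ _ dV); rewrite mem_head.
  have s1 : cstep G col v e u by rewrite /cstep /G !eqxx cu cv; case: (c).
  have s2 : cstep G col u e v by rewrite /cstep /G !eqxx cu cv setUC eqxx; case: (c).
  have w1' : walk (cstep G col) u C1 u.
    apply: cstep_glue w1 => [f fC1|x xC1]; last by rewrite /col (_ : x \in _) //; move: xC1; rewrite !inE orbA orbb.
    by rewrite /G fC1; case: eqP => // fe; rewrite -fe fC1 in eC1.
  have w2' : walk (cstep G col) v C2 v.
    apply: cstep_glue w2 => [f fC2|x xC2]; last first.
      rewrite /col ifN //; apply/negP => /(disjP _ _ dV).
      by move: xC2; rewrite !inE orbA orbb => ->.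
    rewrite /G ifN; last by apply: contraNneq eC2 => <-.
    by rewrite ifN //; apply/negP => /(disjP _ _ dE); rewrite fC2.
  exists G, col; split => //.
  rewrite /= eqxx nextv_cat (parse_nextv p1) walk_cat /= (parse_nextv p2) eqxx.
  by rewrite s1 s2 w1' w2'.
- move=> Y IHY T IHT v C c [C1 [C2 [-> [p1 p2] dE dV]]] /andP[b1 b2].
  have vC1 : v \notin behead (unzip1 C1) by apply/negP => /(disjP _ _ dV); rewrite mem_head.
  have [G1 [col1 [c1 _ w1]]] := IHY _ _ v _ c p1 b1 vC1 (fun _ => erefl).
  have [G2 [col2 [c2 w2]]] := IHT _ _ c p2 b2.
  pose G f := if f \in unzip2 C1 then G1 f else G2 f.
  pose col x := if x \in behead (unzip1 C1) then col1 x else col2 x.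
  have cv : col v = c by rewrite /col ifN.
  exists G, col; split => //; rewrite walk_cat (parse_nextv p2); apply/andP; split.
    apply: cstep_glue w1 => [f fC1|x xC1]; first by rewrite /G fC1.
    rewrite /col; case: ifP => // xN; suff -> : x = v by rewrite c1 c2.
    have [f [C' [C1E _ _]]] := parsec_head p1.
    by move: xC1 xN; rewrite C1E /= !inE !orbA !orbb => /orP[/eqP ->|->].
  apply: cstep_glue w2 => [f fC2|x xC2].
    by rewrite /G ifN //; apply/negP => /(disjP _ _ dE); rewrite fC2.
  rewrite /col ifN //; apply/negP => /(disjP _ _ dV).
  by move: xC2; rewrite !inE orbA orbb => ->.
- move=> p C q b c [e ->] -> _ qp.
  have pq : q != p by apply/eqP => /qp.
  exists (fun _ => [set p; q]), (fun x => if x == p then c else ~~ c); split => //=.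
  + by rewrite eqxx.
  + by rewrite (negbTE pq) addbT.
  + by rewrite !eqxx /cstep !eqxx (negbTE pq) andbT /=; case: (c).
- move=> T IHT Y IHY p C q b c [e [u [C1 [C2 [-> [p1 p2] [eN dE] pN dV]]]]] /andP[b1 b2] /= qN qp.
  have [f [C' [C2E _ uC']]] := parsec_head p2.
  have uC2 : u \in unzip1 C2 by rewrite C2E mem_head.
  have [qu qC1 qC2] : [/\ q != u, q \notin unzip1 C1 & q \notin unzip1 C2].
    move: qN; rewrite unzip1_cat mem_cat negb_or => /andP[-> qC2]; split => //.
    by apply: contraNneq qC2 => ->.
  have [G1 [col1 [c1 w1]]] := IHT _ _ (~~ c) p1 b1.
  have qC2b : q \notin behead (unzip1 C2) by apply: contra qC2; apply: mem_behead.
  have qu' : q = u -> ~~ b = false by move=> E'; rewrite E' eqxx in qu.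
  have [G2 [col2 [c2 cq2 w2]]] := IHY _ _ q _ (~~ c) p2 b2 qC2b qu'.
  pose G f := if f == e then [set p; u] else if f \in unzip2 C1 then G1 f else G2 f.
  pose col x := if x == p then c else if x \in u :: unzip1 C1 then col1 x else col2 x.
  move: eN; rewrite mem_cat negb_or => /andP[eC1 eC2].
  move: pN; rewrite inE mem_cat !negb_or => /and3P[pu pC1 pC2].
  have cp : col p = c by rewrite /col eqxx.
  have cu : col u = ~~ c by rewrite /col eq_sym (negbTE pu) mem_head.
  have cq : col q = c (+) b.
    rewrite /col; case: eqP => [/qp ->|_]; first by rewrite addbF.
    by rewrite inE (negbTE qu) (negbTE qC1) cq2 addNb addbN negbK.
  have s1 : cstep G col p e u by rewrite /cstep /G !eqxx cu cp; case: (c).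
  have w1' : walk (cstep G col) u C1 u.
    apply: cstep_glue w1 => [g gC1|x].
      by rewrite /G gC1; case: eqP => // ge; rewrite -ge gC1 in eC1.
    rewrite !inE orbA orbb => xC1; rewrite /col inE xC1 ifN //.
    by apply: contraTneq xC1 => ->; rewrite negb_or pu.
  have w2' : walk (cstep G col) u C2 q.
    apply: cstep_glue w2 => [g gC2|x].
      rewrite /G ifN; last by apply: contraNneq eC2 => <-.
      by rewrite ifN //; apply/negP => /(disjP _ _ dE); rewrite gC2.
    rewrite inE => /orP[/eqP ->|]; first by rewrite cu c2.
    rewrite inE => /orP[/eqP ->|xC2]; first by rewrite cq cq2 addNb addbN negbK.
    rewrite /col ifN; last by apply: contraNneq pC2 => <-.
    move: xC2; rewrite C2E /= inE => /orP[/eqP ->|xC2]; first by rewrite mem_head c1 c2.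
    rewrite ifN //; apply/negP => /(disjP _ _ dV).
    by rewrite C2E /= xC2.
  exists G, col; split => //.
  by rewrite /= eqxx nextv_cat (walk_nextv w2') (parse_nextv p1) s1 walk_cat (walk_nextv w2') w1' w2'.
Qed.

End ParseGraph.

(** * Closed walks with an excursion tree are outercycles of cacti *)

Section SimpleCycles.
Variables (V E : finType) (G : {ffun E -> {set V}}).
Implicit Types (C D Z : seq (V * E)).

Lemma set2_inj (x y y' : V) : [set x; y] = [set x; y'] -> y = y'.
Proof.
move=> h; have /set2P[yx|//] : y \in [set x; y'] by rewrite -h set22.
by have /set2P[->|//] : y' \in [set x; y] by rewrite h set22.
Qed.

Lemma simple_cycle_rot k C : simple_cycle G (rot k C) = simple_cycle G C.
Proof. by rewrite /simple_cycle /gcycle rot_cycle /unzip1 /unzip2 !map_rot !rot_uniq. Qed.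

Lemma rot_trans (T : Type) (s t u : seq T) : (exists k, t = rot k s) -> (exists k, u = rot k t) ->
  exists k, u = rot k s.
Proof.
move=> [k ->] [k' ->].
have [ks|/ltnW sk] := leqP k (size s); last by exists k'; rewrite (rot_oversize sk).
have [ks'|/ltnW sk'] := leqP k' (size s); last by exists k; rewrite (@rot_oversize _ k') ?size_rot.
by rewrite rot_add_mod //; eexists.
Qed.

Lemma rot_sym (T : Type) (s t : seq T) : (exists k, t = rot k s) -> exists k, s = rot k t.
Proof. by move=> [k ->]; exists (size (rot k s) - k)%N; rewrite -/(rotr k (rot k s)) rotK. Qed.

Lemma simple_cycle_walk p C : simple_cycle G (p :: C) =
  [&& walk (gstep G) p.1 (p :: C) p.1, uniq (unzip1 (p :: C)) & uniq (unzip2 (p :: C))].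
Proof. by rewrite /simple_cycle gcycle_walk. Qed.

(** The edge f determines the next vertex y'. The next edge of C lies on D as well, and D has at y'
    only f and its own next edge. *)
Lemma simple_cycle_prefix p C D P y f : simple_cycle G (p :: C) -> simple_cycle G (p :: D) ->
  {subset unzip2 (p :: C) <= unzip2 (p :: D)} ->
  forall C' D', p :: C = P ++ (y, f) :: C' -> p :: D = P ++ (y, f) :: D' -> C' = D'.
Proof.
rewrite !simple_cycle_walk => /and3P[wC uC eC] /and3P[wD uD eD] sub C'.
elim: C' P y f => [|[y' g] C' IH] P y f D' CE DE.
  case: D' DE => [//|[y' g] D' DE].
  have y'p : y' = p.1.
    move: wC wD; rewrite CE DE !walk_cat /= => /andP[_ /and3P[_ /eqP h _]] /andP[_ /and3P[_ /eqP h' _]].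
    by apply: (@set2_inj y); rewrite -h -h'.
  move: uD; have := congr1 unzip1 DE; rewrite unzip1_cat => DE1.
  rewrite DE1 cat_uniq => /and3P[_ /hasPn hP /= /andP[yN _]].
  case: P CE DE DE1 hP => [|q P] CE DE DE1 hP.
    case: DE => pE _; rewrite pE /= in y'p.
    by move: yN; rewrite y'p mem_head.
  case: DE => pE _; have := hP y'; rewrite /= !inE eqxx orbT => /(_ isT).
  by rewrite y'p pE eqxx.
have y'p : y' != p.1.
  move: uC; have := congr1 unzip1 CE; rewrite unzip1_cat => CE1.
  rewrite CE1 cat_uniq => /and3P[_ /hasPn hP /= /andP[yN _]].
  case: P CE CE1 DE hP => [|q P] CE CE1 DE hP.
    case: CE => pE _; rewrite pE /=.
    by apply: contraNneq yN => ->; rewrite mem_head.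
  case: CE => pE _; have := hP y'; rewrite /= !inE eqxx orbT => /(_ isT).
  by rewrite pE negb_or => /andP[].
move: wC wD; rewrite CE DE !walk_cat /= => /andP[_ /and3P[_ /eqP h /and3P[_ /eqP hg _]]].
move=> /andP[wP /and3P[_ /eqP h' w']].
have {}wP : walk (gstep G) p.1 P y := wP.
have n'E : nextv D' p.1 = y' by apply: (@set2_inj y); rewrite -h -h'.
case: D' DE n'E w' h' => [|[z g'] D'] DE /= n'E; first by rewrite -n'E eqxx in y'p.
have zy : z = y' := n'E.
subst z; move=> /and3P[_ hg' w'] h'.
have gD : g \in unzip2 (p :: D) by apply: sub; rewrite CE unzip2_cat mem_cat /= !inE eqxx !orbT.
have gf : g != f.
  move: eC; rewrite CE unzip2_cat cat_uniq /= => /and3P[_ _ /and3P[fN _ _]].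
  by apply: contraNneq fN => ->; rewrite mem_head.
have y'g : y' \in G g by rewrite hg set21.
move: uD; rewrite DE unzip1_cat cat_uniq => /and3P[_ /hasPn hP /and3P[yN y'D _]].
have y'P : y' \notin unzip1 P.
  by apply: (hP y'); rewrite in_cons mem_head orbT.
have yy' : y != y' by apply: contraNneq yN => ->; rewrite mem_head.
have {}y'D : y' \notin unzip1 D' := y'D.
have gg : g = g'.
  move: gD; rewrite DE unzip2_cat mem_cat /= !inE (negbTE gf) /=.
  case/or3P => [gP|/eqP //|gD'].
    have [a [b [aP bP /eqP ab]]] := walk_mem wP gP.
    move: y'g; rewrite ab => /set2P[E'|E']; first by rewrite E' aP in y'P.
    move: bP; rewrite -E' inE => /orP[/eqP E''|/mem_behead bP].
      by rewrite -E'' E'' eqxx in yy'.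
    by rewrite bP in y'P.
  have [a [b [aP bP /eqP ab]]] := walk_mem w' gD'.
  move: y'g; rewrite ab => /set2P[E'|E']; first by rewrite E' aP in y'D.
  move: bP; rewrite -E' inE => /orP[E''|/mem_behead bP]; first by rewrite E'' in y'p.
  by rewrite bP in y'D.
subst g'; congr (_ :: _).
by apply: (IH (rcons P (y, f)) y' g); rewrite cat_rcons.
Qed.

Lemma simple_cycle_eq_start C D q : simple_cycle G C -> simple_cycle G D ->
  q \in C -> q \in D -> {subset unzip2 C <= unzip2 D} -> exists k, D = rot k C.
Proof.
move=> sC sD qC qD sub.
have [i C' CE] := rot_to qC; have [j D' DE] := rot_to qD.
have CD : C' = D'.
  case: q CE DE {qC qD} => x e CE DE.
  apply: (@simple_cycle_prefix (x, e) C' D' [::] x e) => //.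
  - by rewrite -CE simple_cycle_rot.
  - by rewrite -DE simple_cycle_rot.
  - by move=> f; rewrite -CE -DE /unzip2 !map_rot !mem_rot; apply: sub.
apply: (@rot_trans _ _ (rot i C)); first by exists i.
by apply: rot_sym; exists j; rewrite CE DE CD.
Qed.

Fixpoint rev_walk C (y : V) : seq (V * E) :=
  if C is p :: C' then rcons (rev_walk C' y) (nextv C' y, p.2) else [::].

Lemma rev_walkP x C y : walk (gstep G) x C y -> walk (gstep G) y (rev_walk C y) x.
Proof.
elim: C x => [|p C IH] x /=; first by rewrite eq_sym.
move=> /and3P[/eqP px s w]; rewrite -cats1 walk_cat IH // /= !eqxx andbT /gstep setUC.
exact: s.
Qed.

Lemma unzip2_rev_walk C y : unzip2 (rev_walk C y) = rev (unzip2 C).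
Proof. by elim: C => //= p C IH; rewrite rev_cons -IH /unzip2 map_rcons. Qed.

Lemma unzip1_rev_walk p C y : unzip1 (rev_walk (p :: C) y) = y :: rev (unzip1 C).
Proof.
elim: C p => [|q C IH] p //.
rewrite -[rev_walk _ _]/(rcons (rev_walk (q :: C) y) (q.1, p.2)).
by rewrite /unzip1 map_rcons [map _ _]IH rev_cons rcons_cons.
Qed.

Lemma rev_cycleE p C : Defs.rev_cycle (p :: C) = rev_walk (p :: C) p.1.
Proof.
rewrite -[RHS]zip_unzip unzip2_rev_walk unzip1_rev_walk /Defs.rev_cycle /=.
by rewrite rev_cons rotr1_rcons.
Qed.

Lemma simple_cycle_rev C : simple_cycle G C -> simple_cycle G (Defs.rev_cycle C).
Proof.
case: C => [|p C] //; rewrite rev_cycleE simple_cycle_walk => /and3P[w u1 u2].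
have := rev_walkP w; have := unzip1_rev_walk p C p.1; have := unzip2_rev_walk (p :: C) p.1.
case: (rev_walk _ _) => [|q D] //; move=> e2 e1 w'; rewrite simple_cycle_walk.
case: (e1) => ->; rewrite w' e1 e2 rev_uniq u2 andbT /=.
by move: u1; rewrite /= mem_rev rev_uniq.
Qed.

Lemma mem_rev_cycle C e : (e \in unzip2 (Defs.rev_cycle C)) = (e \in unzip2 C).
Proof. by case: C => [|p C] //; rewrite rev_cycleE unzip2_rev_walk mem_rev. Qed.

Lemma rev_walk_step a C b x e y : walk (gstep G) a C b -> (x, e) \in C ->
  G e = [set x; y] -> (y, e) \in rev_walk C b.
Proof.
move=> w xeC Ge; elim: C a w xeC => //= q D IH a /and3P[/eqP qa s w].
rewrite inE mem_rcons => /orP[/eqP qE|/(IH _ w)]; last by rewrite inE => ->; rewrite orbT.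
rewrite inE -qE /= (_ : y = nextv D b) ?eqxx //.
by apply: (@set2_inj x); rewrite -Ge; move: s; rewrite -qa -qE => /eqP.
Qed.

Lemma walk_step_mem a C b x e : walk (gstep G) a C b -> (x, e) \in C -> x \in G e.
Proof.
elim: C a => //= q D IH a /and3P[/eqP qa s w].
rewrite inE => /orP[/eqP qE|/(IH _ w)//].
by move: s; rewrite -qa -qE => /eqP ->; rewrite set21.
Qed.

(** D passes a common edge in the direction of C or of its reversal; from there every step is forced
    by [simple_cycle_prefix]. *)
Lemma sub_simple_cycle C D : C != [::] -> simple_cycle G C -> simple_cycle G D ->
  {subset unzip2 C <= unzip2 D} -> same_cycle C D.
Proof.
case: C => // [[x e] C] _ sC sD sub.
have eD : e \in unzip2 D by apply: sub; rewrite mem_head.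
have [[z e'] zD /= E'] := mapP eD; subst e'.
have gC : gcycle G ((x, e) :: C) by case/and3P: sC.
have : exists y, G e = [set x; y].
  by move: gC; rewrite gcycle_walk /= => /and3P[_ /eqP -> _]; exists (nextv C x).
move=> [y Ge].
have zG : z \in G e.
  case: D sD zD {sub eD} => // q D; rewrite simple_cycle_walk => /and3P[w _ _] zD.
  exact: walk_step_mem w zD.
have [k kE] : exists k, D = rot k ((x, e) :: C) \/ D = rot k (Defs.rev_cycle ((x, e) :: C)); last by exists k.
move: zG; rewrite Ge => /set2P[zx|zy].
  have [k ->] : exists k, D = rot k ((x, e) :: C); last by exists k; left.
  by apply: (simple_cycle_eq_start (q := (x, e))); rewrite ?mem_head // -zx.
have [k ->] : exists k, D = rot k (Defs.rev_cycle ((x, e) :: C)); last by exists k; right.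
apply: (simple_cycle_eq_start (q := (y, e))); rewrite ?simple_cycle_rev //.
- move: gC; rewrite gcycle_walk => w; rewrite rev_cycleE.
  by apply: (rev_walk_step w _ Ge); rewrite mem_head.
- by rewrite -zy.
- by move=> f; rewrite mem_rev_cycle; apply: sub.
Qed.

Lemma mem_same_cycle C D e : same_cycle C D -> (e \in unzip2 D) = (e \in unzip2 C).
Proof. by move=> [k [->|->]]; rewrite /unzip2 map_rot mem_rot // [LHS]mem_rev_cycle. Qed.

End SimpleCycles.

Section ParseCactus.
Variables (V E : finType) (G : {ffun E -> {set V}}).
Implicit Types (C D Z : seq (V * E)) (U : {set V}).

Definition crosses U (f : E) : bool := (G f :&: U != set0) && (G f :\: U != set0).

Lemma crossesE U f x y : G f = [set x; y] -> crosses U f = (x \in U) (+) (y \in U).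
Proof.
rewrite /crosses => ->; case xU : (x \in U); case yU : (y \in U) => /=.
- rewrite [_ :\: _](_ : _ = set0) ?eqxx ?andbF //; apply/setP => z; rewrite !inE.
  by apply/negP => /andP[zU /orP[/eqP E'|/eqP E']]; rewrite E' ?xU ?yU in zU.
- by apply/andP; split; apply/set0Pn; [exists x|exists y]; rewrite !inE eqxx ?xU ?yU ?orbT.
- by apply/andP; split; apply/set0Pn; [exists y|exists x]; rewrite !inE eqxx ?xU ?yU ?orbT.
- rewrite [_ :&: _](_ : _ = set0) ?eqxx //; apply/setP => z; rewrite !inE.
  by apply/negP => /andP[/orP[/eqP E'|/eqP E'] zU]; rewrite E' ?xU ?yU in zU.
Qed.

Lemma walk_parity U x C y : walk (gstep G) x C y ->
  odd (count (crosses U) (unzip2 C)) = (x \in U) (+) (y \in U).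
Proof.
elim: C x => [|p C IH] x /=; first by move=> /eqP ->; rewrite addbb.
move=> /and3P[_ /eqP s /IH h]; rewrite oddD h (crossesE _ s) oddb.
by rewrite -addbA addKb.
Qed.

Lemma cycle_parity U C : gcycle G C -> ~~ odd (count (crosses U) (unzip2 C)).
Proof.
by case: C => // p C; rewrite gcycle_walk => /walk_parity ->; rewrite addbb.
Qed.

Lemma crosses_sym U U' f x y : G f = [set x; y] ->
  crosses ((U :\: U') :|: (U' :\: U)) f = crosses U f (+) crosses U' f.
Proof.
move=> Gf; rewrite !(crossesE _ Gf) !inE.
by do 4 case: (_ \in _).
Qed.

(* The edges of [C] satisfying [P] are those leaving a vertex set that avoids
   [v]; a closed walk crosses them an even number of times. *)
Definition cut (v : V) C (P : pred E) := exists U : {set V},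
  [/\ v \notin U, {subset U <= unzip1 C} & forall f, f \in unzip2 C -> crosses U f = P f].

Lemma eq_cut v C (P Q : pred E) : {in unzip2 C, P =1 Q} -> cut v C P -> cut v C Q.
Proof. by move=> PQ [U [h1 h2 h3]]; exists U; split => // f fC; rewrite h3 // PQ. Qed.

Lemma cut_addb v x C y (P Q : pred E) : walk (gstep G) x C y -> cut v C P -> cut v C Q ->
  cut v C (fun f => P f (+) Q f).
Proof.
move=> w [U [h1 h2 h3]] [U' [h1' h2' h3']]; exists ((U :\: U') :|: (U' :\: U)); split.
- by rewrite !inE (negbTE h1) (negbTE h1') !andbF.
- by move=> z; rewrite !inE => /orP[/andP[_ /h2]|/andP[_ /h2']].
- move=> f fC; have [a [b [_ _ /eqP Gf]]] := walk_mem w fC.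
  by rewrite (crosses_sym _ _ Gf) h3 // h3'.
Qed.

(* The part [C'] of [C] is attached to the rest at [u] only. *)
Lemma cut_lift u v C' C (P : pred E) : {subset unzip1 C' <= unzip1 C} ->
  (v \in unzip1 C' -> v = u) ->
  (forall f, f \in unzip2 C -> f \notin unzip2 C' -> exists a b, [/\ G f = [set a; b],
     (a \in unzip1 C' -> a = u) & (b \in unzip1 C' -> b = u)]) ->
  (forall f, P f -> f \in unzip2 C') ->
  cut u C' P -> cut v C P.
Proof.
move=> CC vC' rest PC' [U [uU UC' hU]]; exists U; split.
- by apply: contra uU => vU; rewrite -(vC' (UC' _ vU)).
- by move=> z /UC'/CC.
- move=> f fC; case: (boolP (f \in unzip2 C')) => [/hU//|fC'].
  have [a [b [Gf aC' bC']]] := rest _ fC fC'.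
  rewrite (crossesE _ Gf) (_ : P f = false); last by apply: contraNF fC' => /PC'.
  have aU : a \notin U by apply: contra uU => aU; rewrite -(aC' (UC' _ aU)).
  have bU : b \notin U by apply: contra uU => bU; rewrite -(bC' (UC' _ bU)).
  by rewrite (negbTE aU) (negbTE bU).
Qed.

Definition flex_in v C e := count_mem e (unzip2 C) = 2 /\ cut v C (pred1 e).

(* Any two edges of [Z] form a cut, so by parity a simple cycle through one edge
   of [Z] contains all of [Z]. *)
Definition rigid_in v C e := count_mem e (unzip2 C) = 1%N /\
  exists Z, [/\ simple_cycle G Z, e \in unzip2 Z, {subset unzip2 Z <= unzip2 C}
    & forall f g, f \in unzip2 Z -> g \in unzip2 Z -> cut v C (fun h => (h == f) (+) (h == g))].

Definition local v C e := flex_in v C e \/ rigid_in v C e.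

Lemma local_lift u v C' C e : {subset unzip1 C' <= unzip1 C} ->
  {subset unzip2 C' <= unzip2 C} ->
  (v \in unzip1 C' -> v = u) ->
  (forall f, f \in unzip2 C -> f \notin unzip2 C' -> exists a b, [/\ G f = [set a; b],
     (a \in unzip1 C' -> a = u) & (b \in unzip1 C' -> b = u)]) ->
  e \in unzip2 C' ->
  count_mem e (unzip2 C) = count_mem e (unzip2 C') ->
  local u C' e -> local v C e.
Proof.
move=> s1 s2 vC' rest eC' cE [[c2 ct]|[c1 [Z [sZ eZ ZC' ct]]]]; [left|right].
  split; first by rewrite cE.
  by apply: cut_lift ct => // f /eqP ->.
split; first by rewrite cE.
exists Z; split => // [f /ZC'/s2//|f g fZ gZ].
apply: cut_lift (ct _ _ fZ gZ) => // h.
by case: eqP => [-> _|_]; [apply: ZC'|move=> /= /eqP ->; apply: ZC'].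
Qed.

(** Z is the part of C lying on the simple cycle. It keeps the first edge of C because, when a link
    is put in front, the tree hanging at the new vertex is cut off by the new edge and exactly this
    one. *)
Definition chain_local p C q Z :=
  [/\ walk (gstep G) p Z q, uniq (unzip1 Z) /\ uniq (unzip2 Z),
      {subset unzip1 Z <= unzip1 C} /\ {subset unzip2 Z <= unzip2 C},
      ohead (unzip2 Z) = ohead (unzip2 C) /\ (forall e, e \in unzip2 Z -> count_mem e (unzip2 C) = 1%N)
    & (forall f g, f \in unzip2 Z -> g \in unzip2 Z -> cut p C (fun h => (h == f) (+) (h == g)))
      /\ (forall e, e \in unzip2 C -> e \in unzip2 Z \/ local p C e)].

Lemma count_disj (X : eqType) (s : seq X) x : x \notin s -> count_mem x s = 0%N.
Proof. by move=> xs; apply/count_memPn. Qed.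

(** The far branch of a flexible edge is left by this edge only. A tree hanging at a cycle vertex is
    left by the two neighbouring cycle edges, and adding such cuts modulo 2 gives every pair of
    cycle edges. *)
Lemma parse_local :
  (forall T v C, parse T v C -> walk (gstep G) v C v -> forall e, e \in unzip2 C -> local v C e) /\
  (forall Y p C q, parsec Y p C -> walk (gstep G) p C q -> q \notin behead (unzip1 C) ->
     exists Z, chain_local p C q Z).
Proof.
apply: tree_chain_ind => /=.
- by move=> v C -> _ e.
- move=> T1 IH1 T2 IH2 v C [e [u [C1 [C2 [-> [p1 p2] eN dE dV]]]]] /=.
  rewrite eqxx nextv_cat (parse_nextv p1) walk_cat /= (parse_nextv p2) !eqxx /=.
  move=> /and4P[s w1 s' w2].
  move: eN; rewrite mem_cat negb_or => /andP[eC1 eC2].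
  have Ge : G e = [set v; u] by apply/eqP.
  have vu : v \notin u :: unzip1 C1 by apply/negP => /(disjP _ _ dV); rewrite mem_head.
  have en1 f : f \in unzip2 C1 -> _ := gwalk_ends w1 (f := f).
  have en2 f : f \in unzip2 C2 -> _ := gwalk_ends w2 (f := f).
  set C0 := (v, e) :: _.
  have m2 f : (f \in unzip2 C0) = [|| f == e, f \in unzip2 C1 | f \in unzip2 C2].
    by rewrite /C0 /= unzip2_cat !inE mem_cat /= inE; do !case: (_ == _); rewrite ?orbT.
  have m1 z : (z \in unzip1 C0) = [|| z == v, z == u, z \in unzip1 C1 | z \in unzip1 C2].
    rewrite /C0 /= unzip1_cat !inE mem_cat /= inE.
    by do !case: (_ == _); rewrite ?orbT.
  have cnt f : count_mem f (unzip2 C0) = ((f == e).*2 + count_mem f (unzip2 C1) + count_mem f (unzip2 C2))%N.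
    rewrite /C0 /= unzip2_cat count_cat /= [e == f]eq_sym -addnn; lia.
  have cross12 z : z \in u :: unzip1 C1 -> z \in v :: unzip1 C2 -> False.
    by move=> /(disjP _ _ dV) /negP.
  move=> f; rewrite m2 => /or3P[/eqP ->|fC1|fC2].
  + left; split; first by rewrite cnt eqxx !count_disj.
    exists [set z in u :: unzip1 C1]; split => [|z|g].
    * by rewrite inE.
    * by rewrite inE m1 inE => /orP[->|->]; rewrite ?orbT.
    * rewrite m2 => /or3P[/eqP ->|gC1|gC2].
      - by rewrite (crossesE _ Ge) !inE eqxx -in_cons (negbTE vu) /= eqxx.
      - have [a [b [Gg aC bC]]] := en1 _ gC1; rewrite (crossesE _ Gg) !inE -!in_cons aC bC /=.
        by apply/esym/negbTE; apply: contraNneq eC1 => <-.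
      - have [a [b [Gg aC bC]]] := en2 _ gC2; rewrite (crossesE _ Gg) !inE -!in_cons.
        have -> : (a \in u :: unzip1 C1) = false by apply/negP => /cross12/(_ aC).
        have -> : (b \in u :: unzip1 C1) = false by apply/negP => /cross12/(_ bC).
        by apply/esym/negbTE; apply: contraNneq eC2 => <-.
  + apply: (@local_lift u v C1 C0 f) (IH1 _ _ p1 w1 _ fC1) => //.
    * by move=> z zC; rewrite m1 zC !orbT.
    * by move=> g gC; rewrite m2 gC orbT.
    * by move=> vC; move: vu; rewrite inE vC orbT.
    * move=> g; rewrite m2 => /or3P[/eqP ->|->//|gC2] _.
        by exists v, u; split => // vC; move: vu; rewrite inE vC orbT.
      have [a [b [Gg aC bC]]] := en2 _ gC2; exists a, b; split => // zC.
        by case: (cross12 a) => //; rewrite inE zC orbT.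
      by case: (cross12 b) => //; rewrite inE zC orbT.
    * rewrite cnt (count_disj (disjP _ _ dE _ fC1)) (_ : f == e = false) ?addn0 //.
      by apply: contraNF eC1 => /eqP <-.
  + apply: (@local_lift v v C2 C0 f) (IH2 _ _ p2 w2 _ fC2) => //.
    * by move=> z zC; rewrite m1 zC !orbT.
    * by move=> g gC; rewrite m2 gC !orbT.
    * move=> g; rewrite m2 => /or3P[/eqP ->|gC1|->//] _.
        by exists v, u; split => // uC; case: (cross12 u); rewrite !inE ?uC ?eqxx ?orbT.
      have [a [b [Gg aC bC]]] := en1 _ gC1; exists a, b; split => // zC.
        by case: (cross12 a) => //; rewrite inE zC orbT.
      by case: (cross12 b) => //; rewrite inE zC orbT.
    * have fC1 : f \notin unzip2 C1 by apply/negP => /(disjP _ _ dE); rewrite fC2.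
      rewrite cnt (count_disj fC1) (_ : f == e = false) //.
      by apply: contraNF eC2 => /eqP <-.
- move=> Y IHY T IHT v C [C1 [C2 [-> [p1 p2] dE dV]]].
  rewrite walk_cat (parse_nextv p2) => /andP[w1 w2].
  have vC1 : v \notin behead (unzip1 C1) by apply/negP => /(disjP _ _ dV); rewrite mem_head.
  have [Z [wZ [u1Z u2Z] [s1Z s2Z] [_ cZ] [cutZ locZ]]] := IHY _ _ v p1 w1 vC1.
  have both z : z \in unzip1 C1 -> z \in v :: unzip1 C2 -> z = v.
    have [f [C' [C1E _ _]]] := parsec_head p1; rewrite C1E /= in dV *.
    by rewrite inE => /orP[/eqP ->//|/(disjP _ _ dV)/negP].
  have en1 f : f \in unzip2 C1 -> _ := gwalk_ends w1 (f := f).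
  have en2 f : f \in unzip2 C2 -> _ := gwalk_ends w2 (f := f).
  have both' z : z \in unzip1 C2 -> z \in v :: unzip1 C1 -> z = v.
    by rewrite inE => zC /orP[/eqP ->//|/both]; apply; rewrite inE zC orbT.
  have m2 f : (f \in unzip2 (C1 ++ C2)) = (f \in unzip2 C1) || (f \in unzip2 C2).
    by rewrite unzip2_cat mem_cat.
  have m1 z : (z \in unzip1 (C1 ++ C2)) = (z \in unzip1 C1) || (z \in unzip1 C2).
    by rewrite unzip1_cat mem_cat.
  have cnt f : count_mem f (unzip2 (C1 ++ C2)) = (count_mem f (unzip2 C1) + count_mem f (unzip2 C2))%N.
    by rewrite unzip2_cat count_cat.
  have rest1 g : g \in unzip2 (C1 ++ C2) -> g \notin unzip2 C1 -> exists a b, [/\ G g = [set a; b],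
     (a \in unzip1 C1 -> a = v) & (b \in unzip1 C1 -> b = v)].
    rewrite m2 => /orP[->//|/en2[a [b [Gg aC bC]]]] _.
    by exists a, b; split => // h; apply: both.
  have sub1 z : z \in unzip1 C1 -> z \in unzip1 (C1 ++ C2) by rewrite m1 => ->.
  have sub2 z : z \in unzip2 C1 -> z \in unzip2 (C1 ++ C2) by rewrite m2 => ->.
  move=> f; rewrite m2 => /orP[fC1|fC2]; last first.
    apply: (@local_lift v v C2 _ f) (IHT _ _ p2 w2 _ fC2) => //.
    + by move=> z zC; rewrite m1 zC orbT.
    + by move=> g gC; rewrite m2 gC orbT.
    + move=> g; rewrite m2 => /orP[/en1[a [b [Gg aC bC]]]|->//] _.
      by exists a, b; split => // h; apply: both'.
    + have fC1 : f \notin unzip2 C1 by apply/negP => /(disjP _ _ dE); rewrite fC2.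
      by rewrite cnt (count_disj fC1).
  have c1 : count_mem f (unzip2 (C1 ++ C2)) = count_mem f (unzip2 C1).
    by rewrite cnt (count_disj (disjP _ _ dE _ fC1)) addn0.
  case: (locZ _ fC1) => [fZ|]; last exact: local_lift.
  right; split; first by rewrite c1 cZ.
  exists Z; split => // [|g /s2Z/sub2//|g h gZ hZ].
    case: (Z) fZ wZ u1Z u2Z => // r Z' _ wZ u1Z u2Z.
    rewrite simple_cycle_walk u1Z u2Z !andbT.
    by have /and3P[/eqP rv _ _] := wZ; rewrite rv.
  apply: cut_lift (cutZ _ _ gZ hZ) => // k.
  by case: eqP => [-> _|_]; [apply: s2Z|move=> /= /eqP ->; apply: s2Z].
- move=> p C q [e ->] w _; exists [:: (p, e)]; split; [exact: w|by split|by split| |].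
  + by split => // f; rewrite /= inE => /eqP ->; rewrite eqxx.
  + split => [f g|f fe]; last by left.
    rewrite !inE => /eqP -> /eqP ->; exists set0; split => [|z|h]; rewrite ?inE // => _.
    by rewrite /crosses setI0 eqxx addbb.
- move=> T IHT Y IHY p C q [e [u [C1 [C2 [-> [p1 p2] [eN dE] pN dV]]]]] /=.
  have [e2 [C2' [C2E e2N uN]]] := parsec_head p2.
  have nC2 : nextv C2 q = u by rewrite C2E.
  rewrite eqxx nextv_cat nC2 (parse_nextv p1) walk_cat nC2 /= => /and3P[s w1 w2] qN.
  move: qN; rewrite unzip1_cat mem_cat negb_or => /andP[qC1 qC2].
  have qC2b : q \notin behead (unzip1 C2) by apply: contra qC2; apply: mem_behead.
  have [Z [wZ [u1Z u2Z] [s1Z s2Z] [hZ cZ] [cutZ locZ]]] := IHY _ _ q p2 w2 qC2b.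
  move: eN; rewrite mem_cat negb_or => /andP[eC1 eC2].
  move: (pN); rewrite inE mem_cat !negb_or => /and3P[pu pC1 pC2].
  have Ge : G e = [set p; u] by apply/eqP.
  have uC2 : u \in unzip1 C2 by rewrite C2E mem_head.
  have qu : q != u by apply: contraNneq qC2 => ->.
  have en1 f : f \in unzip2 C1 -> _ := gwalk_ends w1 (f := f).
  have en2 f : f \in unzip2 C2 -> exists a b, [/\ G f = [set a; b], a \in unzip1 C2 & b \in q :: behead (unzip1 C2)].
    by move=> /(walk_mem w2)[a [b [aC bC /eqP Gf]]]; exists a, b.
  set C0 := (p, e) :: _.
  have m2 f : (f \in unzip2 C0) = [|| f == e, f \in unzip2 C1 | f \in unzip2 C2].
    by rewrite /C0 /= unzip2_cat !inE mem_cat.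
  have m1 z : (z \in unzip1 C0) = [|| z == p, z \in unzip1 C1 | z \in unzip1 C2].
    by rewrite /C0 /= unzip1_cat !inE mem_cat.
  have cnt f : count_mem f (unzip2 C0) = ((f == e) + count_mem f (unzip2 C1) + count_mem f (unzip2 C2))%N.
    by rewrite /C0 /= unzip2_cat count_cat /= [e == f]eq_sym addnA.
  have both z : z \in u :: unzip1 C1 -> z \in q :: unzip1 C2 -> z = u.
    move=> zC; rewrite inE => /orP[/eqP zq|zC2].
      by move: zC; rewrite zq inE (negbTE qu) (negbTE qC1).
    have zb : z \notin behead (unzip1 C2) := disjP _ _ dV _ zC.
    by move: zC2 zb; rewrite C2E /= inE => /orP[/eqP //|->].
  have tail z : z \in q :: unzip1 C2' -> (z \in u :: unzip1 C1) = false.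
    move=> zC; apply/negP => zC1.
    have zu : z = u.
      by apply: both => //; move: zC; rewrite C2E /= !inE => /orP[->|->]; rewrite ?orbT.
    by move: zC; rewrite zu inE eq_sym (negbTE qu) (negbTE uN).
  have rest2 g : g \in unzip2 C0 -> g \notin unzip2 C2 -> exists a b, [/\ G g = [set a; b],
     (a \in unzip1 C2 -> a = u) & (b \in unzip1 C2 -> b = u)].
    rewrite m2 => /or3P[/eqP ->|/en1[a [b [Gg aC bC]]]|->//] _.
      by exists p, u; split => // h; rewrite h in pC2.
    by exists a, b; split => // h; apply: both => //; rewrite inE h orbT.
  have sub12 z : z \in unzip1 C2 -> z \in unzip1 C0 by rewrite m1 => ->; rewrite !orbT.
  have sub22 z : z \in unzip2 C2 -> z \in unzip2 C0 by rewrite m2 => ->; rewrite !orbT.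
  have pC2' : p \in unzip1 C2 -> p = u by move=> h; rewrite h in pC2.
  have e2Z : e2 \in unzip2 Z.
    by move: hZ; rewrite C2E /=; case: (unzip2 Z) => //= x l [->]; rewrite mem_head.
  have cutE : cut p C0 (fun h => (h == e2) (+) (h == e)).
    exists [set z in u :: unzip1 C1]; split => [|z|g].
    - by rewrite !inE negb_or pu pC1.
    - by rewrite inE m1 inE => /orP[/eqP ->|->]; rewrite ?uC2 !orbT.
    rewrite m2 => /or3P[/eqP ->|gC1|gC2].
    - rewrite (crossesE _ Ge) !inE eqxx (negbTE pu) (negbTE pC1) /= eqxx addbT.
      by apply/esym; apply: contraNneq eC2 => ->; apply: s2Z.
    - have [a [b [Gg aC bC]]] := en1 _ gC1; rewrite (crossesE _ Gg) !inE -!in_cons aC bC /=.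
      have -> : (g == e) = false by apply: contraNF eC1 => /eqP <-.
      rewrite addbF; apply/esym/negbTE; apply/eqP => ge.
      by have := disjP _ _ dE _ gC1; rewrite ge s2Z.
    have -> : (g == e) = false by apply: contraNF eC2 => /eqP <-.
    rewrite addbF; move: gC2 w2; rewrite C2E /= inE => /orP[/eqP ->|gC2'] /and3P[_ /eqP Gg w2'].
      rewrite (crossesE _ Gg) !inE !eqxx -in_cons tail //.
      by case: (C2') => [|t l] /=; rewrite !inE eqxx ?orbT.
    have [a [b [aC bC /eqP Gg']]] := walk_mem w2' gC2'.
    rewrite (crossesE _ Gg') !inE -!in_cons !tail.
    - by apply/esym/negbTE; apply: contraNneq e2N => <-.
    - by move: bC; rewrite !inE => /orP[->|/mem_behead ->]; rewrite ?orbT.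
    - by rewrite inE aC orbT.
  have w0 : walk (gstep G) p C0 q.
    by rewrite /C0 /= eqxx nextv_cat nC2 (parse_nextv p1) s walk_cat nC2 w1 w2.
  have cutE2 h : h \in e :: unzip2 Z -> cut p C0 (fun g => (g == e2) (+) (g == h)).
    rewrite inE => /orP[/eqP ->//|hZ'].
    apply: cut_lift (cutZ _ _ e2Z hZ') => // g.
    by case: eqP => [-> _|_]; [apply: s2Z|move=> /= /eqP ->; apply: s2Z].
  exists ((p, e) :: Z); split.
  + by rewrite /= eqxx (walk_nextv wZ) s wZ.
  + rewrite /= u1Z u2Z !andbT; split; first by apply: contra pC2; apply: s1Z.
    by apply: contra eC2; apply: s2Z.
  + split=> z; rewrite /= inE => /orP[/eqP ->|].
    * by rewrite m1 eqxx.
    * by move=> /s1Z/sub12.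
    * by rewrite m2 eqxx.
    * by move=> /s2Z/sub22.
  + split => // f; rewrite inE => /orP[/eqP ->|fZ].
      by rewrite cnt eqxx !count_disj.
    have fC2 := s2Z _ fZ.
    have fC1 : f \notin unzip2 C1 by apply/negP => /(disjP _ _ dE); rewrite fC2.
    rewrite cnt (count_disj fC1) cZ // (_ : f == e = false) //.
    by apply: contraNF eC2 => /eqP <-.
  split => [f g fZ gZ|f].
    (* The pair f, g is the sum modulo 2 of the pairs e2, f and e2, g. *)
    apply: eq_cut (cut_addb w0 (cutE2 _ fZ) (cutE2 _ gZ)) => h _ /=.
    by rewrite addbACA addbb.
  rewrite m2 => /or3P[/eqP ->|fC1|fC2]; first by left; rewrite mem_head.
    right; apply: (@local_lift u p C1 C0 f) (IHT _ _ p1 w1 _ fC1) => //.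
    + by move=> z zC; rewrite m1 zC !orbT.
    + by move=> g gC; rewrite m2 gC orbT.
    + by move=> h; rewrite h in pC1.
    + move=> g; rewrite m2 => /or3P[/eqP ->|->//|/en2[a [b [Gg aC bC]]]] _.
        by exists p, u; split => // h; rewrite h in pC1.
      exists a, b; split => // h; apply: both; rewrite ?[_ \in u :: _]inE ?h ?orbT //.
        by rewrite inE aC orbT.
      by move: bC; rewrite !inE => /orP[->|/mem_behead ->]; rewrite ?orbT.
    + rewrite cnt (count_disj (disjP _ _ dE _ fC1)) (_ : f == e = false) ?addn0 //.
      by apply: contraNF eC1 => /eqP <-.
  case: (locZ _ fC2) => [fZ|lf]; first by left; rewrite inE fZ orbT.
  right; apply: (@local_lift u p C2 C0 f) lf => //.
  have fC1 : f \notin unzip2 C1 by apply/negP => /(disjP _ _ dE); rewrite fC2.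
  rewrite cnt (count_disj fC1) (_ : f == e = false) //.
  by apply: contraNF eC2 => /eqP <-.
Qed.

Lemma odd_count_addb (X : eqType) (P Q : pred X) (s : seq X) :
  odd (count (fun x => P x (+) Q x) s) = odd (count P s) (+) odd (count Q s).
Proof. by elim: s => //= x s IH; rewrite !oddD IH !oddb addbACA. Qed.

Lemma walk_connect x C y : walk (gstep G) x C y -> forall z, z \in y :: unzip1 C ->
  connect [rel x y | [exists e, G e == [set x; y]]] x z.
Proof.
elim: C x => [|p C IH] x /=; first by move=> /eqP -> z; rewrite inE => /eqP ->.
move=> /and3P[/eqP px s /IH h] z; rewrite !in_cons orbCA -in_cons => /orP[/eqP ->|zC].
  by rewrite px.
by apply: connect_trans (h z zC); apply/connect1/existsP; exists p.2.
Qed.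

(** A simple cycle uses each edge at most once and crosses each cut evenly. So it avoids an edge
    that is a cut by itself, and if it contains one edge of Z it contains all of Z, hence is Z by
    [sub_simple_cycle]. *)
Lemma parse_cactus T v C : parse T v C -> walk (gstep G) v C v ->
  (forall w, w \in v :: unzip1 C) -> (forall e, e \in unzip2 C) ->
  [/\ cactus G, outercycle G C & forall e, flexible G e <-> count_mem e (unzip2 C) = 2].
Proof.
move=> pC w allv alle; have loc e := parse_local.1 _ _ _ pC w e (alle e).
have flexN e D : flex_in v C e -> simple_cycle G D -> e \notin unzip2 D.
  move=> [_ [U [_ _ hU]]] /and3P[cD _ uD]; apply/negP => eD.
  have := cycle_parity U cD; rewrite (eq_count (hU^~ (alle _) : crosses U =1 _)).
  by rewrite count_uniq_mem // eD.
have rigidE e : rigid_in v C e -> exists Z, [/\ Z != [::], simple_cycle G Z, e \in unzip2 Z &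
    forall D, simple_cycle G D -> e \in unzip2 D -> {subset unzip2 Z <= unzip2 D}].
  move=> [_ [Z [sZ eZ _ cutZ]]]; exists Z; split => // [|D /and3P[cD _ uD] eD f fZ].
    by case: (Z) eZ.
  have [U [_ _ hU]] := cutZ _ _ eZ fZ.
  have := cycle_parity U cD; rewrite (eq_count (hU^~ (alle _) : crosses U =1 _)).
  by rewrite (odd_count_addb (pred1 e) (pred1 f)) !count_uniq_mem // eD /=; case: (f \in _).
have rigidN e : rigid_in v C e -> rigid G e.
  by move=> /rigidE[Z [_ sZ eZ _]]; exists Z.
have flexE e : flexible G e <-> flex_in v C e.
  split; first by case: (loc e) => // /rigidN r /(_ r).
  by move=> fe [D [sD eD]]; have := flexN _ _ fe sD; rewrite eD.
have flex2 e : flexible G e <-> count_mem e (unzip2 C) = 2.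
  split; first by move=> /flexE[].
  by case: (loc e) => [fe _|[-> //]]; apply/flexE.
split => //.
- split.
  + move=> e; have [a [b [_ _ /eqP Ge]]] := walk_mem w (alle e); by exists a, b.
  + split; first by apply/card_gt0P; exists v.
    have sym : connect_sym [rel x y | [exists e, G e == [set x; y]]].
      apply: sym_connect_sym => x y /=; apply: eq_existsb => e; by rewrite setUC.
    move=> x y; apply: (@connect_trans _ _ v); last exact: walk_connect w _ (allv y).
    by rewrite sym; apply: walk_connect w _ (allv x).
  + move=> e D D' sD sD' eD eD'.
    case: (loc e) => [fe|/rigidE[Z [Z0 sZ eZ hZ]]]; first by have := flexN _ _ fe sD; rewrite eD.
    have ZD := sub_simple_cycle Z0 sZ sD (hZ _ sD eD).
    apply: (@sub_simple_cycle _ _ G) => //; first by case: (D) eD.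
    by move=> f; rewrite (mem_same_cycle f ZD); apply: hZ.
- split.
  + case: C {pC allv alle loc flexN rigidE rigidN flexE flex2} w => // p C w.
    by rewrite gcycle_walk; have /and3P[/eqP pv _ _] := w; rewrite pv.
  + move=> e [D [sD eD]]; case: (loc e) => [fe|[-> //]].
    by have := flexN _ _ fe sD; rewrite eD.
  + by move=> e /flexE[].
Qed.

End ParseCactus.

(** * Outercycles of cacti have an excursion tree *)

Section CactusParse.
Variables (V E : finType) (G : {ffun E -> {set V}}).
Implicit Types (C D Z : seq (V * E)) (U : {set V}).

Definition adj_off (X : {pred E}) : rel V :=
  [rel x y | [exists e, (e \notin X) && (G e == [set x; y])]].

Lemma adj_off_sym X : connect_sym (adj_off X).
Proof. by apply: sym_connect_sym => x y /=; apply: eq_existsb => e; rewrite setUC. Qed.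

Lemma walk_off X x C y : walk (gstep G) x C y -> {in unzip2 C, forall f, f \notin X} ->
  forall z, z \in y :: unzip1 C -> connect (adj_off X) x z.
Proof.
elim: C x => [|p C IH] x /=; first by move=> /eqP -> _ z; rewrite inE => /eqP ->.
move=> /and3P[/eqP px s w] nX z; rewrite !in_cons orbCA -in_cons => /orP[/eqP ->|zC].
  by rewrite px.
apply: connect_trans (IH _ w _ z zC); last by move=> f fC; apply: nX; rewrite inE fC orbT.
by apply/connect1/existsP; exists p.2; rewrite nX ?mem_head.
Qed.

Lemma path_walk X x p : path (adj_off X) x p -> uniq (x :: p) ->
  exists C, [/\ walk (gstep G) x C (last x p), unzip1 C = belast x p,
    {in unzip2 C, forall f, f \notin X} & uniq (unzip2 C)].
Proof.
elim: p x => [|y p IH] x /=; first by exists [::]; rewrite /= eqxx.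
move=> /andP[/existsP[e /andP[eX /eqP Ge]] yp] /andP[xN up].
have [C [w u1 nX u2]] := IH _ yp up.
exists ((x, e) :: C); split.
- by rewrite /= eqxx (walk_nextv w) /gstep Ge eqxx w.
- by rewrite /= u1.
- by move=> f; rewrite /= inE => /orP[/eqP ->|/nX].
- rewrite /= u2 andbT; apply: contra xN => eC.
  have [a [b [aC bC /eqP Ge']]] := walk_mem w eC.
  have sub z : z \in last y p :: unzip1 C -> z \in y :: p.
    by rewrite u1 inE => /orP[/eqP ->|/mem_belast//]; apply: mem_last.
  have : x \in G e by rewrite Ge set21.
  rewrite Ge' => /set2P[->|->]; apply: sub; first by rewrite inE aC orbT.
  by move: bC; rewrite !inE => /orP[->//|/mem_behead ->]; rewrite orbT.
Qed.

Lemma connect_rigid e x y : G e = [set x; y] -> connect (adj_off (pred1 e)) y x -> rigid G e.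
Proof.
move=> Ge /connectP[p0 pp xE]; subst x.
case: (shortenP pp) Ge => p pp' up _ Ge.
have [C [w u1 nX u2]] := path_walk pp' up.
exists ((last y p, e) :: C); split; last by rewrite mem_head.
rewrite simple_cycle_walk /= eqxx (walk_nextv w) /gstep Ge eqxx w u1 u2 /=.
rewrite andbT; move: up; rewrite lastI rcons_uniq => /andP[-> ->] /=.
by apply/negP => /nX; rewrite inE eqxx.
Qed.

(** U is the component of x after removing e; were y in it, a path from y to x together with e would
    be a simple cycle. *)
Lemma flexible_cut e x y : flexible G e -> G e = [set x; y] -> multigraph G ->
  exists U : {set V}, [/\ x \in U, y \notin U & forall f, crosses G U f = (f == e)].
Proof.
move=> fe Ge mG; exists [set z | connect (adj_off (pred1 e)) x z].
have yN : y \notin [set z | connect (adj_off (pred1 e)) x z].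
  rewrite inE adj_off_sym; apply/negP => h; apply: fe; exact: connect_rigid h.
rewrite inE connect0; split => // f.
have [->|fN] := eqVneq f e; first by rewrite (crossesE _ Ge) (negbTE yN) inE connect0.
have [a [b Gf]] := mG f; rewrite (crossesE _ Gf) !inE; apply/negbTE; rewrite -negb_eqb negbK.
have ab : connect (adj_off (pred1 e)) a b by apply/connect1/existsP; exists f; rewrite inE fN Gf eqxx.
apply/eqP; apply/idP/idP => h; first exact: connect_trans h ab.
by apply: connect_trans h _; rewrite adj_off_sym.
Qed.

Lemma flexible_even e v C : multigraph G -> flexible G e -> walk (gstep G) v C v ->
  ~~ odd (count_mem e (unzip2 C)).
Proof.
move=> mG fe w; have [x [y Ge]] := mG e.
have [U [_ _ hU]] := flexible_cut fe Ge mG.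
by rewrite -(eq_count (hU : crosses G U =1 _)) (walk_parity U w) addbb.
Qed.

Lemma walk_side U x C y : walk (gstep G) x C y -> {in unzip2 C, forall f, ~~ crosses G U f} ->
  forall z, z \in y :: unzip1 C -> (z \in U) = (x \in U).
Proof.
elim: C x => [|p C IH] x /=; first by move=> /eqP -> _ z; rewrite inE => /eqP ->.
move=> /and3P[/eqP px /eqP s w] nX z; rewrite !in_cons orbCA -in_cons => /orP[/eqP ->|zC].
  by rewrite px.
rewrite (IH _ w _ z zC); last by move=> f fC; apply: nX; rewrite inE fC orbT.
have := nX p.2; rewrite mem_head (crossesE _ s) => /(_ isT).
by do 2 case: (_ \in U).
Qed.

Hypothesis cG : cactus G.

Let mG : multigraph G. Proof. by case: cG. Qed.

(* Otherwise a shortest detour off [Z] and an arc of [Z] form a second simple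
   cycle through an edge of [Z]. *)
Lemma cactus_apart Z u u' : simple_cycle G Z -> u \in unzip1 Z -> u' \in unzip1 Z ->
  connect (adj_off (mem (unzip2 Z))) u u' -> u = u'.
Proof.
move=> sZ uZ u'Z /connectP[p0 pp0 u'E]; subst u'; move: u'Z.
case: (shortenP pp0) => p pp up _ u'Z {p0 pp0}.
apply/eqP; apply: contraT => unl.
have hp : has (mem (unzip1 Z)) p.
  apply/hasP; exists (last u p) => //; have := mem_last u p.
  by rewrite inE eq_sym (negbTE unl).
(* x is the first vertex of the detour that is back on Z. *)
case: (split_find hp) pp up => {unl u'Z hp} x p1 p2 xZ p1Z.
rewrite -cats1 -catA cat_path => /andP[pp1 /andP[sx _]].
rewrite -cat_cons cat_uniq => /and3P[up1 /hasPn xN _].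
have xup1 : x \notin u :: p1 by apply: xN; rewrite mem_head.
have pp : path (adj_off (mem (unzip2 Z))) u (rcons p1 x) by rewrite rcons_path pp1.
have up : uniq (u :: rcons p1 x) by rewrite -rcons_cons rcons_uniq xup1.
have [D [wD u1D nD u2D]] := path_walk pp up.
rewrite last_rcons in wD; rewrite belast_rcons in u1D.
have [q qZ qx] := mapP xZ; case: q qZ qx => x' f qZ /= qx; subst x'.
have [i Z' ZE] := rot_to qZ.
have sZ' : simple_cycle G ((x, f) :: Z') by rewrite -ZE simple_cycle_rot.
have uZ' : u \in unzip1 Z'.
  have : u \in unzip1 ((x, f) :: Z') by rewrite -ZE /unzip1 map_rot mem_rot.
  by rewrite /= inE => /orP[/eqP ux|//]; rewrite ux mem_head in xup1.
have [r rZ ru] := mapP uZ'; case: r rZ ru => u' g rZ /= ru; subst u'.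
case/splitPr: rZ ZE sZ' {uZ'} => A B ZE sZ'.
have := sZ'; rewrite simple_cycle_walk => /and3P[wZ v1 v2].
have wA : walk (gstep G) x ((x, f) :: A) u by move: wZ; rewrite -cat_cons walk_cat => /andP[].
have subZ h : h \in unzip2 ((x, f) :: A ++ (u, g) :: B) -> h \in unzip2 Z.
  by rewrite -ZE /unzip2 map_rot mem_rot.
have subZ1 z : z \in unzip1 ((x, f) :: A ++ (u, g) :: B) -> z \in unzip1 Z.
  by rewrite -ZE /unzip1 map_rot mem_rot.
pose q' := head (u, f) D; pose D' := behead D.
have DE : D = q' :: D' by rewrite /q' /D'; case: (D) u1D.
have sW : simple_cycle G (D ++ (x, f) :: A).
  have q'u : q'.1 = u by move: u1D; rewrite DE /= => -[].
  rewrite DE cat_cons simple_cycle_walk -cat_cons -DE q'u walk_cat /= -/(nextv _ _).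
  rewrite wD; apply/and3P; split; first exact: wA.
    rewrite unzip1_cat u1D cat_uniq up1 /=.
    move: v1; rewrite /= unzip1_cat cat_uniq /= mem_cat negb_or => /andP[/andP[xA _] /and3P[uA dA _]].
    rewrite xA uA !andbT negb_or; apply/andP; split; first exact: xup1.
    apply/hasPn => z zA; apply/negP; rewrite /= inE => /orP[/eqP zu|zp1].
      by move: dA; rewrite negb_or /= -zu zA.
    by move/hasPn: p1Z => /(_ z zp1); rewrite /= subZ1 //= inE unzip1_cat mem_cat zA orbT.
  rewrite unzip2_cat cat_uniq u2D; apply/and3P; split => //.
    apply/hasPn => h hA; apply/negP => /nD; rewrite /= subZ //.
    by move: hA; rewrite /= !inE unzip2_cat mem_cat => /orP[->|->]; rewrite ?orbT.
  by move: v2; rewrite /= unzip2_cat mem_cat negb_or cat_uniq => /andP[/andP[-> _] /andP[-> _]].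
have fW : f \in unzip2 (D ++ (x, f) :: A) by rewrite unzip2_cat mem_cat /= mem_head orbT.
have fZ : f \in unzip2 Z by apply: subZ; rewrite mem_head.
(* The new cycle shares f with Z, so it would have to be Z, yet it starts with an edge off Z. *)
have [_ _ /(_ f _ _ sZ sW fZ fW) ZW] := cG.
have q'W : q'.2 \in unzip2 (D ++ (x, f) :: A) by rewrite DE /= mem_head.
rewrite (mem_same_cycle q'.2 ZW) in q'W.
by have := nD q'.2; rewrite DE /= mem_head => /(_ isT); rewrite q'W.
Qed.

(* The number of times an outercycle passes through [f]. *)
Definition budget (f : E) : nat := if `[< rigid G f >] then 1 else 2.

(** Unlike being an outercycle, this bound passes to subwalks, as the induction on the length
    needs. *)
Definition thin C := forall f, (count_mem f (unzip2 C) <= budget f)%N.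

Lemma thin_catl C D : thin (C ++ D) -> thin C.
Proof. by move=> h f; apply: leq_trans (h f); rewrite unzip2_cat count_cat leq_addr. Qed.

Lemma thin_catr C D : thin (C ++ D) -> thin D.
Proof. by move=> h f; apply: leq_trans (h f); rewrite unzip2_cat count_cat leq_addl. Qed.

(** A closed walk uses a flexible edge evenly often, so it exhausts the budget of every edge it
    meets; the rest of a thin walk then avoids these edges. *)
Lemma closed_exhaust v C f : walk (gstep G) v C v -> f \in unzip2 C ->
  (budget f <= count_mem f (unzip2 C))%N.
Proof.
move=> w fC; have c0 : (0 < count_mem f (unzip2 C))%N by rewrite -has_count has_pred1.
rewrite /budget; case: asboolP => // fe.
have := flexible_even mG fe w.
by case: (count_mem _ _) c0 => [|[|n]].
Qed.

Lemma closed_disj v C D : walk (gstep G) v C v ->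
  (forall f, (count_mem f (unzip2 C) + count_mem f (unzip2 D) <= budget f)%N) ->
  disj (unzip2 C) (unzip2 D).
Proof.
move=> w h; apply/disjP => f fC; apply/negP => fD.
have := h f; rewrite leqNgt => /negP; apply.
apply: leq_ltn_trans (closed_exhaust w fC) _.
by rewrite -[X in (X < _)%N]addn0 ltn_add2l -has_count has_pred1.
Qed.

Lemma step_mem x C y e z : walk (gstep G) x ((z, e) :: C) y -> z \in G e.
Proof. by move=> /and3P[/eqP /= -> /eqP -> _]; rewrite set21. Qed.

Lemma thin_rigid x e D : thin ((x, e) :: D) -> rigid G e -> e \notin unzip2 D.
Proof.
move=> tD re; have := tD e; rewrite /budget asboolT // /= eqxx add1n ltnS.
by rewrite leqNgt -has_count has_pred1.
Qed.

Section Chain.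
Variable n : nat.
Hypothesis IHn : forall v C, (size C <= n)%N -> walk (gstep G) v C v -> thin C ->
  exists T, parse T v C.
Variables (Z : seq (V * E)) (v : V).
Hypotheses (sZ : simple_cycle G Z) (nZ : nextv Z v = v) (wZ : walk (gstep G) v Z v).

Local Notation off := (adj_off (mem (unzip2 Z))).

(** Follows Z edge by edge: Zp has been traversed, e is the current edge, Zs remains. Between two
    edges of Z the walk makes a closed excursion, since by [cactus_apart] it can rejoin Z only where
    it left. The last clause attaches every visited vertex to a vertex of Zs off Z, from which the
    disjointness in [parsec] follows. *)
Lemma chain_parse Zp Zs x e D : Z = Zp ++ (x, e) :: Zs ->
  walk (gstep G) x ((x, e) :: D) v -> (size D <= n)%N -> thin ((x, e) :: D) ->
  {in unzip2 Zp, forall f, f \notin unzip2 D} ->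
  exists Y D1 D2, [/\ (x, e) :: D = D1 ++ D2, parsec Y x D1, walk (gstep G) v D2 v,
     {in unzip2 D2, forall f, f \notin unzip2 Z}
   & {in behead (unzip1 D1), forall y, exists2 z, z \in unzip1 Zs & connect off z y}].
Proof.
have rX f : f \in unzip2 Z -> rigid G f by move=> fZ; exists Z.
elim: Zs Zp x e D => [|[u e2] Zs IH] Zp x e D ZE wD sD tD nD.
  have eX : e \in unzip2 Z by rewrite ZE unzip2_cat mem_cat /= mem_head orbT.
  have eD := thin_rigid tD (rX _ eX).
  have w' : walk (gstep G) (nextv D v) D v by case/and3P: wD.
  have nv : nextv D v = v.
    move: (wZ); rewrite ZE walk_cat => /andP[_ /and3P[_ /eqP Ge _]].
    move: (wD) => /and3P[_ /eqP Ge' _].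
    by apply: (@set2_inj _ x); rewrite -Ge -Ge'.
  rewrite nv in w'.
  exists Last, [:: (x, e)], D; split; [by []|by exists e|exact: w'| |by []].
  move=> f fD; rewrite ZE unzip2_cat mem_cat /= inE negb_or.
  apply/andP; split; first by apply/negP => /nD; rewrite fD.
  by apply: contraNneq eD => <-.
have memX f : (f \in unzip2 Z) = [|| f \in unzip2 Zp, f == e, f == e2 | f \in unzip2 Zs].
  by rewrite ZE unzip2_cat mem_cat /= !inE.
have memV z : (z \in unzip1 Z) = [|| z \in unzip1 Zp, z == x, z == u | z \in unzip1 Zs].
  by rewrite ZE unzip1_cat mem_cat /= !inE.
have eX : e \in unzip2 Z by rewrite memX eqxx orbT.
have e2X : e2 \in unzip2 Z by rewrite memX eqxx !orbT.
have eD := thin_rigid tD (rX _ eX).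
have [uZ1 uZ2] : uniq (unzip1 Z) /\ uniq (unzip2 Z) by case/and3P: sZ.
have vZ' : v \in unzip1 Zp ++ [:: x].
  by move: nZ; rewrite ZE; case: (Zp) => [|q l] /= <-; rewrite mem_head.
have vZ : v \in unzip1 Z.
  by rewrite memV; move: vZ'; rewrite mem_cat inE => /orP[->|->]; rewrite ?orbT.
have xZ : x \in unzip1 Z by rewrite memV eqxx !orbT.
have uZ : u \in unzip1 Z by rewrite memV eqxx !orbT.
have ZsZ z : z \in unzip1 Zs -> z \in unzip1 Z by rewrite memV => ->; rewrite !orbT.
have [uv xu uZs xZs] : [/\ u != v, x != u, u \notin unzip1 Zs & x \notin unzip1 Zs].
  move: uZ1; rewrite ZE unzip1_cat /= -cat_rcons cat_uniq => /and3P[_ /hasPn h /andP[uN _]].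
  split => //.
  - by apply: contraTneq vZ' => <-; rewrite cats1; apply: h; rewrite mem_head.
  - by have := h u; rewrite mem_head /= mem_rcons inE negb_or eq_sym => /(_ isT) /andP[].
  - apply/negP => xZs; have := h x; rewrite inE xZs orbT => /(_ isT).
    by rewrite /= mem_rcons mem_head.
have wZs : walk (gstep G) u ((u, e2) :: Zs) v.
  by move: (wZ); rewrite ZE walk_cat => /andP[_ /and3P[_ _]].
have wZt : walk (gstep G) (nextv Zs v) Zs v by have /and3P[_ _] := wZs.
have w' : walk (gstep G) (nextv D v) D v by case/and3P: wD.
have /and3P[_ /eqP Ge _] := wD.
have nu : nextv D v = u.
  move: (wZ); rewrite ZE walk_cat => /andP[_ /and3P[_ /eqP Ge' _]].
  by apply: (@set2_inj _ x); rewrite -Ge -Ge'.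
rewrite /= nu in Ge; rewrite nu in w'.
have hX : has (fun q : V * E => q.2 \in unzip2 Z) D.
  apply: contraT => /hasPn nX; case/eqP: uv.
  apply: (cactus_apart sZ uZ vZ).
  apply: (walk_off w'); last by rewrite mem_head.
  by move=> f /mapP[q qD ->]; apply: nX.
have [B [w [f [D' [DE fX nB]]]]] : exists B w f D',
    [/\ D = B ++ (w, f) :: D', f \in unzip2 Z & {in unzip2 B, forall f, f \notin unzip2 Z}].
  case: (split_find hX) => [[w f] B D' fX nB]; exists B, w, f, D'; split => //.
    by rewrite cat_rcons.
  by move=> g /mapP[q qB ->]; move/hasPn: nB; apply.
have fD : f \in unzip2 D by rewrite DE unzip2_cat mem_cat /= mem_head orbT.
have /andP[wB wD'] : walk (gstep G) u B w && walk (gstep G) w ((w, f) :: D') v.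
  by move: w'; rewrite DE walk_cat.
have cu z : z \in w :: unzip1 B -> connect off u z by apply: (walk_off wB nB).
have wGf := step_mem wD'.
have wE : w = u.
  have [a [b [aZ bZ /eqP Gf]]] := walk_mem wZ fX.
  have wZ' : w \in unzip1 Z.
    move: wGf; rewrite Gf => /set2P[->//|->].
    by move: bZ; rewrite inE => /orP[/eqP ->//|/mem_behead].
  by apply/esym/(cactus_apart sZ uZ wZ'); apply: cu; rewrite mem_head.
subst w.
(* The edges of Zp and e do not occur in D, and the edges of Zs do not meet u. *)
have fe2 : f = e2.
  apply/eqP; move: fX; rewrite memX => /or4P[/nD|/eqP fe|//|fZs].
  - by rewrite fD.
  - by rewrite -fe fD in eD.
  have [a [b [aZ bZ /eqP Gf]]] := walk_mem wZt fZs.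
  move: wGf; rewrite Gf => /set2P[E'|E']; first by rewrite E' aZ in uZs.
  move: bZ; rewrite -E' inE => /orP[|/mem_behead]; first by rewrite (negbTE uv).
  by rewrite (negbTE uZs).
subst f.
have tB : thin B by move: tD; rewrite DE -cat_cons => /thin_catl /(@thin_catr [:: _]).
have tD' : thin ((u, e2) :: D') by move: tD; rewrite DE -cat_cons => /thin_catr.
have sB : (size B <= n)%N by apply: leq_trans sD; rewrite DE size_cat leq_addr.
have sD' : (size D' <= n)%N.
  by apply: leq_trans sD; rewrite DE size_cat /= addnS; apply/ltnW; rewrite ltnS leq_addl.
have [T pT] := IHn sB wB tB.
have [||Y [D1 [D2 [DE' pY wD2 nD2 loc]]]] := IH (rcons Zp (x, e)) u e2 D' _ wD' sD' tD'.
- by rewrite cat_rcons.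
- move=> g; rewrite -cats1 unzip2_cat mem_cat /= inE => /orP[/nD|/eqP ->].
    by rewrite DE unzip2_cat mem_cat /= inE !negb_or => /and3P[].
  by move: eD; rewrite DE unzip2_cat mem_cat /= inE !negb_or => /and3P[].
have DE2 : D = B ++ D1 ++ D2 by rewrite DE DE'.
have [g [D1' [D1E _ _]]] := parsec_head pY.
have locZ z y : z \in unzip1 Z -> connect off z y -> forall z', z' \in unzip1 Z -> connect off z' y -> z = z'.
  move=> zZ zy z' z'Z z'y; apply: (cactus_apart sZ zZ z'Z).
  by apply: connect_trans zy _; rewrite adj_off_sym.
have cu' z : z \in u :: unzip1 B -> connect off u z.
  by move=> zB; apply: cu.
exists (Link T Y), ((x, e) :: B ++ D1), D2; split => //.
- by rewrite DE2 /= catA.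
- exists e, u, B, D1; split => //.
  + split; first by move: eD; rewrite DE2 !unzip2_cat !mem_cat !negb_or => /and3P[-> ->].
    apply: closed_disj wB _ => h; have := tD h; rewrite DE2; apply: leq_trans.
    rewrite /= !unzip2_cat !count_cat.
    by apply: leq_trans (leq_addl _ _); rewrite leq_add2l leq_addr.
  + rewrite inE negb_or xu mem_cat negb_or /=; apply/andP; split.
      apply/negP => xB; case/eqP: xu.
      by apply: (locZ x x xZ (connect0 _ _) u uZ (cu' x _)); rewrite inE xB orbT.
    rewrite D1E /= inE negb_or xu /=; apply/negP => xD.
    have [|z zZs zx] := loc x; first by rewrite D1E.
    have xz : x = z by exact: (locZ x x xZ (connect0 _ _) z (ZsZ z zZs) zx).
    by rewrite xz zZs in xZs.
  + apply/disjP => z zB; apply/negP => /loc[z' z'Z z'z].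
    have uz' : u = z' by exact: (locZ u z uZ (cu' z zB) z' (ZsZ z' z'Z) z'z).
    by rewrite uz' z'Z in uZs.
- move=> y; rewrite /= unzip1_cat mem_cat => /orP[yB|].
    by exists u; [rewrite mem_head|apply: cu'; rewrite inE yB orbT].
  rewrite D1E /= inE => /orP[/eqP ->|yD]; first by exists u; rewrite ?mem_head.
  have [|z zZs zy] := loc y; first by rewrite D1E.
  by exists z; rewrite // inE zZs orbT.
Qed.

End Chain.

(** A rigid first edge starts a simple cycle, handled by [chain_parse]. A flexible one is a bridge,
    used exactly once more by parity and thinness, in the opposite direction; its two sides share no
    vertex. *)
Lemma thin_parse n v C : (size C <= n)%N -> walk (gstep G) v C v -> thin C ->
  exists T, parse T v C.
Proof.
elim: n v C => [|n IHn] v [|[v' e] C] //; try by exists Leaf.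
rewrite /= ltnS => sC /and3P[/eqP /= -> s w] tC {v'}.
have mem_sub D D' f : count_mem f (unzip2 (D ++ D')) = (count_mem f (unzip2 D) + count_mem f (unzip2 D'))%N.
  by rewrite unzip2_cat count_cat.
set u := nextv C v in s w.
have Ge : G e = [set v; u] by apply/eqP.
have wC : walk (gstep G) v ((v, e) :: C) v by rewrite /= eqxx s w.
case: (pselect (rigid G e)) => [[Z0 [sZ0 eZ0]]|fe].
  have [Z1 sZ1 vZ1] : exists2 Z1, simple_cycle G Z1 & (v, e) \in Z1.
    have [[x e'] xZ /= E'] := mapP eZ0; subst e'.
    have [p [C0 Z0E]] : exists p C0, Z0 = p :: C0 by case: (Z0) xZ => // p C0 _; exists p, C0.
    subst Z0; have := sZ0; rewrite simple_cycle_walk => /and3P[w0 _ _].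
    have := walk_step_mem w0 xZ; rewrite Ge => /set2P[xv|xu]; first by exists (p :: C0); rewrite // -xv.
    exists (Defs.rev_cycle (p :: C0)); first exact: simple_cycle_rev.
    by rewrite rev_cycleE; apply: (rev_walk_step w0 xZ); rewrite xu setUC.
  have [k Zs ZE] := rot_to vZ1.
  have sZ : simple_cycle G ((v, e) :: Zs) by rewrite -ZE simple_cycle_rot.
  have wZ : walk (gstep G) v ((v, e) :: Zs) v by have := sZ; rewrite simple_cycle_walk => /and3P[].
  have [|Y [D1 [D2 [CE pY wD2 nD2 loc]]]] :=
    chain_parse IHn sZ (erefl v) wZ (Zp := [::]) erefl wC sC tC; first by [].
  have [g [D1' [D1E _ _]]] := parsec_head pY.
  have sD2 : (size D2 <= n)%N.
    by apply: leq_trans sC; move: (congr1 size CE); rewrite D1E /= size_cat => -[->]; rewrite leq_addl.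
  have [|T pT] := IHn v D2 sD2 wD2; first by move: tC; rewrite CE => /thin_catr.
  exists (Rigid Y T), D1, D2; split => //.
    rewrite disjC; apply: closed_disj wD2 _ => f.
    by have := tC f; rewrite CE mem_sub addnC.
  apply/disjP => y /loc[z zZs zy]; apply/negP => yD.
  have vy : connect (adj_off (mem (unzip2 ((v, e) :: Zs)))) v y := walk_off wD2 nD2 yD.
  have zv : z = v.
    apply: (cactus_apart sZ); rewrite ?mem_head //; first by rewrite /= inE zZs orbT.
    by apply: connect_trans zy _; rewrite adj_off_sym.
  by have := sZ; rewrite simple_cycle_walk /= => /and3P[_ /andP[+ _] _]; rewrite -zv zZs.
have eC : e \in unzip2 C.
  have := flexible_even mG fe wC; rewrite /= eqxx add1n /= negbK => o.
  by rewrite -has_pred1 has_count; case: (count _ _) o.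
have [[u' e'] qC /= qe] := mapP eC; subst e'.
case/splitPr: qC @u w wC s sC tC Ge eC => C1 C2 u w wC s sC tC Ge _.
have [eC1 eC2] : e \notin unzip2 C1 /\ e \notin unzip2 C2.
  have := tC e; rewrite /budget asboolF // /= eqxx mem_sub /= eqxx.
  move=> h; have : (count_mem e (unzip2 C1) + count_mem e (unzip2 C2) <= 0)%N.
    move: h; move: (count_mem e (unzip2 C1)) (count_mem e (unzip2 C2)); clear=> i j.
    by rewrite add1n addnS ltnS ltnS.
  rewrite leqn0 addn_eq0 => /andP[/eqP c1 /eqP c2].
  by split; rewrite -has_pred1 has_count ?c1 ?c2.
have [U [vU uU hU]] := flexible_cut fe Ge mG.
have /andP[w1 w2'] : walk (gstep G) u C1 u' && walk (gstep G) u' ((u', e) :: C2) v.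
  by move: w; rewrite walk_cat.
have nX (D : seq (V * E)) : e \notin unzip2 D -> {in unzip2 D, forall f, ~~ crosses G U f}.
  by move=> eD f fD; rewrite hU; apply: contraNneq eD => <-.
have side1 := walk_side w1 (nX _ eC1).
have u'u : u' = u.
  have := step_mem w2'; rewrite Ge => /set2P[u'v|//].
  by have := side1 u'; rewrite mem_head u'v vU (negbTE uU) => /(_ isT).
have w2 : walk (gstep G) v C2 v.
  have /and3P[_ /eqP Ge' w2] := w2'.
  suff E' : nextv C2 v = v by rewrite E' in w2.
  by apply: (@set2_inj _ u); rewrite [RHS]setUC -Ge -[in LHS]u'u Ge'.
rewrite u'u in w1 side1 *.
have side2 := walk_side w2 (nX _ eC2).
have tC' : thin (C1 ++ (u', e) :: C2) by move: tC => /(@thin_catr [:: _]).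
have [||T1 p1] := IHn u C1 _ w1 _.
- by apply: leq_trans sC; rewrite size_cat leq_addr.
- exact: thin_catl tC'.
have [||T2 p2] := IHn v C2 _ w2 _.
- by apply: leq_trans sC; rewrite size_cat /= addnS ltnW // ltnS leq_addl.
- by move: tC' => /thin_catr /(@thin_catr [:: _]).
exists (Flex T1 T2), e, u, C1, C2; split => //.
- by rewrite mem_cat negb_or eC1.
- apply: closed_disj w1 _ => f; have := tC' f; apply: leq_trans.
  by rewrite mem_sub leq_add2l leq_addl.
- apply/disjP => z /side1 zU; apply/negP => /side2; by rewrite zU vU (negbTE uU).
Qed.

End CactusParse.

(** * Weights *)

Section ParseWeight.
Variables (V E : finType) (G : {ffun E -> {set V}}) (col : V -> bool).
Variables (K : comNzRingType) (kap : bool -> nat -> K).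
Implicit Types (l : seq E) (C : seq (V * E)).

(** Restricting to the edges of l makes degrees add up over branches. A loop counts once, but
    bipartite graphs have none. *)
Definition deg_in l (w : V) : nat := #|[set e in l | w \in G e]|.

Definition ntwice l : nat := #|[set e | count_mem e l == 2]|.

Lemma eq_deg_in l l' w : l =i l' -> deg_in l w = deg_in l' w.
Proof. by move=> ll; apply: eq_card => e; rewrite !inE ll. Qed.

Lemma deg_in_cat l l' w : disj l l' -> deg_in (l ++ l') w = (deg_in l w + deg_in l' w)%N.
Proof.
move=> d; rewrite /deg_in -[RHS]cardUI [X in (_ + X)%N](_ : _ = 0%N) ?addn0.
  by apply: eq_card => e; rewrite !inE mem_cat andb_orl.
apply: eq_card0 => e; rewrite !inE; apply/negP => /andP[/andP[el _] /andP[el' _]].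
by have := disjP _ _ d _ el; rewrite el'.
Qed.

Lemma deg_in1 e w : deg_in [:: e] w = (w \in G e).
Proof.
rewrite /deg_in; case wG: (w \in G e).
  by rewrite (eq_card (B := pred1 e)) ?card1 // => f; rewrite !inE; case: eqP => // ->.
by apply: eq_card0 => f; rewrite !inE; case: eqP => // ->.
Qed.

Lemma deg_in_cons e l w : e \notin l -> deg_in (e :: l) w = ((w \in G e) + deg_in l w)%N.
Proof. by move=> el; rewrite -cat1s deg_in_cat ?deg_in1 // disj1s. Qed.

Lemma deg_in0 x C y w : walk (gstep G) x C y -> w \notin y :: unzip1 C -> deg_in (unzip2 C) w = 0%N.
Proof.
move=> wC wN; apply: eq_card0 => e; rewrite !inE; apply/negP => /andP[eC].
have [a [b [-> aC bC]]] := gwalk_ends wC eC.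
by move=> /set2P[E'|E']; case/negP: wN; rewrite E'.
Qed.

Lemma ntwice_cat l l' : disj l l' -> ntwice (l ++ l') = (ntwice l + ntwice l')%N.
Proof.
move=> d; rewrite /ntwice -[RHS]cardUI [X in (_ + X)%N](_ : _ = 0%N) ?addn0.
  apply: eq_card => e; rewrite !inE count_cat.
  case: (boolP (e \in l)) => el; last by rewrite (count_disj el).
  by rewrite (count_disj (disjP _ _ d _ el)) addn0 orbF.
apply: eq_card0 => e; rewrite !inE; apply/negP => /andP[c c'].
have el : e \in l by rewrite -has_pred1 has_count (eqP c).
by move: c'; rewrite (count_disj (disjP _ _ d _ el)).
Qed.

Lemma ntwice1 e l : e \notin l -> ntwice (e :: l) = ntwice l.
Proof.
move=> el; apply: eq_card => f; rewrite !inE /=.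
by have [<-|] := eqVneq e f; rewrite ?(count_disj el).
Qed.

Lemma ntwice2 e l l' : e \notin l ++ l' -> ntwice (e :: l ++ e :: l') = (ntwice (l ++ l')).+1.
Proof.
move=> el; rewrite -add1n -(cards1 e) /ntwice -cardsUI [X in (_ + X)%N](_ : _ = 0%N) ?addn0.
  apply: eq_card => f; rewrite !inE /= !count_cat /= eq_sym.
  have [->|_] := eqVneq f e; last by [].
  have := count_disj el; rewrite count_cat => /eqP.
  by rewrite addn_eq0 => /andP[/eqP -> /eqP ->].
apply/eqP; rewrite cards_eq0; apply/eqP/setP => f; rewrite !inE.
by apply/negP => /andP[/eqP ->]; rewrite (count_disj el).
Qed.

Lemma cwalk_walk x C y : walk (cstep G col) x C y -> walk (gstep G) x C y.
Proof. by apply: eq_walk => a e b _ _ _ /andP[]. Qed.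

Let prodw C v := \prod_(w in V | (w \in unzip1 C) && (w != v)) kap (col w) (deg_in (unzip2 C) w).

(** Degrees at a shared vertex add up over the branches, and every other vertex lies in one branch
    only, so the product over vertices factors. A chain has one edge at each end, two if the ends
    coincide: hence [(p == q).+1]. *)
Lemma parse_weight :
  (forall T v C, parse T v C -> walk (cstep G col) v C v ->
     deg_in (unzip2 C) v = tdeg T /\
     2%:R ^+ ntwice (unzip2 C) * prodw C v = weight kap (col v) T) /\
  (forall Y p C q, parsec Y p C -> walk (cstep G col) p C q -> q \notin behead (unzip1 C) ->
     [/\ deg_in (unzip2 C) p = (p == q).+1, deg_in (unzip2 C) q = (p == q).+1 &
     2%:R ^+ ntwice (unzip2 C) * prodw C p = weightc kap (col p) (col p != col q) Y]).
Proof.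
apply: tree_chain_ind => /=.
- move=> v C -> _; rewrite /prodw big_pred0 // mulr1 /deg_in /ntwice !eq_card0 // => e; by rewrite !inE.
- move=> T1 IH1 T2 IH2 v C [e [u [C1 [C2 [-> [p1 p2] eN dE dV]]]]] /=.
  rewrite eqxx nextv_cat (parse_nextv p1) walk_cat /= (parse_nextv p2) !eqxx /=.
  move=> /and4P[/andP[/eqP Ge cvu] w1 _ w2].
  have [d1 e1] := IH1 _ _ p1 w1; have [d2 e2] := IH2 _ _ p2 w2.
  have vu : v \notin u :: unzip1 C1 by apply/negP => /(disjP _ _ dV); rewrite mem_head.
  have uv : u \notin v :: unzip1 C2 by apply: (disjP _ _ dV); rewrite mem_head.
  have dC w : deg_in (unzip2 ((v, e) :: C1 ++ (u, e) :: C2)) w =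
      ((w \in G e) + deg_in (unzip2 C1) w + deg_in (unzip2 C2) w)%N.
    rewrite -addnA -deg_in_cat // -deg_in_cons //; apply: eq_deg_in => f.
    by rewrite /= unzip2_cat !inE !mem_cat inE; do !case: (_ == _); rewrite ?orbT.
  have z1 := deg_in0 (cwalk_walk w1); have z2 := deg_in0 (cwalk_walk w2).
  have mGe w : (w \in G e) = (w == v) || (w == u) by rewrite Ge !inE.
  split; first by rewrite dC d2 (z1 _ vu) mGe eqxx.
  rewrite /= unzip2_cat ntwice2 // ntwice_cat // exprS exprD.
  have cu : col u = ~~ col v by case: (col v) (col u) cvu => -[].
  rewrite -cu -e1 -e2 /prodw (bigD1 u) /=; last first.
    by rewrite unzip1_cat !inE mem_cat inE eqxx !orbT /=; apply: contraNneq vu => ->; rewrite mem_head.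
  rewrite dC d1 (z2 _ uv) mGe eqxx orbT addn0 add1n.
  rewrite (bigID (mem (unzip1 C1))) /=.
  set P1 := \prod_(w | _) _; set P2 := \prod_(w | _) _.
  set Q1 := \prod_(w | _ && (w != u)) _; set Q2 := \prod_(w | _ && (w != v)) _.
  have N1 w : w \in unzip1 C1 -> w \in v :: unzip1 C2 = false.
    by move=> wC; apply/negbTE/(disjP _ _ dV); rewrite inE wC orbT.
  have N2 w : w \in unzip1 C2 -> (w \in u :: unzip1 C1) = false.
    by move=> wC; apply/negP => /(disjP _ _ dV); rewrite inE wC orbT.
  have -> : P1 = Q1.
    apply: eq_big => w.
      rewrite unzip1_cat !inE mem_cat inE; case: (boolP (w \in unzip1 C1)) => [wC|_]; last by rewrite !andbF.
      by rewrite orTb !orbT andbT /=; have := N1 _ wC; rewrite inE; case: (w == v).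
    move=> /andP[/andP[/andP[_ wv] wu] wC]; congr (kap _ _).
    by rewrite dC mGe (negbTE wv) (negbTE wu) (z2 _ (negbT (N1 _ wC))) addn0.
  have E2 w : (((w \in v :: unzip1 (C1 ++ (u, e) :: C2)) && (w != v)) && (w != u)) && (w \notin unzip1 C1)
      = (w \in unzip1 C2) && (w != v).
    rewrite unzip1_cat !inE mem_cat inE; have := N2 w; rewrite inE.
    case: (w \in unzip1 C2) => [/(_ isT)/norP[/negbTE -> /negbTE ->]|_]; first by rewrite !orbT !andbT.
    by case: (w == v) => //; case: (w == u) => //=; case: (w \in unzip1 C1).
  have -> : P2 = Q2.
    apply: eq_big => w; first exact: E2.
    rewrite E2 => /andP[wC wv]; congr (kap _ _).
    have wN := N2 _ wC; have := wN; rewrite inE => /norP[wu _].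
    by rewrite dC mGe (negbTE wv) (negbTE wu) (z1 _ (negbT wN)).
  by ring.
- move=> Y IHY T IHT v C [C1 [C2 [-> [p1 p2] dE dV]]].
  rewrite walk_cat (parse_nextv p2) => /andP[w1 w2].
  have vC1 : v \notin behead (unzip1 C1) by apply/negP => /(disjP _ _ dV); rewrite mem_head.
  have [d1 _ e1] := IHY _ _ v p1 w1 vC1; have [d2 e2] := IHT _ _ p2 w2.
  have dC w : deg_in (unzip2 (C1 ++ C2)) w = (deg_in (unzip2 C1) w + deg_in (unzip2 C2) w)%N.
    by rewrite unzip2_cat deg_in_cat.
  have z1 := deg_in0 (cwalk_walk w1); have z2 := deg_in0 (cwalk_walk w2).
  have [f [C' [C1E _ vC']]] := parsec_head p1.
  have N1 w : w \in unzip1 C1 -> w != v -> w \notin v :: unzip1 C2.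
    by rewrite C1E /= inE => /orP[->//|wC] _; apply: (disjP _ _ dV); rewrite C1E.
  have N2 w : w \in unzip1 C2 -> w != v -> w \notin v :: unzip1 C1.
    rewrite inE => wC wv; rewrite (negbTE wv) /=; apply/negP => /N1/(_ wv).
    by rewrite inE wC orbT.
  split; first by rewrite dC d1 d2 eqxx.
  rewrite unzip2_cat ntwice_cat // exprD; rewrite eqxx in e1; rewrite -e1 -e2 /prodw.
  rewrite (bigID (mem (unzip1 C1))) /=.
  set P1 := \prod_(w | _) _; set P2 := \prod_(w | _) _.
  set Q1 := \prod_(w | (w \in unzip1 C1) && _) _; set Q2 := \prod_(w | (w \in unzip1 C2) && _) _.
  have -> : P1 = Q1.
    apply: eq_big => w.
      by rewrite unzip1_cat mem_cat; case: (w \in unzip1 C1); rewrite /= ?andbT ?andbF.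
    by move=> /andP[/andP[_ wv] wC]; rewrite dC (z2 _ (N1 _ wC wv)) addn0.
  have E2 w : ((w \in unzip1 (C1 ++ C2)) && (w != v)) && (w \notin unzip1 C1) = (w \in unzip1 C2) && (w != v).
    rewrite unzip1_cat mem_cat; have := N2 w; rewrite inE.
    case: (w \in unzip1 C2) => [/(_ isT)|_]; last by case: (w \in unzip1 C1); rewrite /= ?andbF.
    by rewrite orbT; case: (w == v) => //= /(_ isT) ->.
  have -> : P2 = Q2.
    apply: eq_big => w; first exact: E2.
    by rewrite E2 => /andP[wC wv]; rewrite dC (z1 _ (N2 _ wC wv)).
  by ring.
- move=> p C q [e ->] /= /and3P[_ /andP[/eqP Ge cpq] _] _.
  have pq : (p == q) = false by apply: contraNF cpq => /eqP ->.
  rewrite !deg_in1 Ge set21 set22 pq cpq; split => //.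
  rewrite /prodw big_pred0 ?mulr1; last by move=> w; rewrite /= inE; case: eqP.
  by rewrite ntwice1 // /ntwice eq_card0 // => f; rewrite !inE.
- move=> T IHT Y IHY p C q [e [u [C1 [C2 [-> [p1 p2] [eN dE] pN dV]]]]] /=.
  have [e2 [C2' [C2E e2N uN]]] := parsec_head p2.
  have nC2 : nextv C2 q = u by rewrite C2E.
  rewrite eqxx nextv_cat nC2 (parse_nextv p1) walk_cat nC2 /= => /and3P[/andP[/eqP Ge cpu] w1 w2] qN.
  move: qN; rewrite unzip1_cat mem_cat negb_or => /andP[qC1 qC2].
  have qC2b : q \notin behead (unzip1 C2) by apply: contra qC2; apply: mem_behead.
  have [d1 e1] := IHT _ _ p1 w1; have [d2 dq e2'] := IHY _ _ q p2 w2 qC2b.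
  move: (pN); rewrite inE mem_cat !negb_or => /and3P[pu pC1 pC2].
  have uC2 : u \in unzip1 C2 by rewrite C2E mem_head.
  have qu : q != u by apply: contraNneq qC2 => ->.
  rewrite eq_sym (negbTE qu) in d2 dq.
  have dC w : deg_in (unzip2 ((p, e) :: C1 ++ C2)) w =
      ((w \in G e) + deg_in (unzip2 C1) w + deg_in (unzip2 C2) w)%N.
    by rewrite -addnA -deg_in_cat // -deg_in_cons //= unzip2_cat.
  have z1 := deg_in0 (cwalk_walk w1); have z2 := deg_in0 (cwalk_walk w2).
  have mGe w : (w \in G e) = (w == p) || (w == u) by rewrite Ge !inE.
  have N1 w : w \in unzip1 C1 -> w != u -> w \notin q :: unzip1 C2.
    move=> wC wu; rewrite C2E /= !inE (negbTE wu) /= negb_or; apply/andP; split.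
      by apply: contraNneq qC1 => <-.
    by have := disjP _ _ dV w; rewrite C2E /= inE wC orbT => /(_ isT).
  have N2 w : w \in unzip1 C2 -> w != u -> w \notin u :: unzip1 C1.
    rewrite inE => wC wu; rewrite (negbTE wu) /=; apply/negP => /N1/(_ wu).
    by rewrite inE wC orbT.
  have pC : p \notin u :: unzip1 C1 by rewrite inE negb_or pu.
  have qC : q \notin u :: unzip1 C1 by rewrite inE negb_or qu.
  split.
  + rewrite dC mGe eqxx (z1 _ pC) addn0; have [->|pq] := eqVneq p q; first by rewrite dq.
    by rewrite z2 // inE negb_or pq.
  + by rewrite dC mGe (negbTE qu) orbF (z1 _ qC) addn0 dq eq_sym addn1.
  rewrite /= unzip2_cat ntwice1 // ntwice_cat // exprD.
  have cu : col u = ~~ col p by case: (col p) (col u) cpu => -[].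
  have cuq : (col u != col q) = ~~ (col p != col q) by rewrite cu; case: (col p) (col q) => -[].
  rewrite -cuq -cu -e1 -e2' /prodw (bigD1 u) /=; last first.
    by rewrite unzip1_cat inE mem_cat uC2 !orbT eq_sym.
  rewrite dC d1 d2 mGe eqxx orbT addn1 add1n.
  rewrite (bigID (mem (unzip1 C1))) /=.
  set P1 := \prod_(w | _) _; set P2 := \prod_(w | _) _.
  set Q1 := \prod_(w | (w \in unzip1 C1) && _) _; set Q2 := \prod_(w | (w \in unzip1 C2) && _) _.
  have -> : P1 = Q1.
    apply: eq_big => w.
      rewrite unzip1_cat inE mem_cat; case: (boolP (w \in unzip1 C1)) => wC; last by rewrite !andbF.
      by rewrite orbT andbT /=; case: eqP => // wp; rewrite wp (negbTE pC1) in wC.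
    move=> /andP[/andP[/andP[_ wp] wu] wC]; congr (kap _ _).
    by rewrite dC mGe (negbTE wp) (negbTE wu) (z2 _ (N1 _ wC wu)) addn0.
  have E2 w : (((w \in p :: unzip1 (C1 ++ C2)) && (w != p)) && (w != u)) && (w \notin unzip1 C1)
      = (w \in unzip1 C2) && (w != u).
    rewrite unzip1_cat !inE mem_cat; have := N2 w; rewrite inE.
    case: (boolP (w \in unzip1 C2)) => [wC /(_ isT)|_].
      case: (eqVneq w p) => [wp|_]; first by rewrite -wp wC in pC2.
      by rewrite !orbT /=; case: (w == u) => //= /(_ isT) ->.
    by rewrite orbF; case: (w == p) => //; case: (w == u) => //=; case: (w \in unzip1 C1).
  have -> : P2 = Q2.
    apply: eq_big => w; first exact: E2.
    rewrite E2 => /andP[wC wu]; congr (kap _ _).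
    have wp : w != p by apply: contraNneq pC2 => <-.
    by rewrite dC mGe (negbTE wp) (negbTE wu) (z1 _ (N2 _ wC wu)).
  by ring.
Qed.

End ParseWeight.

Section ParseCard.
Variables (V E : finType).
Implicit Types (C : seq (V * E)).

Lemma card_cat (X : finType) (s t : seq X) : disj s t -> #|s ++ t| = (#|s| + #|t|)%N.
Proof.
move=> d; rewrite -cardUI [X in (_ + X)%N](_ : _ = 0%N) ?addn0.
  by apply: eq_card => x; rewrite !inE mem_cat.
apply: eq_card0 => x; rewrite !inE; apply/negP => /andP[xs].
by apply/negP/(disjP _ _ d).
Qed.

Lemma card_cons (X : finType) (x : X) (s : seq X) : x \notin s -> #|x :: s| = #|s|.+1.
Proof.
move=> xs; rewrite -cat1s card_cat ?disj1s // (eq_card (B := pred1 x)) ?card1 // => y.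
by rewrite !inE.
Qed.

Lemma parse_card :
  (forall T v C, parse T v C -> #|v :: unzip1 C| = (nvert T).+1 /\ #|unzip2 C| = nedge T) /\
  (forall Y p C, parsec Y p C -> #|unzip1 C| = (nvertc Y).+1 /\ #|unzip2 C| = nedgec Y).
Proof.
apply: tree_chain_ind => /=.
- by move=> v C ->; split; [rewrite card_cons // eq_card0|rewrite eq_card0].
- move=> T1 IH1 T2 IH2 v C [e [u [C1 [C2 [-> [p1 p2] eN dE dV]]]]].
  have [v1 e1] := IH1 _ _ p1; have [v2 e2] := IH2 _ _ p2; split.
    rewrite -addnS -addSn -v1 -v2 -card_cat //; apply: eq_card => x.
    by rewrite /= unzip1_cat !inE !mem_cat !inE; do !case: (_ == _); rewrite ?orbT.
  rewrite -e1 -e2 -card_cat // -(card_cons eN); apply: eq_card => x.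
  by rewrite /= unzip2_cat !inE !mem_cat !inE; do !case: (_ == _); rewrite ?orbT.
- move=> Y IHY T IHT v C [C1 [C2 [-> [p1 p2] dE dV]]].
  have [v1 e1] := IHY _ _ p1; have [v2 e2] := IHT _ _ p2; split; last first.
    by rewrite unzip2_cat card_cat // e1 e2.
  have [f [C' [C1E _ vC']]] := parsec_head p1; rewrite C1E /= in v1 dV *.
  rewrite card_cons // in v1; case: v1 => v1.
  rewrite -addnS -v1 -v2 -card_cat //; apply: eq_card => x.
  by rewrite /= unzip1_cat !inE !mem_cat !inE; do !case: (_ == _); rewrite ?orbT.
- by move=> p C [e ->]; rewrite !card_cons ?eq_card0.
- move=> T IHT Y IHY p C [e [u [C1 [C2 [-> [p1 p2] [eN dE] pN dV]]]]].
  have [v1 e1] := IHT _ _ p1; have [v2 e2] := IHY _ _ p2; split.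
    have [f [C' [C2E _ uC']]] := parsec_head p2; rewrite C2E /= in v2 dV pN *.
    rewrite card_cons // in v2; case: v2 => v2.
    rewrite unzip1_cat card_cons; last first.
      by move: pN; rewrite /= !inE !mem_cat !inE; do !case: (_ == _); rewrite ?orbT.
    congr _.+1; rewrite -addSn -v1 -v2 -card_cat //; apply: eq_card => x.
    by rewrite /= !inE !mem_cat !inE; do !case: (_ == _); rewrite ?orbT.
  by rewrite /= unzip2_cat card_cons // card_cat // e1 e2.
Qed.

Lemma parse_size :
  (forall T v C, parse T v C -> (size C <= (nedge T).*2)%N) /\
  (forall Y p C, parsec Y p C -> (size C <= (nedgec Y).*2)%N).
Proof.
apply: tree_chain_ind => /=.
- by move=> v C ->.
- move=> T1 IH1 T2 IH2 v C [e [u [C1 [C2 [-> [p1 p2] _ _ _]]]]].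
  rewrite /= size_cat /= doubleS addnS !ltnS doubleD leq_add ?(IH1 _ _ p1) ?(IH2 _ _ p2) //.
- move=> Y IHY T IHT v C [C1 [C2 [-> [p1 p2] _ _]]].
  by rewrite size_cat doubleD leq_add ?(IHY _ _ p1) ?(IHT _ _ p2).
- by move=> p C [e ->].
- move=> T IHT Y IHY p C [e [u [C1 [C2 [-> [p1 p2] _ _ _]]]]].
  by rewrite /= size_cat doubleS ltnS doubleD leqW // leq_add ?(IHT _ _ p1) ?(IHY _ _ p2).
Qed.

End ParseCard.

Lemma weight_even (K : comNzRingType) (kap : bool -> nat -> K) :
  (forall T c, ~~ even_cycles T -> weight kap c T = 0) /\
  (forall Y c b, ~~ even_cyclesc b Y -> weightc kap c b Y = 0).
Proof.
apply: tree_chain_ind => //= [T IH T' IH' c|Y IH T IH' c|c [] //|T IH Y IH' c b];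
  rewrite negb_and => /orP[/IH|/IH'] ->; ring.
Qed.

Lemma weight_root_even (K : comNzRingType) (kap : bool -> nat -> K) T c :
  ~~ even_cycles T -> weight_root kap c T = 0.
Proof.
have [wt wc] := weight_even kap; case: T => [|T T'|Y T'] //=; rewrite negb_and => /orP[] h.
- by rewrite (wt _ _ h); ring.
- by rewrite (wt _ _ h); ring.
- by rewrite (wc _ _ _ h); ring.
- by rewrite (wt _ _ h); ring.
Qed.

(** * Oriented cacti and trees *)

Section OrientedCacti.
Variables (n m : nat).
Hypothesis n_gt0 : (0 < n)%N.
Implicit Types x y : orgraph n m.

Definition parses T v x := [/\ parse T v x.2, walk (gstep x.1) v x.2 v,
  forall w, w \in v :: unzip1 x.2 & forall e, e \in unzip2 x.2].

Lemma oriented_parse x : oriented_cactus x -> exists T v, parses T v x.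
Proof.
case: x => G [C sC] [/= cG [gC rC fC]].
have alle e : e \in unzip2 C.
  rewrite -has_pred1 has_count; case: (pselect (rigid G e)) => [/rC ->//|/fC ->//].
case: C sC gC rC fC alle => [|p C] sC gC rC fC alle; first by have := alle (Ordinal n_gt0).
have w : walk (gstep G) p.1 (p :: C) p.1 by rewrite -gcycle_walk.
have tC : thin G (p :: C).
  move=> f; rewrite /budget; case: asboolP => [/rC ->//|h]; by rewrite (fC _ h).
have [T pT] := thin_parse cG (leqnn _) w tC.
exists T, p.1; split => //= z.
have [_ [_ /(_ p.1 z)/connectP conn] _] := cG; case: conn => q.
case/lastP: q => [_ -> |q z' ]; first by rewrite mem_head.
rewrite rcons_path last_rcons => /andP[_ /existsP[e /eqP Ge]] ->.
have [a [b [Ge' aC bC]]] := gwalk_ends w (alle e).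
have : z' \in G e by rewrite Ge set22.
by rewrite Ge' => /set2P[->|->].
Qed.

Lemma parses_card T v x : parses T v x -> nedge T = n /\ (nvert T).+1 = m.
Proof.
move=> [p _ allv alle]; have [h1 h2] := (parse_card _ _).1 _ _ _ p.
rewrite -h1 -h2; split; rewrite -[RHS]card_ord; apply: eq_card => z.
  by rewrite [LHS]alle.
by rewrite [LHS]allv.
Qed.

Lemma parses_uniq T T' v v' x : parses T v x -> parses T' v' x -> T = T'.
Proof.
move=> [p _ _ alle] [p' _ _ _].
have vv : v = v'.
  have := alle (Ordinal n_gt0); rewrite -(parse_nextv p) -(parse_nextv p').
  by case: (val x.2).
by subst v'; apply: parse_uniq p p'.
Qed.

Lemma parses_oriented T v x : parses T v x -> oriented_cactus x.
Proof. by move=> [p w allv alle]; have [] := parse_cactus p w allv alle. Qed.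

Lemma oc_isoP x y : oc_iso x y -> exists (s : 'S_m) (t : 'S_n),
  (forall e, y.1 (t e) = s @: x.1 e) /\ map_steps s t x.2 = y.2.
Proof.
move=> /existsP[s /existsP[t /andP[/forallP h /eqP h']]].
by exists s, t; split => // e; apply/eqP.
Qed.

Lemma parses_iso T v x y : oc_iso x y -> parses T v x -> exists v', parses T v' y.
Proof.
move=> /oc_isoP[s [t [h h']]] [p w allv alle]; exists (s v); split.
- by rewrite -h'; apply: (parse_map (@perm_inj _ s) (@perm_inj _ t)).1.
- rewrite -h'; suff step u C : walk (gstep x.1) u C v ->
    walk (gstep y.1) (s u) (map_steps s t C) (s v) by exact: step.
  elim: C u => [|q C IH] u /=; first by move=> /eqP ->.
  move=> /and3P[/eqP <- /eqP s' w']; rewrite eqxx nextv_map IH // andbT.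
  by rewrite /gstep h s' imsetU1 imset_set1 /= eqxx.
- move=> z; rewrite -h' unzip1_map_steps -map_cons -(permKV s z).
  by apply: map_f; apply: allv.
- by move=> e; rewrite -h' unzip2_map_steps -(permKV t e); apply: map_f.
Qed.

Lemma bipartite_iso x y : oc_iso x y -> bipartite x.1 -> bipartite y.1.
Proof.
move=> /oc_isoP[s [t [h _]]] /existsP[S /forallP bS]; apply/existsP; exists (s @: S).
apply/forallP => e; have /existsP[u /andP[uS /existsP[z /andP[zS /eqP Ge]]]] := bS ((t^-1)%g e).
apply/existsP; exists (s u); rewrite mem_imset ?uS /=; last exact: perm_inj.
apply/existsP; exists (s z); rewrite inE mem_imset; last exact: perm_inj.
move: zS; rewrite inE => -> /=.
by rewrite -(permKV t e) h Ge imsetU1 imset_set1.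
Qed.

Lemma OCG_oriented x : x \in OCG n m -> oriented_cactus x.
Proof.
have [_ /andP[/subsetP h _]] := andP (OCG_transversal n m).
by move=> /h; rewrite inE => /asboolP.
Qed.

Lemma OCG_exists x : oriented_cactus x -> exists2 y, y \in OCG n m & oc_iso x y.
Proof.
move=> ox; have /and3P[_ _ /forall_inP h] := OCG_transversal n m.
have xD : x \in labelled_OC n m by rewrite inE; apply/asboolP.
have := h _ (imset_f (fun x => [set y in labelled_OC n m | oc_iso x y]) xD).
move=> /cards1P[y yE]; have := set11 y; rewrite -yE !inE => /and3P[yO _ xy].
by exists y.
Qed.

Lemma OCG_uniq x y : x \in OCG n m -> y \in OCG n m -> oc_iso x y -> x = y.
Proof.
move=> xO yO xy; have /and3P[_ _ /forall_inP h] := OCG_transversal n m.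
have oD z : z \in OCG n m -> z \in labelled_OC n m.
  by move=> /OCG_oriented oz; rewrite inE; apply/asboolP.
have := h _ (imset_f (fun x => [set y in labelled_OC n m | oc_iso x y]) (oD _ xO)).
move=> /cards1P[z zE].
have xz : x \in [set z].
  by rewrite -zE inE xO inE oD //=; have [] := oc_iso_equiv x x x.
have yz : y \in [set z] by rewrite -zE inE yO inE oD.
by move: xz yz; rewrite !inE => /eqP -> /eqP ->.
Qed.

End OrientedCacti.

Lemma bipartitionC (V E : finType) (G : {ffun E -> {set V}}) S :
  bipartition G S -> bipartition G (~: S).
Proof.
move=> /forallP h; apply/forallP => e.
have /existsP[u /andP[uS /existsP[w /andP[wS /eqP Ge]]]] := h e.
apply/existsP; exists w; rewrite wS; apply/existsP; exists u.
by rewrite setCK uS Ge setUC /=.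
Qed.

Lemma bipartition_step (V E : finType) (G : {ffun E -> {set V}}) S e (x y : V) :
  bipartition G S -> G e = [set x; y] -> (x \in S) != (y \in S).
Proof.
move=> /forallP /(_ e) /existsP[u /andP[uS /existsP[w /andP[wS /eqP ->]]]] uw.
rewrite inE in wS; have wu : w != u by apply: contraNneq wS => ->.
have ux : u \in [set x; y] by rewrite -uw set21.
have wx : w \in [set x; y] by rewrite -uw set22.
case/set2P: ux wx => <-; rewrite !inE ?(negbTE wu) /= ?orbF => /eqP <-; by rewrite uS (negbTE wS).
Qed.

(** A bipartition class or its complement contains the first vertex, so [pick] succeeds and the
    default [set0] is not taken. *)
Lemma first_partP (V E : finType) (G : {ffun E -> {set V}}) p C : bipartite G ->
  bipartition G (first_part G (p :: C)) /\ p.1 \in first_part G (p :: C).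
Proof.
move=> /existsP[S bS]; rewrite /first_part; case: pickP => [T /andP[]//|/= no].
have := no S; have := no (~: S).
by rewrite bS (bipartitionC bS) inE /=; case: (p.1 \in S).
Qed.

Lemma bipartite_degree (V E : finType) (G : {ffun E -> {set V}}) l w :
  bipartite G -> (forall e, e \in l) -> degree G w = deg_in G l w.
Proof.
move=> /existsP[S bS] alle; rewrite /degree [X in (_ + X)%N](_ : _ = 0%N).
  by rewrite addn0; apply: eq_card => e; rewrite !inE alle.
apply: eq_card0 => e; rewrite inE; apply/eqP => Ge.
by have := @bipartition_step _ _ _ _ e w w bS; rewrite setUid eqxx => /(_ Ge).
Qed.

Definition is_flex (T : tree) : bool := if T is Flex _ _ then true else false.

Lemma weight_rootE (K : comNzRingType) (kap : bool -> nat -> K) c T : (0 < nedge T)%N ->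
  2%:R ^+ is_flex T * weight_root kap c T = kap c (tdeg T) * weight kap c T.
Proof. by case: T => //= [T T'|Y T'] _; ring. Qed.

Lemma parse_flex (V E : eqType) T v (p : V * E) C : parse T v (p :: C) ->
  (count_mem p.2 (unzip2 (p :: C)) == 2) = is_flex T.
Proof.
case: T => [//|T T'|Y T'] /=.
  move=> [e [u [C1 [C2 [[-> ->] _ + _ _]]]]] /=; rewrite mem_cat negb_or => /andP[e1 e2].
  by rewrite unzip2_cat count_cat /= eqxx !count_disj.
move=> [C1 [C2 [CE [/parsec_head[e [C' [C1E eC _]]] _] dE _]]].
move: CE dE; rewrite C1E => -[-> ->] /= dE.
rewrite eqxx unzip2_cat count_cat !count_disj //; apply/negP => eC2.
by have := disjP _ _ dE e; rewrite /= mem_head eC2 => /(_ isT).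
Qed.

Section RootWeight.
Variables (n m : nat) (K : numDomainType) (kap : bool -> nat -> K).
Hypothesis n_gt0 : (0 < n)%N.
Implicit Types x : orgraph n m.

Lemma parses_weight T v x c : parses T v x -> bipartite x.1 ->
  2%:R ^+ nflex x.1 x.2 *
    (\prod_(w in first_part x.1 x.2) kap c (degree x.1 w) *
     \prod_(w in ~: first_part x.1 x.2) kap (~~ c) (degree x.1 w)) = weight_root kap c T.
Proof.
case: x => G [C sC] /= pT bG; have [nE _] := parses_card pT.
move: pT => [/= pT wC allv alle]; have [_ _ flexE] := parse_cactus pT wC allv alle.
case: C {sC} pT wC allv alle flexE => [|p C] pT wC allv alle flexE.
  by have := alle (Ordinal n_gt0).
have pv : p.1 = v by apply: parse_nextv pT.
have allC w : w \in unzip1 (p :: C) by have := allv w; rewrite /= pv !inE orbA orbb.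
have [bS vS] := first_partP p C bG; rewrite pv in vS.
set S := first_part G _ in bS vS *.
pose col w := if w \in S then c else ~~ c.
have wcol : walk (cstep G col) v (p :: C) v.
  apply: eq_walk wC => x e y _ _ _ /eqP Ge; rewrite /cstep Ge eqxx /col /=.
  by have := bipartition_step bS Ge; case: (x \in S) (y \in S) (c) => [] [] [].
have [dv wE] := (parse_weight G col kap).1 _ _ _ pT wcol.
have colv : col v = c by rewrite /col vS.
have prodE : \prod_(w in S) kap c (degree G w) * \prod_(w in ~: S) kap (~~ c) (degree G w)
   = kap c (tdeg T) * \prod_(w | (w \in unzip1 (p :: C)) && (w != v)) kap (col w) (deg_in G (unzip2 (p :: C)) w).
  transitivity (\prod_w kap (col w) (deg_in G (unzip2 (p :: C)) w)); last first.
    rewrite (bigD1 v) //= dv colv; congr (_ * _); apply: eq_bigl => w.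
    by rewrite allC.
  rewrite [RHS](bigID (mem S)) /=; congr (_ * _).
    by apply: eq_bigr => w wS; rewrite /col wS -bipartite_degree.
  apply: eq_big => w; first by rewrite inE.
  by rewrite inE => wS; rewrite /col (negbTE wS) -bipartite_degree.
have twice : ntwice (unzip2 (p :: C)) = (is_flex T + nflex G (p :: C))%N.
  rewrite /ntwice (cardsD1 p.2) inE (parse_flex pT); congr (_ + _)%N.
  apply: eq_card => e; rewrite !inE /= andbC; congr (_ && _); last by rewrite eq_sym.
  by apply/eqP/asboolP => h; apply/flexE.
(* [nflex] omits the first edge whereas [ntwice] counts every edge used twice; the factor 2 of a
   flexible first edge is put back on both sides. *)
apply: (mulfI (x := 2%:R ^+ is_flex T)); first by rewrite expf_neq0 // pnatr_eq0.
rewrite weight_rootE ?nE // prodE [LHS]mulrA -exprD -twice mulrCA; congr (_ * _).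
by rewrite colv in wE.
Qed.

End RootWeight.

Lemma parses_exists n T : nedge T = n -> even_cycles T ->
  exists (v : 'I_(nvert T).+1) (x : orgraph n (nvert T).+1), parses T v x /\ bipartite x.1.
Proof.
move=> nE ev; pose v : 'I_(nvert T).+1 := ord0.
have [||||C [pC vC eC]] := (parse_exists _ _).1 T v (rem v (enum 'I_(nvert T).+1)) (enum 'I_n).
- by rewrite /= rem_uniq ?enum_uniq // mem_rem_uniq ?enum_uniq // inE eqxx.
- by rewrite size_rem ?mem_enum // size_enum_ord.
- exact: enum_uniq.
- by rewrite size_enum_ord.
have [G [col [_ wC]]] := (parse_graph _ _).1 _ _ _ true pC ev.
have sC : (size C <= n.*2)%N by have := (parse_size _ _).1 _ _ _ pC; rewrite nE.
have gE : walk (cstep [ffun e => G e] col) v C v.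
  by apply: eq_walk wC => a e b _ _ _; rewrite /cstep ffunE.
exists v, ([ffun e => G e], Bseq sC); split.
  split => //=; first exact: cwalk_walk gE.
  - move=> w; rewrite vC inE; case: eqVneq => //= wv.
    by rewrite mem_rem_uniq ?enum_uniq // inE wv mem_enum.
  - by move=> e; rewrite eC mem_enum.
apply/existsP; exists [set w | col w]; apply/forallP => e /=.
have [|a [b [_ _ /andP[/eqP -> ab]]]] := walk_mem gE (e := e); first by rewrite eC mem_enum.
case: (boolP (col a)) ab => ca cb.
  apply/existsP; exists a; rewrite inE ca; apply/existsP; exists b.
  by rewrite !inE eqxx andbT; case: (col b) cb.
apply/existsP; exists b; rewrite inE (_ : col b); last by case: (col b) cb.
by apply/existsP; exists a; rewrite !inE ca setUC eqxx.
Qed.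

(* A connected graph with n edges has at most n + 1 vertices. *)
Theorem theorem1p14 (R : realType) (A : algType R[i]) (phi : {scalar A})
    (a b : A) (n : nat) (phi1 : phi 1 = 1) (ab_free : free_indep phi a b)
    (n_gt0 : (0 < n)%N) :
  kappa phi n (a * b + b * a) =
  \sum_(m < n.+2) \sum_(x in OCG n m | bipartite x.1)
    2%:R ^+ nflex x.1 x.2 *
    (\prod_(v in first_part x.1 x.2) kappa phi (degree x.1 v) a *
     \prod_(w in ~: first_part x.1 x.2) kappa phi (degree x.1 w) b +
     \prod_(v in first_part x.1 x.2) kappa phi (degree x.1 v) b *
     \prod_(w in ~: first_part x.1 x.2) kappa phi (degree x.1 w) a).
Proof.
pose kap (c : bool) k := kappa phi k (if c then a else b).
rewrite (cumulant_sum phi1 ab_free n_gt0) -/kap.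
set W := fun T => weight_root kap true T + weight_root kap false T.
pose of_tree m T (x : orgraph n m) := `[< exists v, parses T v x >].
(* A tree with only even cycles comes from exactly one representative, on [(nvert T).+1] vertices;
   all other trees have weight 0. *)
transitivity (\sum_(T <- trees n.+1 | nedge T == n)
    \sum_(m < n.+2) \sum_(x in OCG n m | bipartite x.1 && of_tree m T x) W T).
  apply: eq_bigr => T /eqP nE; case: (boolP (even_cycles T)) => ev; last first.
    by rewrite big1 => [|m _]; rewrite ?big1 // /W !weight_root_even ?addr0.
  have [v [x [pT bx]]] := parses_exists nE ev.
  have [y yO xy] := OCG_exists (parses_oriented pT).
  have [v' pT'] := parses_iso xy pT.
  have mn : ((nvert T).+1 < n.+2)%N by rewrite !ltnS -nE nvert_le.1.
  rewrite (bigD1 (Ordinal mn)) //= (big_pred1 y) => [|z /=].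
    rewrite big1 ?addr0 // => m mT; rewrite big_pred0 // => z.
    apply/negP => /and3P[_ _ /asboolP[u pz]]; have [_ mE] := parses_card pz.
    by case/eqP: mT; apply/val_inj; rewrite /= mE.
  apply/and3P/eqP => [[zO bz /asboolP[u pz]]|->].
    apply: (OCG_uniq zO yO); case: pz pT' => [p1 w1 a1 e1] [p2 w2 _ _].
    exact: parse_iso p1 p2 w1 w2 a1 e1.
  by split=> //; [exact: bipartite_iso xy bx|apply/asboolP; exists v'].
rewrite exchange_big; apply: eq_bigr => m _.
(* Conversely each representative has exactly one tree, so one term is left after the exchange. *)
rewrite (exchange_big_dep (fun x => (x \in OCG n m) && bipartite x.1)) /=.
  apply: eq_bigr => x /andP[xO bx].
  have [T [v pT]] := oriented_parse n_gt0 (OCG_oriented xO).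
  have [nE _] := parses_card pT.
  rewrite (big_rem T) /=; last by rewrite mem_trees nE.
  have -> : of_tree m T x by apply/asboolP; exists v.
  rewrite nE eqxx xO bx /= big1_seq ?addr0 => [|T' /andP[/andP[_ +]]].
    by rewrite /W -!(parses_weight kap n_gt0 _ pT bx) -mulrDr.
  move=> /asboolP[v' pT'] /=; rewrite (parses_uniq n_gt0 pT' pT).
  by rewrite mem_rem_uniq ?undup_uniq // inE eqxx.
by move=> T x _ /and3P[-> ->].
Qed.
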